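(* Assume the Vertical Template Hypothesis stated in the context. Then there exist $k,n\in\mathbb{Z}_+$ such that a vertically $k$-connected binary matroid $M$ with an $M(K_n)$-minor has no minor isomorphic to $\mathrm{PG}(3,2)\backslash L$ or to $M^*(K_6)$ if and only if $M$ is an even-cycle matroid with a blocking pair.
   Context: Binary frame template: a tuple $\Phi=(C,X,Y_0,Y_1,A_1,\Delta,\Lambda)$ where $C,X,Y_0,Y_1$ are disjoint finite sets, $A_1$ is a binary matrix with rows indexed by $X$ and columns by $Y_0\cup Y_1\cup C$, $\Lambda$ is a subgroup of $\mathrm{GF}(2)^X$ and $\Delta$ a subgroup of $\mathrm{GF}(2)^{Y_0\cup Y_1\cup C}$; moreover (standard form) there are partitions $C=C_0\cup C_1$, $X=X_0\cup X_1$ with $A_1[X_0,C_0]$ an identity matrix and $A_1[X_1,C]$ a zero matrix. A binary frame matrix is a binary matrix each of whose columns has at most two nonzero entries. A binary matrix $A'$ with rows indexed by $B$ and columns by $E$ respects $\Phi$ if: $X\subseteq B$ and $C,Y_0,Y_1\subseteq E$; $A'[X,C\cup Y_0\cup Y_1]=A_1$; there is $Z\subseteq E-(C\cup Y_0\cup Y_1)$ with $A'[X,Z]=0$, each column of $A'[B-X,Z]$ a unit vector, and $A'[B-X,E-(C\cup Y_0\cup Y_1\cup Z)]$ a binary frame matrix; each column of $A'[X,E-(C\cup Y_0\cup Y_1\cup Z)]$ lies in $\Lambda$; each row of $A'[B-X,C\cup Y_0\cup Y_1]$ lies in $\Delta$. A matrix $A$ conforms to $\Phi$ if for such $A'$ and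 $Z$ we have $A[B,E-Z]=A'[B,E-Z]$ and for each $i\in Z$ there is $j\in Y_1$ such that column $i$ of $A$ equals the sum of columns $i$ and $j$ of $A'$. A matroid $M$ conforms to $\Phi$ if $M\cong M(A)/C\backslash Y_1$ for some $A$ conforming to $\Phi$; $\mathcal{M}(\Phi)$ is the set of such matroids. A matroid $M$ is vertically $k$-connected if for every partition $(P,Q)$ of $E(M)$ with $r(P)+r(Q)-r(M)<k-1$, either $P$ or $Q$ is spanning; $M$ is cyclically $k$-connected if $M^*$ is vertically $k$-connected. Vertical Template Hypothesis: for every proper minor-closed class $\mathcal{M}$ of binary matroids there exist $k,n\in\mathbb{Z}_+$ and binary frame templates $\Phi_1,\dots,\Phi_s,\Psi_1,\dots,\Psi_t$ such that $\mathcal{M}$ contains each $\mathcal{M}(\Phi_i)$ and the duals of the matroids in each $\mathcal{M}(\Psi_j)$; every simple vertically $k$-connected member of $\mathcal{M}$ with an $M(K_n)$-minor lies in some $\mathcal{M}(\Phi_i)$; and every cosimple cyclically $k$-connected member $M$ of $\mathcal{M}$ with an $M^*(K_n)$-minor has $M^*$ in some $\mathcal{M}(\Psi_j)$. Even-cycle matroid: a binary matroid $M\binom{w}{D}$ where $D$ is the vertex-edge incidence matrix over $\mathrm{GF}(2)$ of a graph $G=(V,E)$ and $w$ is the characteristic vector of a set $W\subseteq E$ (odd edges). Resigning at a vertex $u$ replaces $W$ by its symmetric difference with the set of edges incident with $u$. Vertices $u,v$ form a blocking pair of $(G,W)$ if after some resignings every odd edge is incident with $u$ or $v$; an even-cycle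 matroid has a blocking pair if some representation $(G,W)$ of it has one. $\mathrm{PG}(3,2)\backslash L$ is $\mathrm{PG}(3,2)$ with the three points of a line deleted. *)

(* Defs.v *)
From HB Require Import structures.
From mathcomp Require Import all_boot all_order all_algebra.
From mathcomp Require Import zify.
Set Implicit Arguments.
Unset Strict Implicit.
Unset Printing Implicit Defensive.
Import GRing.Theory.
Local Open Scope ring_scope.

(* Finite matroids, given by their rank function.  The ground set E(M) is the
   whole carrier type, so that a minor lives on a subtype of the carrier. *)
Record matroid := Matroid {
  elt :> finType;
  rk : {set elt} -> nat;
  rk_card : forall S : {set elt}, (rk S <= #|S|)%N;
  rk_mono : forall S T : {set elt}, S \subset T -> (rk S <= rk T)%N;
  rk_submod : forall S T : {set elt}, (rk (S :|: T) + rk (S :&: T) <= rk S + rk T)%N }.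

Arguments rk : clear implicits.

Definition matroid_iso (M N : matroid) : Prop :=
  exists2 f : M -> N, bijective f & forall S : {set M}, rk N (f @: S) = rk M S.

Lemma rk0 (M : matroid) : rk M set0 = 0%N.
Proof. by apply/eqP; rewrite -leqn0 -(cards0 M); exact: rk_card. Qed.

Lemma rk_subD (M : matroid) (S T : {set M}) :
  S \subset T -> (rk M T <= rk M S + #|T :\: S|)%N.
Proof.
move=> sST; have := rk_submod S (T :\: S); have := rk_card (T :\: S).
by rewrite setDE setUIr setUCr setIT (setUidPr sST); lia.
Qed.

Section Dual.
Variable M : matroid.

Definition dual_rk (S : {set M}) : nat := (#|S| + rk M (~: S) - rk M setT)%N.

Lemma dual_rk_sub (S : {set M}) : (rk M setT <= #|S| + rk M (~: S))%N.
Proof.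
have := rk_subD (subsetT (~: S)).
by rewrite setTD setCK addnC.
Qed.

Lemma dual_rk_card (S : {set M}) : (dual_rk S <= #|S|)%N.
Proof.
rewrite /dual_rk; have := rk_mono (subsetT (~: S)); lia.
Qed.

Lemma dual_rk_mono (S T : {set M}) : S \subset T -> (dual_rk S <= dual_rk T)%N.
Proof.
move=> sST; have sC : ~: T \subset ~: S by rewrite setCS.
have := rk_subD sC; rewrite /dual_rk setDE setCK setIC -setDE.
have := cardsDS sST; have := subset_leq_card sST; lia.
Qed.

Lemma dual_rk_submod (S T : {set M}) :
  (dual_rk (S :|: T) + dual_rk (S :&: T) <= dual_rk S + dual_rk T)%N.
Proof.
have := rk_submod (~: S) (~: T); rewrite -setCI -setCU.
have := cardsUI S T; rewrite /dual_rk.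
have := dual_rk_sub (S :|: T); have := dual_rk_sub (S :&: T).
have := dual_rk_sub S; have := dual_rk_sub T; lia.
Qed.

Definition dual : matroid := Matroid dual_rk_card dual_rk_mono dual_rk_submod.
End Dual.

Section Minor.
Variables (M : matroid) (C D : {set M}).

Definition minor_elt : finType := {x : M | x \notin C :|: D}.

Definition minor_rk (S : {set minor_elt}) : nat :=
  (rk M (val @: S :|: C) - rk M C)%N.

Lemma minor_rk_sub (S : {set minor_elt}) : (rk M C <= rk M (val @: S :|: C))%N.
Proof. by apply: rk_mono; apply: subsetUr. Qed.

Lemma minor_rk_card S : (minor_rk S <= #|S|)%N.
Proof.
rewrite /minor_rk leq_subLR addnC -(card_imset _ val_inj).
apply: leq_trans (leq_trans (leq_addr _ _) (rk_submod _ _)) _.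
by rewrite leq_add2r rk_card.
Qed.

Lemma minor_rk_mono (S T : {set minor_elt}) :
  S \subset T -> (minor_rk S <= minor_rk T)%N.
Proof.
by move=> sST; apply: leq_sub2r; apply: rk_mono; apply: setSU; apply: imsetS.
Qed.

Lemma minor_rk_submod (S T : {set minor_elt}) :
  (minor_rk (S :|: T) + minor_rk (S :&: T) <= minor_rk S + minor_rk T)%N.
Proof.
have minor_rkE S' : (minor_rk S' + rk M C)%N = rk M (val @: S' :|: C).
  by rewrite subnK // minor_rk_sub.
rewrite -(leq_add2r (rk M C + rk M C)) addnACA !minor_rkE addnACA !minor_rkE.
rewrite imsetU setUUl imsetI; last by move=> x y _ _; apply: val_inj.
by rewrite setUIl rk_submod.
Qed.

(* M / C \ D *)
Definition minor : matroid := Matroid minor_rk_card minor_rk_mono minor_rk_submod.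
End Minor.

Definition delete (M : matroid) (D : {set M}) : matroid := minor set0 D.

Definition has_minor (M N : matroid) : Prop :=
  exists C D : {set M}, [disjoint C & D] /\ matroid_iso N (minor C D).

(* The sets of size at most 2 are independent: no loops or parallel pairs. *)
Definition simple (M : matroid) : Prop :=
  forall S : {set M}, (#|S| <= 2)%N -> rk M S = #|S|.

Definition cosimple (M : matroid) : Prop := simple (dual M).

Definition spanning (M : matroid) (S : {set M}) : Prop := rk M S = rk M setT.

(* Neither subtraction is truncated: r(M) <= r(P) + r(~: P), and k > 0
   wherever this is used. *)
Definition vertically_connected (k : nat) (M : matroid) : Prop :=
  forall P : {set M},
    (rk M P + rk M (~: P) - rk M setT < k - 1)%N ->
    spanning P \/ spanning (~: P).

Definition cyclically_connected (k : nat) (M : matroid) : Prop :=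
  vertically_connected k (dual M).

(* A GF(2)-matrix with rows indexed by B and columns indexed by E is a function
   A : B -> E -> 'F_2. *)
Section VectorMatroid.
Variables (B E : finType) (A : B -> E -> 'F_2).

Definition mcol (e : E) : {ffun B -> ('F_2)^o} := [ffun b => A b e].

Definition mspan (S : {set E}) : {vspace {ffun B -> ('F_2)^o}} :=
  <<[seq mcol e | e in S]>>%VS.

Definition vec_rk (S : {set E}) : nat := \dim (mspan S).

Lemma mspanS (S T : {set E}) : S \subset T -> (mspan S <= mspan T)%VS.
Proof.
move/subsetP=> sST; apply: sub_span => v /imageP[e eS ->].
by apply/imageP; exists e => //; apply: sST.
Qed.

Lemma vec_rk_card S : (vec_rk S <= #|S|)%N.
Proof. by apply: leq_trans (dim_span _) _; rewrite size_image. Qed.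

Lemma vec_rk_mono (S T : {set E}) : S \subset T -> (vec_rk S <= vec_rk T)%N.
Proof. by move=> sST; apply/dimvS/mspanS. Qed.

Lemma vec_rk_submod (S T : {set E}) :
  (vec_rk (S :|: T) + vec_rk (S :&: T) <= vec_rk S + vec_rk T)%N.
Proof.
rewrite /vec_rk -(dimv_sum_cap (mspan S)).
apply: leq_add; last first.
  by apply: dimvS; rewrite subv_cap !mspanS ?subsetIl ?subsetIr.
apply: dimvS.
apply/span_subvP => v /imageP[e]; rewrite inE => /orP[eS|eT] ->.
  apply: (subvP (addvSl _ _)); apply: memv_span; exact: image_f.
apply: (subvP (addvSr _ _)); apply: memv_span; exact: image_f.
Qed.

Definition vec_matroid : matroid :=
  Matroid vec_rk_card vec_rk_mono vec_rk_submod.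
End VectorMatroid.

Definition binary (M : matroid) : Prop :=
  exists (B E : finType) (A : B -> E -> 'F_2), matroid_iso M (vec_matroid A).

(* Finite multigraphs; loops and parallel edges are allowed.  The order of the
   two ends of an edge is irrelevant below. *)
Record graph := Graph {
  vert : finType;
  edge : finType;
  ends : edge -> vert * vert }.

Definition incident (G : graph) (u : vert G) (e : edge G) : bool :=
  (u == (ends e).1) || (u == (ends e).2).

(* The vertex-edge incidence matrix over GF(2); the column of a loop is 0. *)
Definition incidence (G : graph) (u : vert G) (e : edge G) : 'F_2 :=
  (u == (ends e).1)%:R + (u == (ends e).2)%:R.

Definition adj (G : graph) (F : {set edge G}) : rel (vert G) :=
  fun u v => [exists e in F, (ends e == (u, v)) || (ends e == (v, u))].

Section CycleMatroid.
Variable G : graph.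

(* |V| minus the number of components of the graph (V, F) *)
Definition graph_rk (F : {set edge G}) : nat :=
  (#|vert G| - n_comp (adj F) predT)%N.

Let V := {ffun vert G -> ('F_2)^o}.

Definition vdelta (v : vert G) : V := [ffun u => (u == v)%:R].

Lemma mcol_incidence (e : edge G) :
  mcol (@incidence G) e = vdelta (ends e).1 + vdelta (ends e).2.
Proof. by apply/ffunP=> u; rewrite !ffunE. Qed.

Lemma sum_vdelta (x : V) : x = \sum_v x v *: vdelta v.
Proof.
apply/ffunP=> u; rewrite sum_ffunE (bigD1 u) //= big1 => [|v vu].
  by rewrite !ffunE eqxx addr0 /GRing.scale /= mulr1.
by rewrite !ffunE eq_sym (negPf vu) scaler0.
Qed.

Lemma free_vdelta (p : pred (vert G)) : free [seq vdelta v | v <- enum p].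
Proof.
have freeA : free [seq vdelta v | v <- enum (vert G)].
  apply/(@basis_free _ _ fullv); rewrite basisEdim size_map -cardE.
  apply/andP; split; last by rewrite dimvf /dim /= muln1.
  apply/subvP=> x _; rewrite [x]sum_vdelta; apply: memv_suml => v _.
  by apply/memvZ/memv_span/map_f; rewrite mem_enum.
have: perm_eq (enum p ++ enum (predC p)) (enum (vert G)).
  by rewrite [enum (vert G)]enumT /enum_mem; apply/permPl; exact: perm_filterC.
move/(perm_map vdelta)/perm_free; rewrite freeA map_cat.
exact: catl_free.
Qed.

Lemma adj_sym (F : {set edge G}) : connect_sym (adj F).
Proof.
apply: sym_connect_sym => u v; apply: eq_existsb => e.
by rewrite orbC.
Qed.

Lemma F2_addrr (x : 'F_2) : x + x = 0.
Proof. exact: (@addrr_pchar2 _ (pchar_Fp (isT : prime 2))). Qed.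

Lemma V_addrr (x : V) : x + x = 0.
Proof. by apply/ffunP=> u; rewrite !ffunE F2_addrr. Qed.

Lemma graph_rkE F : graph_rk F = vec_rk (@incidence G) F.
Proof.
set A := adj F; pose U := mspan (@incidence G) F.
pose rts := enum (roots A).
pose W : {vspace V} := <<[seq vdelta v | v <- rts]>>%VS.
have dimW : \dim W = n_comp A predT.
  rewrite (eqP (free_vdelta _)) size_map -cardE.
  by apply: eq_card => v; rewrite !inE andbT.
have sym : connect_sym A := adj_sym F.
have conU u v : connect A u v -> vdelta u + vdelta v \in U.
  case/connectP=> p; elim: p u => [|w p IHp] u /=.
    by move=> _ ->; rewrite V_addrr mem0v.
  case/andP=> /exists_inP[e eF uw] pw lastv.
  have: vdelta u + vdelta w \in U.
    have -> : vdelta u + vdelta w = mcol (@incidence G) e.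
      by rewrite mcol_incidence; case/orP: uw => /eqP-> //=; rewrite addrC.
    by apply/memv_span/image_f.
  move/memvD/(_ (IHp w pw lastv)).
  by rewrite addrA -(addrA (vdelta u)) V_addrr addr0.
have UW : (U + W)%VS = fullv.
  apply/eqP; rewrite eqEsubv subvf; apply/subvP=> x _.
  rewrite [x]sum_vdelta; apply: memv_suml => v _; apply: memvZ.
  have -> : vdelta v = (vdelta v + vdelta (fingraph.root A v)) + vdelta (fingraph.root A v).
    by rewrite -addrA V_addrr addr0.
  apply: memv_add; first by apply: conU; apply: connect_root.
  by apply/memv_span/map_f; rewrite mem_enum; apply: roots_root.
pose phi (x : V) : V := [ffun r => \sum_(v | fingraph.root A v == r) x v].
have phi_lin : linear phi.
  move=> a x y; apply/ffunP=> r; rewrite !ffunE scaler_sumr -big_split.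
  by apply: eq_bigr => v _; rewrite !ffunE.
pose phiL := GRing.isLinear.Build _ _ _ _ phi phi_lin.
pose phil : {linear V -> V} := HB.pack phi phiL.
have phi_delta v : phi (vdelta v) = vdelta (fingraph.root A v).
  apply/ffunP=> r; rewrite !ffunE; case: (eqVneq r (fingraph.root A v)) => [->|rv].
    rewrite (bigD1 v) ?eqxx //= ffunE eqxx big1 ?addr0 // => u /andP[_ uv].
    by rewrite ffunE (negPf uv).
  rewrite big1 // => u /eqP ur; rewrite ffunE; case: eqP => // uv.
  by rewrite -ur uv eqxx in rv.
have phiU : (U <= lker (linfun phil))%VS.
  apply/span_subvP=> _ /imageP[e eF ->]; rewrite memv_ker lfunE /=.
  rewrite mcol_incidence [phi _](linearD phil) /= !phi_delta.
  have -> : fingraph.root A (ends e).1 = fingraph.root A (ends e).2.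
    apply/eqP; rewrite (root_connect sym); apply: connect1.
    by apply/exists_inP; exists e => //; rewrite -surjective_pairing eqxx.
  by rewrite V_addrr.
have phiW : {in W, forall x, phi x = x}.
  suff /eqlfun_inP WP : (W <= lker (linfun phil - \1%VF))%VS.
    by move=> x xW; have := WP x xW; rewrite lfunE id_lfunE.
  apply/span_subvP=> x /mapP[v]; rewrite mem_enum => /eqP rv ->.
  by apply/eqlfunP; rewrite lfunE id_lfunE /= phi_delta rv.
have UcapW : (U :&: W)%VS = 0%VS.
  apply/eqP; rewrite -subv0; apply/subvP=> x; rewrite memv_cap => /andP[xU xW].
  move/subvP/(_ x xU): phiU; rewrite memv_ker lfunE /= phiW // => /eqP->.
  exact: mem0v.
have := dimv_sum_cap U W; rewrite UW UcapW dimv0 dimvf dimW /dim /= muln1.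
by rewrite addn0 /graph_rk /vec_rk -/U => ->; rewrite addnK.
Qed.

Lemma graph_rk_card F : (graph_rk F <= #|F|)%N.
Proof. by rewrite graph_rkE vec_rk_card. Qed.

Lemma graph_rk_mono (F F' : {set edge G}) :
  F \subset F' -> (graph_rk F <= graph_rk F')%N.
Proof. by rewrite !graph_rkE; apply: vec_rk_mono. Qed.

Lemma graph_rk_submod (F F' : {set edge G}) :
  (graph_rk (F :|: F') + graph_rk (F :&: F') <= graph_rk F + graph_rk F')%N.
Proof. by rewrite !graph_rkE; apply: vec_rk_submod. Qed.

Definition cycle_matroid : matroid :=
  Matroid graph_rk_card graph_rk_mono graph_rk_submod.
End CycleMatroid.

Definition Kgraph (n : nat) : graph :=
  @Graph 'I_n {p : 'I_n * 'I_n | (p.1 < p.2)%N} val.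

Definition MK (n : nat) : matroid := cycle_matroid (Kgraph n).

(* The matrix with the characteristic vector of W as its extra row None,
   above the incidence matrix of G. *)
Definition even_cycle_matrix (G : graph) (W : {set edge G})
    (r : option (vert G)) (e : edge G) : 'F_2 :=
  if r is Some u then incidence u e else (e \in W)%:R.

Definition even_cycle_matroid (G : graph) (W : {set edge G}) : matroid :=
  vec_matroid (even_cycle_matrix W).

(* Resigning at u adds row u of the incidence matrix to the row of W; loops at
   u are incident with u twice, so they keep their sign. *)
Definition resign (G : graph) (W : {set edge G}) (u : vert G) : {set edge G} :=
  let star := [set e | incidence u e != 0] in (W :\: star) :|: (star :\: W).

Definition blocking_pair (G : graph) (W : {set edge G}) (u v : vert G) : Prop :=
  u != v /\
  exists us : seq (vert G),
    forall e, e \in foldl (@resign G) W us -> incident u e || incident v e.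

Definition even_cycle_with_blocking_pair (M : matroid) : Prop :=
  exists (G : graph) (W : {set edge G}),
    matroid_iso M (even_cycle_matroid W) /\
    exists u v : vert G, blocking_pair W u v.

(* Over GF(2) the points of a projective space are the nonzero vectors. *)
Definition PG32_point : finType := {v : 'rV['F_2]_4 | v != 0}.

Definition PG32 : matroid :=
  vec_matroid (fun (i : 'I_4) (p : PG32_point) => val p 0 i).

Definition PG32_line (L : {set PG32}) : Prop :=
  exists2 U : {vspace 'rV['F_2]_4},
    \dim U = 2%N & L = [set p : PG32_point | val p \in U].

Definition has_PG32_delete_line_minor (M : matroid) : Prop :=
  exists2 L : {set PG32}, PG32_line L & has_minor M (delete L).

(* The disjoint finite sets C, X, Y_0, Y_1 are types, and Y_0 u Y_1 u C is the
   sum type tY0 + tY1 + tC.  In tstd, sigma is the bijection between C_0 and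
   X_0 along which A_1[X_0, C_0] is an identity matrix. *)
Record frame_template := FrameTemplate {
  tC : finType;
  tX : finType;
  tY0 : finType;
  tY1 : finType;
  tA1 : tX -> tY0 + tY1 + tC -> 'F_2;
  tDelta : {set {ffun tY0 + tY1 + tC -> 'F_2}};
  tLambda : {set {ffun tX -> 'F_2}};
  tDelta_group : zmod_closed tDelta;
  tLambda_group : zmod_closed tLambda;
  tstd : exists (C0 : {set tC}) (X0 : {set tX})
      (sigma : {c | c \in C0} -> {x | x \in X0}),
    [/\ bijective sigma,
        forall x c, tA1 (val x) (inr (val c)) = (x == sigma c)%:R
      & forall x c, x \notin X0 -> tA1 x (inr c) = 0] }.

Definition tcore (Phi : frame_template) : finType := (tY0 Phi + tY1 Phi + tC Phi)%type.

(* Each column has at most two nonzero entries; only the columns in S count. *)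
Definition frame_columns (B E : finType) (A : B -> E -> 'F_2) (S : {set E}) : Prop :=
  forall e, e \in S -> (#|[set b | (A b e != 0)%R]| <= 2)%N.

(* Up to renaming, the row set B is X + R with R = B - X, and the column set E
   is (Y_0 + Y_1 + C) + F; thus Z is a subset of F. *)
Definition respects (Phi : frame_template) (R F : finType)
    (A' : tX Phi + R -> tcore Phi + F -> 'F_2) (Z : {set F}) : Prop :=
  [/\ forall x y, A' (inl x) (inl y) = tA1 x y,
      (forall f, f \in Z ->
        (forall x, A' (inl x) (inr f) = 0) /\
        (exists r0, forall r, A' (inr r) (inr f) = (r == r0)%:R)),
      frame_columns (fun r f => A' (inr r) (inr f)) (~: Z),
      forall f, f \notin Z -> [ffun x => A' (inl x) (inr f)] \in tLambda Phi
    & forall r, [ffun y => A' (inr r) (inl y)] \in tDelta Phi].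

Definition matrix_conforms (Phi : frame_template) (R F : finType)
    (A : tX Phi + R -> tcore Phi + F -> 'F_2) : Prop :=
  exists (A' : tX Phi + R -> tcore Phi + F -> 'F_2) (Z : {set F}),
    [/\ respects A' Z,
        forall b y, A b (inl y) = A' b (inl y),
        forall b f, f \notin Z -> A b (inr f) = A' b (inr f)
      & forall f, f \in Z -> exists j : tY1 Phi,
          forall b, A b (inr f) = A' b (inr f) + A' b (inl (inl (inr j)))].

(* M is in the class M(Phi) *)
Definition conforms (Phi : frame_template) (M : matroid) : Prop :=
  exists (R F : finType) (A : tX Phi + R -> tcore Phi + F -> 'F_2),
    matrix_conforms A /\
    matroid_iso M
      (@minor (vec_matroid A)
        [set (inl (inr c) : tcore Phi + F) | c : tC Phi]
        [set (inl (inl (inr j)) : tcore Phi + F) | j : tY1 Phi]).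

(* As has_minor is up to isomorphism, so is a minor-closed class. *)
Definition minor_closed (P : matroid -> Prop) : Prop :=
  forall M N : matroid, P M -> has_minor M N -> P N.

Definition proper_minor_closed_binary (P : matroid -> Prop) : Prop :=
  [/\ forall M, P M -> binary M,
      minor_closed P
    & exists2 M, binary M & ~ P M].

Definition vertical_template_hypothesis : Prop :=
  forall P : matroid -> Prop, proper_minor_closed_binary P ->
  exists k n : nat, (0 < k)%N /\ (0 < n)%N /\
  exists (s t : nat) (Phi : 'I_s -> frame_template) (Psi : 'I_t -> frame_template),
    [/\ forall i M, conforms (Phi i) M -> P M,
        forall j M, conforms (Psi j) M -> P (dual M),
        forall M, P M -> simple M -> vertically_connected k M ->
          has_minor M (MK n) -> exists i, conforms (Phi i) M
      & forall M, P M -> cosimple M -> cyclically_connected k M ->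
          has_minor M (dual (MK n)) -> exists j, conforms (Psi j) (dual M)].

(* Main.v *)
(* In both directions M is compared with the matroids M(G)/T: the edge ab of a
   graph is represented by p a + p b, where the vectors p of the vertices have
   only one linear relation, namely that a set T of four of them has sum 0.
   These are the even-cycle matroids with a blocking pair: merging the vertices
   of T in pairs gives the graph, and the odd edges are those that change ends.

   The Vertical Template Hypothesis is applied to the binary matroids without
   minor PG(3,2)\L.  If a template conforms to this class then its core spans no
   nonzero set of vertices, as M(K_6)/V(K_6) is PG(3,2), and Lambda lies in the
   span of C, as a signed K_4 is PG(3,2) without two points.  Up to projection,
   the members are then represented by the edges of a graph, by the differences
   of fixed points indexed by Y_1, and by vectors indexed by Y_0.  Any relations
   between these that do not reduce to one 4-set T again produce PG(3,2), or
   PG(3,2) without two points.  The minor M*(K_6) is not needed here.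

   In minors of M(G)/T the set T remains even and of size at most 4.  Then the
   star of each vertex outside T is a cocycle, so has at least m elements, where
   m is the least size of a nonempty cocycle; as the stars together have at most
   2n elements, the rank is too small for M*(K_6), where n = 15, r = 10, m = 3.
   For PG(3,2)\L, where n = 12, r = 4, m = 6, equality forces all 12 elements to
   be a cocycle, but the cocycles have at most 8. *)

From HB Require Import structures.
Require Import Defs.
From mathcomp Require Import all_boot all_order all_algebra all_field.
From mathcomp Require Import zify.
Set Implicit Arguments.
Unset Strict Implicit.
Unset Printing Implicit Defensive.
Import GRing.Theory.
Local Open Scope ring_scope.

(** * Linear algebra over GF(2) *)

(** Minors are exhibited by weights. A linear map to GF(2)^4 gives a weight to each vertex, all
    elements of weight 0 are contracted, and a linear map in the other direction certifies that
    nothing more is identified. Any two points lie on a line that may be deleted, so a minor that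
    misses two points of PG(3,2) is still good enough. Weights can be prescribed freely on vertices
    that are independent modulo the contracted elements; therefore only the relations between
    vertices matter, and over GF(2) these are the subsets of sum 0, which determine a binary
    matroid.

    The obstacle is [Y_0]: its vectors are arbitrary and a priori unrelated to the vertices. They
    are few, so high vertical connectivity together with a large rank forces them into the span of
    the other elements; this is what determines [k] and [n]. The hypothesis speaks of simple
    matroids only, hence the detour through simplifications. *)

Notation F2 := ('F_2)^o.

Lemma F2_cases (x : 'F_2) : x = 0 \/ x = 1.
Proof.
case: x => [[|[|n]]] // p; [left | right]; exact/val_inj.
Qed.

Lemma F2_addb (a b : bool) : a%:R + b%:R = (a (+) b)%:R :> 'F_2.
Proof. by case: a; case: b => //; exact/val_inj. Qed.

Lemma F2_natr n : n%:R = (odd n)%:R :> 'F_2.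
Proof.
elim: n => [//|n IHn]; rewrite mulrS IHn /=.
by case: (odd n); exact/val_inj.
Qed.

Section Char2.
Variable V : vectType 'F_2.

Lemma addF2 (x : V) : x + x = 0.
Proof. by rewrite -mulr2n -scaler_nat (_ : 2%:R = 0) ?scale0r //; exact/val_inj. Qed.

Lemma oppF2 (x : V) : - x = x.
Proof. by apply/eqP; rewrite eq_sym -subr_eq0 opprK addF2. Qed.

Lemma eqF2 (x y : V) : x + y = 0 -> x = y.
Proof. by move/eqP; rewrite addr_eq0 oppF2 => /eqP. Qed.

Lemma addF2_cancel (a b c : V) : (a + b) + (a + c) = b + c.
Proof. by rewrite addrACA addF2 add0r. Qed.

Lemma addF2K (x a : V) : a + x + x = a.
Proof. by rewrite -addrA addF2 addr0. Qed.

Lemma addF2AC (x a y : V) : a + x + y = a + y + x.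
Proof. exact: addrAC. Qed.

Lemma memv_eq (U : {vspace V}) (x y : V) : x \in U -> y = x -> y \in U.
Proof. by move=> xU ->. Qed.

Lemma sum_setF2 (E : finType) (f : E -> V) (c : E -> 'F_2) :
  \sum_e c e *: f e = \sum_(e in [set e | c e != 0]) f e.
Proof.
rewrite [RHS]big_mkcond; apply: eq_bigr => e _; rewrite inE.
by case: (F2_cases (c e)) => ->; rewrite ?scale0r ?scale1r ?eqxx.
Qed.

Lemma sum_symdiff (E : finType) (f : E -> V) (S T : {set E}) :
  \sum_(e in (S :\: T) :|: (T :\: S)) f e = \sum_(e in S) f e + \sum_(e in T) f e.
Proof.
rewrite !(big_mkcond (fun e => e \in _)) -big_split; apply: eq_bigr => e _ /=.
by rewrite !inE; case: (e \in S); case: (e \in T); rewrite ?addr0 ?add0r ?addF2.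
Qed.

Definition sp (E : finType) (f : E -> V) (S : {set E}) : {vspace V} :=
  <<[seq f e | e in S]>>%VS.

Lemma mem_sp (E : finType) (f : E -> V) (S : {set E}) e : e \in S -> f e \in sp f S.
Proof. by move=> eS; apply/memv_span/image_f. Qed.

Section Span.
Variables (E : finType) (f : E -> V).

Lemma sp_subP (S : {set E}) (U : {vspace V}) :
  reflect (forall e, e \in S -> f e \in U) (sp f S <= U)%VS.
Proof.
apply: (iffP idP) => [/span_subvP h e eS|h]; first exact/h/image_f.
by apply/span_subvP=> v /imageP[e eS ->]; apply: h.
Qed.

Lemma spS (S T : {set E}) : S \subset T -> (sp f S <= sp f T)%VS.
Proof. by move=> /subsetP sST; apply/sp_subP => e /sST; exact: mem_sp. Qed.

Lemma spP (S : {set E}) v :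
  reflect (exists2 J : {set E}, J \subset S & v = \sum_(e in J) f e) (v \in sp f S).
Proof.
apply: (iffP idP) => [|[J sJS ->]]; last first.
  by apply: memv_suml => e eJ; apply/mem_sp/(subsetP sJS).
have : forall e, e \in enum (mem S) -> e \in S by move=> e; rewrite mem_enum.
rewrite /sp /image_mem; elim: (enum _) v => [|e s IHs] v sub.
  rewrite /= span_nil memv0 => /eqP->; exists set0; rewrite ?sub0set //.
  by rewrite big_set0.
rewrite /= span_cons => /memv_addP[_ /vlineP[c ->] [w ws ->]].
have [|J sJ ->] := IHs w _ ws; first by move=> x xs; apply: sub; rewrite in_cons xs orbT.
have eS : e \in S by apply: sub; rewrite mem_head.
case: (F2_cases c) => ->; first by exists J; rewrite // scale0r add0r.
exists ((J :\: [set e]) :|: ([set e] :\: J)).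
  apply/subsetP=> x; rewrite !inE => /orP[/andP[_ /(subsetP sJ)]//|/andP[_ /eqP->]//].
by rewrite sum_symdiff big_set1 scale1r addrC.
Qed.

Lemma spU (S T : {set E}) : sp f (S :|: T) = (sp f S + sp f T)%VS.
Proof.
apply/eqP; rewrite eqEsubv subv_add !spS ?subsetUl ?subsetUr // !andbT.
apply/sp_subP => e; rewrite inE => /orP[] /mem_sp h.
  by apply: (subvP (addvSl _ _)).
by apply: (subvP (addvSr _ _)).
Qed.

Lemma sp_imset (E' : finType) (h : E' -> E) (S : {set E'}) :
  sp f (h @: S) = sp (f \o h) S.
Proof.
apply/eqP; rewrite eqEsubv; apply/andP; split.
  by apply/sp_subP => _ /imsetP[x xS ->]; apply: (mem_sp (f \o h)).
by apply/span_subvP => _ /imageP[e eS ->] /=; apply/mem_sp/imset_f.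
Qed.

Lemma eq_sp (g : E -> V) S : f =1 g -> sp f S = sp g S.
Proof. by move=> fg; rewrite /sp; congr (<< _ >>)%VS; apply: eq_image. Qed.

Lemma sp_set0 : sp f set0 = 0%VS.
Proof. by apply/eqP; rewrite -subv0; apply/sp_subP=> e; rewrite inE. Qed.

Lemma dim_sp_card S : (\dim (sp f S) <= #|S|)%N.
Proof. by apply: leq_trans (dim_span _) _; rewrite size_image. Qed.

Lemma dim_sp_dep S : (\dim (sp f S) < #|S|)%N ->
  exists J : {set E}, [/\ J \subset S, J != set0 & \sum_(e in J) f e = 0].
Proof.
have [n] := ubnP #|S|; elim: n S => // n IHn S /ltnSE leSn ltS.
have /existsP[e /andP[eS ef]] : [exists e, (e \in S) && (f e \in sp f (S :\ e))].
  apply/contraT=> /existsPn h; suff: (#|S| <= \dim (sp f S))%N by lia.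
  have: free [seq f e | e in S].
    have: uniq (enum (mem S)) by exact: enum_uniq.
    have : forall e, e \in enum (mem S) -> e \in S by move=> e; rewrite mem_enum.
    rewrite /image_mem; elim: (enum _) => [|e s IHs] sub /=; first by rewrite nil_free.
    case/andP=> es us; rewrite free_cons IHs //; last first.
      by move=> x xs; apply: sub; rewrite inE xs orbT.
    rewrite andbT; have eS := sub e (mem_head _ _); have := h e; rewrite eS /=.
    apply: contra; apply/subvP/span_subvP => _ /mapP[x xs ->].
    apply: mem_sp; rewrite !inE sub ?inE ?xs ?orbT // !andbT.
    by apply: contraNneq es => <-.
  by rewrite /sp /free => /eqP->; rewrite size_image.
have [J sJ fe] := spP (S :\ e) (f e) ef.
have eJ : e \notin J by apply/negP=> /(subsetP sJ); rewrite !inE eqxx.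
exists (e |: J); split.
- by apply/subsetP=> x; rewrite !inE => /orP[/eqP->//|/(subsetP sJ)]; rewrite !inE => /andP[].
- by apply/set0Pn; exists e; rewrite !inE eqxx.
- by rewrite big_setU1 //= -fe addF2.
Qed.

Lemma dep_dim_sp (S J : {set E}) : J \subset S -> J != set0 ->
  \sum_(e in J) f e = 0 -> (\dim (sp f S) < #|S|)%N.
Proof.
move=> sJS /set0Pn[e eJ]; rewrite (bigD1 e) //= => /eqF2 fe.
have eS := subsetP sJS e eJ.
have : (sp f S <= sp f (S :\ e))%VS.
  apply/sp_subP => x xS; case: (eqVneq x e) => [->|xe]; last by apply/mem_sp; rewrite !inE xe.
  rewrite fe; apply: memv_suml => y /andP[yJ ye].
  by apply: mem_sp; rewrite !inE ye (subsetP sJS).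
move/dimvS; move: (dim_sp_card (S :\ e)); rewrite [#|S|](cardsD1 e) eS; lia.
Qed.

End Span.

End Char2.

(* Decides identities between sums in characteristic 2: the copies of the last
   summand are moved to the right, where they cancel. *)
Ltac f2 :=
  apply: eqF2; rewrite ?(oppF2, addr0, add0r) -[LHS]add0r !addrA;
  repeat match goal with |- ?a + ?x = 0 => rewrite !(addF2K x, addF2AC x) end;
  by [].

(* Over GF(2) the linear relations of a family are its subsets of sum 0. *)
Lemma ext_hom (V W : vectType 'F_2) (I : finType) (x : I -> V) (w : I -> W) :
  (forall J : {set I}, \sum_(i in J) x i = 0 -> \sum_(i in J) w i = 0) ->
  exists phi : 'Hom(V, W), forall i, phi (x i) = w i.
Proof.
move=> h; pose U := {ffun I -> F2}.
have lin (Z : vectType 'F_2) (y : I -> Z) : linear (fun c : U => \sum_i (c i : 'F_2) *: y i).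
  move=> a c d; rewrite scaler_sumr -big_split; apply: eq_bigr => i _ /=.
  by rewrite !ffunE scalerDl scalerA.
pose L (Z : vectType 'F_2) (y : I -> Z) :=
  GRing.isLinear.Build _ _ _ _ _ (lin Z y).
pose Lx : {linear U -> V} := HB.pack (fun c : U => \sum_i (c i : 'F_2) *: x i) (L V x).
pose Lw : {linear U -> W} := HB.pack (fun c : U => \sum_i (c i : 'F_2) *: w i) (L W w).
exists (linfun Lw \o (linfun Lx)^-1)%VF => i; rewrite comp_lfunE.
pose d : U := [ffun j => (j == i)%:R].
have dE (Z : vectType 'F_2) (y : I -> Z) : \sum_j (d j : 'F_2) *: y j = y i.
  rewrite (bigD1 i) //= ffunE eqxx scale1r big1 ?addr0 // => j ji.
  by rewrite ffunE (negPf ji) scale0r.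
have ximg : x i \in limg (linfun Lx).
  by rewrite -(dE _ x) -[X in X \in _]/(Lx d) -lfunE memv_img ?memvf.
set c := (linfun Lx)^-1%VF (x i).
have cx : Lx c = x i by rewrite -lfunE limg_lfunVK.
rewrite lfunE -[LHS]/(Lw c) -(dE _ w) -[RHS]/(Lw d).
(* [c] and the unit vector [d] have the same image under [Lx], so the support of [c - d] is a set of
   sum 0 for [x], hence for [w]. *)
apply/eqP; rewrite -subr_eq0 -linearB; apply/eqP.
apply: (etrans (sum_setF2 w (fun i => (c - d) i))); apply: h.
apply: (etrans (esym (sum_setF2 x (fun i => (c - d) i)))).
rewrite -[LHS]/(Lx (c - d)) linearB cx.
by rewrite -[X in _ - X]/(\sum_j (d j : 'F_2) *: x j) dE subrr.
Qed.

(** The projection away from [U] serves as the quotient map by [U] while its values remain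
    representatives in [V]. *)
Lemma hom_lker (V : vectType 'F_2) (U : {vspace V}) :
  exists2 phi : 'End(V), lker phi = U & forall v, v - phi v \in U.
Proof.
exists (\1 - projv U)%VF; last first.
  by move=> v; rewrite add_lfunE opp_lfunE id_lfunE opprB addrC subrK memv_proj.
apply/vspaceP=> v; rewrite memv_ker add_lfunE opp_lfunE id_lfunE subr_eq0.
by apply/eqP/idP => [->|/projv_id->//]; apply: memv_proj.
Qed.

(** * Representations modulo a subspace *)

(* The matroid M is represented by f in the quotient of V by K. *)
Definition rep (M : matroid) (V : vectType 'F_2) (f : M -> V) (K : {vspace V}) : Prop :=
  forall S : {set M}, (rk M S + \dim K)%N = \dim (sp f S + K).

Lemma rep0E (M : matroid) (V : vectType 'F_2) (f : M -> V) :
  rep f 0 <-> forall S, rk M S = \dim (sp f S).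
Proof.
by split=> h S; have := h S; rewrite dimv0 addn0 addv0.
Qed.

Lemma rep_rk (M : matroid) (V : vectType 'F_2) (f : M -> V) (S : {set M}) :
  rep f 0 -> rk M S = \dim (sp f S).
Proof. by move/rep0E. Qed.

Lemma dim_quot (V W : vectType 'F_2) (phi : 'Hom(V, W)) (U K : {vspace V}) :
  (K <= U)%VS -> (K <= lker phi)%VS -> (forall v, v \in U -> phi v = 0 -> v \in K) ->
  \dim U = (\dim (phi @: U) + \dim K)%N.
Proof.
move=> KU Kk h; rewrite -(limg_ker_dim phi U) addnC; congr (_ + \dim _)%N.
apply/eqP; rewrite eqEsubv subv_cap KU Kk !andbT.
by apply/subvP=> v; rewrite memv_cap memv_ker => /andP[vU /eqP]; apply: h.
Qed.

Lemma limg_sp (V W : vectType 'F_2) (phi : 'Hom(V, W)) (E : finType) (f : E -> V)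
  (S : {set E}) : (phi @: sp f S)%VS = sp (phi \o f) S.
Proof. by rewrite limg_span /sp -map_comp. Qed.

Definition minor_val (M : matroid) (C D : {set M}) (x : minor C D) : M := val x.

Lemma minor_val_inj (M : matroid) (C D : {set M}) : injective (@minor_val M C D).
Proof. exact: val_inj. Qed.

Lemma minor_rkE (M : matroid) (C D : {set M}) (S : {set minor C D}) :
  rk (minor C D) S = (rk M (@minor_val M C D @: S :|: C) - rk M C)%N.
Proof. by []. Qed.

Section Rep.
Variables (M : matroid) (V : vectType 'F_2).
Implicit Type (f : M -> V) (K : {vspace V}).

Lemma rep_quot (W : vectType 'F_2) (phi : 'Hom(V, W)) f K :
  (K <= lker phi)%VS -> (forall v, v \in (sp f setT + K)%VS -> phi v = 0 -> v \in K) ->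
  rep f K <-> rep (phi \o f) 0.
Proof.
move=> Kk h; rewrite rep0E.
have E S : \dim (sp f S + K) = (\dim (sp (phi \o f) S) + \dim K)%N.
  rewrite (@dim_quot _ _ phi _ K) ?addvSr //.
    rewrite limgD limg_sp; congr (\dim _ + _)%N.
    by move: Kk; rewrite lkerE => /eqP->; rewrite addv0.
  by move=> v /(subvP (addvS (spS f (subsetT S)) (subvv K))); apply: h.
by split=> r S; have := r S; rewrite ?E; lia.
Qed.

Lemma rep_iso (N : matroid) (h : N -> M) f K :
  (forall S : {set N}, rk M (h @: S) = rk N S) -> rep f K -> rep (f \o h) K.
Proof. by move=> hr r S; rewrite -sp_imset -hr r. Qed.

Lemma rep_minor (C D : {set M}) f K :
  rep f K -> rep (f \o @minor_val M C D) (K + sp f C).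
Proof.
move=> r S; rewrite -sp_imset minor_rkE; set T := _ @: S.
have := r C; have := r (T :|: C); have := rk_mono (subsetUr T C).
rewrite spU (addvC K) addvA; lia.
Qed.

(** Everything outside [C] and the image of [h] is deleted. Describing a minor by an injection and a
    contracted set avoids working in nested subtypes. *)
Lemma rep_sub f K (N : matroid) (h : N -> M) (C : {set M}) :
  rep f K -> injective h -> (forall x, h x \notin C) ->
  rep (f \o h) (K + sp f C) -> has_minor M N.
Proof.
move=> r hi hC rN; pose D : {set M} := ~: (C :|: h @: setT).
have hD x : h x \notin C :|: D.
  by rewrite !inE (negPf (hC x)) /= negbK imset_f ?inE.
exists C, D; split.
  by rewrite disjoint_sym disjoints_subset setCS subsetUl.
pose h' x : minor C D := Sub (h x) (hD x).
have h'E (S : {set N}) : @minor_val M C D @: (h' @: S) = h @: S.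
  by rewrite -imset_comp; apply: eq_imset.
exists h'.
  apply: inj_card_bij => [x y /(congr1 val) /hi//|].
  rewrite -[leqRHS]cardsT -(card_imset setT hi) -[leqLHS]cardsT.
  rewrite -(card_imset setT (@minor_val_inj M C D)).
  apply/subset_leq_card/subsetP=> _ /imsetP[[y yD] _ ->].
  by move: yD; rewrite /minor_val /= !inE; case: (y \in C) => //=; rewrite negbK.
move=> S; have := rN S; have := @rep_minor C D f K r (h' @: S).
rewrite -[sp (f \o @minor_val M C D) _]sp_imset h'E -sp_imset; lia.
Qed.

Lemma has_minor_rep f K (N : matroid) : rep f K -> has_minor M N ->
  exists (C : {set M}) (h : N -> M),
    [/\ injective h, forall x, h x \notin C & rep (f \o h) (K + sp f C)].
Proof.
move=> r [C [D [_ [g gb gr]]]]; exists C, (@minor_val M C D \o g); split.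
- by apply: inj_comp; [exact: minor_val_inj|exact: bij_inj].
- by move=> x; have := valP (g x); rewrite inE negb_or => /andP[].
- move=> S; rewrite -gr (@rep_minor C D f K r (g @: S)); congr (\dim (_ + _)).
  by rewrite (sp_imset _ g).
Qed.

End Rep.

Lemma has_minor_trans_rep (M N L : matroid) (V : vectType 'F_2) (f : M -> V) K :
  rep f K -> has_minor M N -> has_minor N L -> has_minor M L.
Proof.
move=> r /(has_minor_rep r)[C [h [hi hC rN]]] /(has_minor_rep rN)[C' [h' [hi' hC' rL]]].
apply: (rep_sub (h := h \o h') (C := C :|: h @: C') r).
- exact: inj_comp.
- move=> x; rewrite inE negb_or hC; apply/imsetP=> -[y yC /hi e].
  by move: (hC' x); rewrite e yC.
- by rewrite spU sp_imset addvA.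
Qed.

Section Rep0.
Variables (M : matroid) (V : vectType 'F_2) (f : M -> V).
Hypothesis r : rep f 0.

Lemma rep_loop (x : M) : (f x == 0) = (rk M [set x] == 0%N).
Proof.
rewrite (rep_rk _ r).
apply/eqP/eqP => [fx|h].
  suff -> : sp f [set x] = 0%VS by rewrite dimv0.
  by apply/eqP; rewrite -subv0; apply/sp_subP => y; rewrite inE => /eqP->; rewrite fx mem0v.
have /eqP := h; rewrite dimv_eq0 => /eqP h0.
by apply/eqP; rewrite -memv0 -h0 mem_sp ?inE.
Qed.

Lemma rep_dep (S : {set M}) :
  (rk M S < #|S|)%N <->
  exists J : {set M}, [/\ J \subset S, J != set0 & \sum_(e in J) f e = 0].
Proof.
rewrite (rep_rk _ r).
by split=> [/dim_sp_dep//|[J [s0 n0]]]; apply: dep_dim_sp.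
Qed.

(** Binary representations are unique: a minimal dependent set has sum 0 in every representation.
    Removing such a circuit from [J] leaves a smaller set of sum 0. *)
Lemma rep_unique (W : vectType 'F_2) (g : M -> W) : rep g 0 ->
  forall J : {set M}, \sum_(e in J) f e = 0 -> \sum_(e in J) g e = 0.
Proof.
move=> r' J; have [n] := ubnP #|J|; elim: n J => // n IHn J /ltnSE leJ f0.
have [->|J0] := eqVneq J set0; first by rewrite big_set0.
have dJ : (rk M J < #|J|)%N by apply/rep_dep; exists J.
have [C Cmin sCJ] := minset_exists (P := fun C : {set M} => (rk M C < #|C|)%N) dJ.
have /minsetP[dC minC] := Cmin.
have min_rel (X : {set M}) : X \subset C -> (rk M X < #|X|)%N -> X = C.
  by move=> sX dX; apply: minC.
have circ (Z : vectType 'F_2) (k : M -> Z) : rep k 0 -> \sum_(e in C) k e = 0.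
  move=> rk0; have : (rk M C < #|C|)%N := dC.
  rewrite (rep_rk _ rk0).
  case/dim_sp_dep=> X [sX X0 kX]; rewrite -(min_rel X sX) //.
  rewrite (rep_rk _ rk0).
  exact: dep_dim_sp kX.
have C0 : C != set0.
  by apply/eqP=> C0; move: dC; rewrite C0 cards0.
have fC : \sum_(e in C) f e = 0 := circ _ _ r.
have gC : \sum_(e in C) g e = 0 := circ _ _ r'.
move: f0; rewrite (big_setID C) (setIidPr sCJ) /= fC add0r => f0.
rewrite (big_setID C) (setIidPr sCJ) /= gC add0r; apply: IHn => //.
rewrite (leq_trans _ leJ) // cardsD (setIidPr sCJ).
by have := subset_leq_card sCJ; move: C0; rewrite -card_gt0; lia.
Qed.

Lemma rep_rel (W : vectType 'F_2) (g : M -> W) :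
  (forall J : {set M}, \sum_(e in J) f e = 0 <-> \sum_(e in J) g e = 0) -> rep g 0.
Proof.
move=> h; have [phi phif] := ext_hom (fun J => proj1 (h J)).
have [psi psig] := ext_hom (fun J => proj2 (h J)).
have e : phi \o f =1 g by move=> x /=; rewrite phif.
suff : rep (phi \o f) 0 by move=> s S; rewrite s (eq_sp _ e).
apply/(@rep_quot _ _ _ phi f 0) => //; first exact: sub0v.
move=> v; rewrite addv0 => /spP[J _ ->]; rewrite linear_sum memv0 => h0.
apply/eqP/h; rewrite -[RHS]h0; apply: eq_bigr => i _; rewrite -phif //.
Qed.

End Rep0.

Lemma rep_hom (M : matroid) (V W : vectType 'F_2) (f : M -> V) (g : M -> W) :
  rep f 0 -> rep g 0 -> exists phi : 'Hom(V, W), forall e, phi (f e) = g e.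
Proof. by move=> rf rg; apply: ext_hom => J; exact: rep_unique. Qed.

Lemma rep_vec (B E : finType) (A : B -> E -> 'F_2) :
  rep (mcol A : vec_matroid A -> _) 0.
Proof. by apply/rep0E. Qed.

Lemma binary_rep (M : matroid) : binary M <->
  exists (B : finType) (f : M -> {ffun B -> F2}), rep f 0.
Proof.
split=> [[B [E [A [h hb hr]]]]|[B [f r]]].
  exists B, (mcol A \o h); exact: (rep_iso hr (rep_vec (A := A))).
exists B, M, (fun b e => f e b); exists id; first by exists id.
move=> S; rewrite imset_id (rep_rk _ r) (rep_rk _ (@rep_vec _ _ _)).
by congr (\dim _); apply: eq_sp => x; apply/ffunP=> b; rewrite ffunE.
Qed.

Section Minor_criterion.
Variables (M N : matroid) (V W : vectType 'F_2).
Variables (f : M -> V) (K : {vspace V}) (g : N -> W).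
Variables (phi : 'Hom(V, W)) (sigma : 'Hom(W, V)).

Definition killed : {vspace V} := (K + sp f [set e | phi (f e) == 0%R])%VS.

Lemma mem_killedK v : v \in K -> v \in killed.
Proof. exact/subvP/addvSl. Qed.

Lemma mem_killed e : phi (f e) = 0 -> f e \in killed.
Proof.
by move=> e0; apply/(subvP (addvSr K _))/mem_sp; rewrite inE e0.
Qed.

(* Contract the elements that phi kills; sigma shows that nothing else is
   identified. *)
Lemma minor_criterion :
  rep f K -> rep g 0 -> injective g -> (forall x, g x != 0) -> (K <= lker phi)%VS ->
  (forall x, exists2 e, phi (f e) = g x & f e - sigma (g x) \in killed) ->
  has_minor M N.
Proof.
move=> rf rg gi g0 Kk hx.
have hx' x : exists e, (phi (f e) == g x) && (f e - sigma (g x) \in killed).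
  by have [e e1 e2] := hx x; exists e; rewrite e1 e2 eqxx.
pose h x := xchoose (hx' x).
have hE x : phi (f (h x)) = g x by have /andP[/eqP] := xchooseP (hx' x).
have hU x : f (h x) - sigma (g x) \in killed by have /andP[] := xchooseP (hx' x).
have Uk : (killed <= lker phi)%VS.
  rewrite subv_add Kk; apply/sp_subP => e; rewrite inE.
  by rewrite memv_ker.
apply: (rep_sub (h := h) (C := [set e | phi (f e) == 0]) rf).
- by move=> x y hxy; apply: gi; rewrite -!hE hxy.
- by move=> x; rewrite inE hE.
apply/(rep_quot (phi := phi)) => //; last first.
  by move=> S; rewrite rg; congr (\dim (_ + _)); apply: eq_sp => x /=; rewrite hE.
move=> v /memv_addP[_ /spP[J _ ->] [u uU ->]].
rewrite linearD /= (eqP (_ : phi u == 0)) ?addr0; last by rewrite -memv_ker (subvP Uk).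
move=> h0; rewrite memvD //.
have g0J : \sum_(e in J) g e = 0.
  by rewrite -[RHS]h0 linear_sum; apply: eq_bigr => x _; rewrite /= hE.
(* The sum of [g] over [J] is 0, so its image under [sigma] can be subtracted for free; then every
   single term is killed. *)
have -> : \sum_(e in J) (f \o h) e = \sum_(e in J) (f (h e) - sigma (g e)).
  by rewrite sumrB -linear_sum g0J linear0 subr0.
by apply: memv_suml => x _.
Qed.

End Minor_criterion.

(** * PG(3,2) *)

Lemma hom_of_linear (V W : vectType 'F_2) (f : V -> W) :
  linear f -> exists phi : 'Hom(V, W), forall v, phi v = f v.
Proof.
move=> lin; pose L := GRing.isLinear.Build _ _ _ _ f lin.
pose g : {linear V -> W} := HB.pack f L.
by exists (linfun g) => v; rewrite lfunE.
Qed.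

Definition row4 (a b c d : bool) : 'rV['F_2]_4 :=
  \row_i nth 0 [:: a%:R; b%:R; c%:R; d%:R] i.

Lemma row4D a b c d a' b' c' d' : row4 a b c d + row4 a' b' c' d' =
  row4 (a (+) a') (b (+) b') (c (+) c') (d (+) d').
Proof. by apply/rowP => -[[|[|[|[|i]]]] p] //; rewrite !mxE /= F2_addb. Qed.

Lemma row4_0 : row4 false false false false = 0.
Proof. by apply/rowP => -[[|[|[|[|i]]]] p]; rewrite !mxE. Qed.

Lemma row4_eq0 a b c d : (row4 a b c d == 0) = ~~ [|| a, b, c | d].
Proof.
apply/eqP/idP => [/rowP h|].
  move: (h 0) (h 1) (h (inord 2)) (h (inord 3)) => {h}.
  by rewrite !mxE !inordK //=; case: a; case: b; case: c; case: d.
by case: a; case: b; case: c; case: d => // _; exact: row4_0.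
Qed.

Lemma row4P (x : 'rV['F_2]_4) : exists a b c d, x = row4 a b c d.
Proof.
exists (x 0 0 == 1), (x 0 1 == 1), (x 0 (inord 2) == 1), (x 0 (inord 3) == 1).
have E i : (x 0 i == 1)%:R = x 0 i by case: (F2_cases (x 0 i)) => ->.
apply/rowP=> i; rewrite mxE !E.
case: i => -[|[|[|[|i]]]] p //=.
all: by apply: (congr1 (x 0)); apply/val_inj; rewrite /= ?inordK.
Qed.

Lemma hom4 (V : vectType 'F_2) (v : 'I_4 -> V) :
  exists sigma : 'Hom('rV['F_2]_4, V), forall a b c d, sigma (row4 a b c d) =
    \sum_(i < 4) (nth false [:: a; b; c; d] i)%:R *: v i.
Proof.
have [|sigma sE] := @hom_of_linear _ _ (fun x : 'rV['F_2]_4 => \sum_(i < 4) x 0 i *: v i).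
  move=> k x y; rewrite scaler_sumr -big_split; apply: eq_bigr => i _ /=.
  by rewrite !mxE scalerDl scalerA.
exists sigma => a b c d; rewrite sE /=. apply: eq_bigr => i _; rewrite mxE.
by congr (_ *: _); case: i => -[|[|[|[|i]]]].
Qed.

(** Six vectors of sum 0 whose 15 pairwise sums are the 15 nonzero vectors: the vertices of K_6
    after contraction of the sum of all of them. Indices beyond 5 give 0, too. *)
Definition weight6 (i : nat) : 'rV['F_2]_4 :=
  nth 0 [:: row4 true false false false; row4 false true false false;
    row4 false false true false; row4 false false false true;
    row4 true true true true; 0] i.

Lemma weight6_cover (x : 'rV['F_2]_4) : exists i j : 'I_6, x = weight6 i + weight6 j.
Proof.
have [a [b [c [d ->]]]] := row4P x.
case: a; case: b; case: c; case: d.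
- by exists (Ordinal (isT : (4 < 6)%N)), (Ordinal (isT : (5 < 6)%N)); rewrite /weight6 /= ?row4D ?addr0 ?addF2.
- by exists (Ordinal (isT : (3 < 6)%N)), (Ordinal (isT : (4 < 6)%N)); rewrite /weight6 /= ?row4D ?addr0 ?addF2.
- by exists (Ordinal (isT : (2 < 6)%N)), (Ordinal (isT : (4 < 6)%N)); rewrite /weight6 /= ?row4D ?addr0 ?addF2.
- by exists (Ordinal (isT : (0 < 6)%N)), (Ordinal (isT : (1 < 6)%N)); rewrite /weight6 /= ?row4D ?addr0 ?addF2.
- by exists (Ordinal (isT : (1 < 6)%N)), (Ordinal (isT : (4 < 6)%N)); rewrite /weight6 /= ?row4D ?addr0 ?addF2.
- by exists (Ordinal (isT : (0 < 6)%N)), (Ordinal (isT : (2 < 6)%N)); rewrite /weight6 /= ?row4D ?addr0 ?addF2.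
- by exists (Ordinal (isT : (0 < 6)%N)), (Ordinal (isT : (3 < 6)%N)); rewrite /weight6 /= ?row4D ?addr0 ?addF2.
- by exists (Ordinal (isT : (0 < 6)%N)), (Ordinal (isT : (5 < 6)%N)); rewrite /weight6 /= ?row4D ?addr0 ?addF2.
- by exists (Ordinal (isT : (0 < 6)%N)), (Ordinal (isT : (4 < 6)%N)); rewrite /weight6 /= ?row4D ?addr0 ?addF2.
- by exists (Ordinal (isT : (1 < 6)%N)), (Ordinal (isT : (2 < 6)%N)); rewrite /weight6 /= ?row4D ?addr0 ?addF2.
- by exists (Ordinal (isT : (1 < 6)%N)), (Ordinal (isT : (3 < 6)%N)); rewrite /weight6 /= ?row4D ?addr0 ?addF2.
- by exists (Ordinal (isT : (1 < 6)%N)), (Ordinal (isT : (5 < 6)%N)); rewrite /weight6 /= ?row4D ?addr0 ?addF2.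
- by exists (Ordinal (isT : (2 < 6)%N)), (Ordinal (isT : (3 < 6)%N)); rewrite /weight6 /= ?row4D ?addr0 ?addF2.
- by exists (Ordinal (isT : (2 < 6)%N)), (Ordinal (isT : (5 < 6)%N)); rewrite /weight6 /= ?row4D ?addr0 ?addF2.
- by exists (Ordinal (isT : (3 < 6)%N)), (Ordinal (isT : (5 < 6)%N)); rewrite /weight6 /= ?row4D ?addr0 ?addF2.
- by exists (Ordinal (isT : (0 < 6)%N)), (Ordinal (isT : (0 < 6)%N)); rewrite /weight6 /= ?row4D ?addr0 ?addF2.
Qed.

(** Entries 0, 1, 2, 5 and entries 0, 1, 3, 6 are two sets of sum 0; entry 4 is a further vertex at
    the origin. The pairwise sums miss only 1011 and 0111, and 1100 is the third point of their
    line. *)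
Definition weight7 (i : nat) : 'rV['F_2]_4 :=
  nth 0 [:: row4 true false false false; row4 false true false false; row4 false false true false; row4 false false false true; 0;
    row4 true true true false; row4 true true false true] i.

Lemma weight7_cover (x : 'rV['F_2]_4) :
  x \in [:: row4 true false true true; row4 false true true true;
    row4 true false true true + row4 false true true true] \/
  exists i j : 'I_7, x = weight7 i + weight7 j.
Proof.
have [a [b [c [d ->]]]] := row4P x; rewrite row4D /=.
case: a; case: b; case: c; case: d.
- by right; exists (Ordinal (isT : (2 < 7)%N)), (Ordinal (isT : (6 < 7)%N)); rewrite /weight7 /= ?row4D ?addr0 ?add0r ?addF2.
- by right; exists (Ordinal (isT : (4 < 7)%N)), (Ordinal (isT : (5 < 7)%N)); rewrite /weight7 /= ?row4D ?addr0 ?add0r ?addF2.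
- by right; exists (Ordinal (isT : (4 < 7)%N)), (Ordinal (isT : (6 < 7)%N)); rewrite /weight7 /= ?row4D ?addr0 ?add0r ?addF2.
- by left; rewrite !inE eqxx ?orbT.
- by left; rewrite !inE eqxx ?orbT.
- by right; exists (Ordinal (isT : (0 < 7)%N)), (Ordinal (isT : (2 < 7)%N)); rewrite /weight7 /= ?row4D ?addr0 ?add0r ?addF2.
- by right; exists (Ordinal (isT : (0 < 7)%N)), (Ordinal (isT : (3 < 7)%N)); rewrite /weight7 /= ?row4D ?addr0 ?add0r ?addF2.
- by right; exists (Ordinal (isT : (0 < 7)%N)), (Ordinal (isT : (4 < 7)%N)); rewrite /weight7 /= ?row4D ?addr0 ?add0r ?addF2.
- by left; rewrite !inE eqxx ?orbT.
- by right; exists (Ordinal (isT : (0 < 7)%N)), (Ordinal (isT : (5 < 7)%N)); rewrite /weight7 /= ?row4D ?addr0 ?add0r ?addF2.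
- by right; exists (Ordinal (isT : (0 < 7)%N)), (Ordinal (isT : (6 < 7)%N)); rewrite /weight7 /= ?row4D ?addr0 ?add0r ?addF2.
- by right; exists (Ordinal (isT : (1 < 7)%N)), (Ordinal (isT : (4 < 7)%N)); rewrite /weight7 /= ?row4D ?addr0 ?add0r ?addF2.
- by right; exists (Ordinal (isT : (2 < 7)%N)), (Ordinal (isT : (3 < 7)%N)); rewrite /weight7 /= ?row4D ?addr0 ?add0r ?addF2.
- by right; exists (Ordinal (isT : (2 < 7)%N)), (Ordinal (isT : (4 < 7)%N)); rewrite /weight7 /= ?row4D ?addr0 ?add0r ?addF2.
- by right; exists (Ordinal (isT : (3 < 7)%N)), (Ordinal (isT : (4 < 7)%N)); rewrite /weight7 /= ?row4D ?addr0 ?add0r ?addF2.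
- by right; exists (Ordinal (isT : (0 < 7)%N)), (Ordinal (isT : (0 < 7)%N)); rewrite /weight7 /= ?row4D ?addr0 ?add0r ?addF2.
Qed.

(** The last list consists of sums of four of the five weights; with the pairwise sums they miss the
    same two points as [weight7]. *)
Lemma weight5_cover (x : 'rV['F_2]_4) :
  [\/ x \in [:: row4 true false true true; row4 false true true true;
       row4 true false true true + row4 false true true true],
     exists i j : 'I_5, x = weight7 i + weight7 j
   | x \in [:: row4 true true true true; row4 true true true false;
       row4 true true false true]].
Proof.
have [a [b [c [d ->]]]] := row4P x; rewrite row4D /=.
case: a; case: b; case: c; case: d.
- by constructor 3; rewrite !inE eqxx ?orbT.
- by constructor 3; rewrite !inE eqxx ?orbT.
- by constructor 3; rewrite !inE eqxx ?orbT.
- by constructor 1; rewrite !inE eqxx ?orbT.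
- by constructor 1; rewrite !inE eqxx ?orbT.
- by constructor 2; exists (Ordinal (isT : (0 < 5)%N)), (Ordinal (isT : (2 < 5)%N)); rewrite /weight7 /= ?row4D ?addr0 ?add0r ?addF2.
- by constructor 2; exists (Ordinal (isT : (0 < 5)%N)), (Ordinal (isT : (3 < 5)%N)); rewrite /weight7 /= ?row4D ?addr0 ?add0r ?addF2.
- by constructor 2; exists (Ordinal (isT : (0 < 5)%N)), (Ordinal (isT : (4 < 5)%N)); rewrite /weight7 /= ?row4D ?addr0 ?add0r ?addF2.
- by constructor 1; rewrite !inE eqxx ?orbT.
- by constructor 2; exists (Ordinal (isT : (1 < 5)%N)), (Ordinal (isT : (2 < 5)%N)); rewrite /weight7 /= ?row4D ?addr0 ?add0r ?addF2.
- by constructor 2; exists (Ordinal (isT : (1 < 5)%N)), (Ordinal (isT : (3 < 5)%N)); rewrite /weight7 /= ?row4D ?addr0 ?add0r ?addF2.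
- by constructor 2; exists (Ordinal (isT : (1 < 5)%N)), (Ordinal (isT : (4 < 5)%N)); rewrite /weight7 /= ?row4D ?addr0 ?add0r ?addF2.
- by constructor 2; exists (Ordinal (isT : (2 < 5)%N)), (Ordinal (isT : (3 < 5)%N)); rewrite /weight7 /= ?row4D ?addr0 ?add0r ?addF2.
- by constructor 2; exists (Ordinal (isT : (2 < 5)%N)), (Ordinal (isT : (4 < 5)%N)); rewrite /weight7 /= ?row4D ?addr0 ?add0r ?addF2.
- by constructor 2; exists (Ordinal (isT : (3 < 5)%N)), (Ordinal (isT : (4 < 5)%N)); rewrite /weight7 /= ?row4D ?addr0 ?add0r ?addF2.
- by constructor 2; exists (Ordinal (isT : (0 < 5)%N)), (Ordinal (isT : (0 < 5)%N)); rewrite /weight7 /= ?row4D ?addr0 ?add0r ?addF2.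
Qed.

Section PG32.

Lemma rep_PG32 : rep (fun p : PG32 => val (p : PG32_point) : 'rV['F_2]_4) 0.
Proof.
apply: (rep_rel (@rep_vec _ _ (fun (i : 'I_4) (p : PG32_point) => val p 0 i))) => J.
have E i : (\sum_(p in J) mcol (fun (i : 'I_4) (p : PG32_point) => val p 0 i) p) i =
    (\sum_(p in J) val (p : PG32_point) : 'rV['F_2]_4) 0 i.
  by rewrite sum_ffunE summxE; apply: eq_bigr => p _; rewrite ffunE.
split=> h; first by apply/rowP=> i; rewrite -E h ffunE mxE.
by apply/ffunP=> i; rewrite E h ffunE mxE.
Qed.

Definition PGL_val (L : {set PG32}) (x : delete L) : 'rV['F_2]_4 :=
  val (minor_val x : PG32_point).

Lemma rep_PGL (L : {set PG32}) : rep (@PGL_val L) 0.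
Proof.
have := @rep_minor _ _ set0 L _ _ rep_PG32; rewrite sp_set0 addv0; exact.
Qed.

Lemma PGL_val_inj L : injective (@PGL_val L).
Proof. by move=> x y /val_inj e; apply: (@minor_val_inj PG32 set0 L). Qed.

Lemma PGL_val_neq0 L x : @PGL_val L x != 0.
Proof. exact: (valP (minor_val x : PG32_point)). Qed.

Lemma PGL_val_notin (L : {set PG32}) (x : delete L) : minor_val x \notin L.
Proof. by have := valP x; rewrite !inE. Qed.

Definition pair_line (u v : 'rV['F_2]_4) : {set PG32} :=
  [set p : PG32_point | val p \in <<[:: u; v]>>%VS].

Lemma pair_lineP u v : u != 0 -> v != 0 -> u != v -> PG32_line (pair_line u v).
Proof.
move=> u0 v0 uv; exists <<[:: u; v]>>%VS => //.
apply/eqP; have : free [:: u; v]; last by rewrite /free.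
rewrite free_cons seq1_free v0 andbT span_seq1; apply/negP=> /vlineP[k uk].
by move: u0 uv; rewrite uk; case: (F2_cases k) => ->; rewrite ?scale0r ?scale1r eqxx.
Qed.

(** The deleted line is the one through [u] and [v], so these are the two points that need not be
    found in the minor. *)
Lemma PG32_minor (M : matroid) (V : vectType 'F_2) (f : M -> V) K
  (phi : 'Hom(V, 'rV['F_2]_4)) (sigma : 'Hom('rV['F_2]_4, V)) (u v : 'rV['F_2]_4) :
  rep f K -> (K <= lker phi)%VS -> u != 0 -> v != 0 -> u != v ->
  (forall x, x != 0 -> x \in [:: u; v; u + v] \/
     exists2 e, phi (f e) = x & f e - sigma x \in killed f K phi) ->
  has_PG32_delete_line_minor M.
Proof.
move=> rf Kk u0 v0 uv h; exists (pair_line u v); first exact: pair_lineP.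
set L := pair_line u v.
apply: (@minor_criterion M (delete L) _ _ f K (@PGL_val L) phi sigma rf (@rep_PGL L)
  (@PGL_val_inj L) (@PGL_val_neq0 L) Kk) => x.
have [|//] := h (PGL_val x) (PGL_val_neq0 x).
move=> xL; case/negP: (PGL_val_notin x); rewrite inE -/(PGL_val x).
by move: xL; rewrite !inE => /or3P[] /eqP->; rewrite ?memvD // memv_span ?inE ?eqxx ?orbT.
Qed.

End PG32.

(** * Matroids conforming to a template *)

Section Universal.
Variables (Phi : frame_template) (R : finType) (rho : R -> {ffun tcore Phi -> 'F_2}).
Hypothesis rhoD : forall r, rho r \in tDelta Phi.

(** All columns that are wanted outside the core, for given rows [rho]: a label from Lambda above at
    most two ones, [None] being an absent one, or a column of Z with the choice of its [Y_1] column.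
    With all of them present, exhibiting a minor amounts to naming elements. *)
Definition univ_F : finType :=
  ({l : {ffun tX Phi -> 'F_2} | l \in tLambda Phi} * (option R * option R)
   + tY1 Phi * R)%type.

Definition univ_A' (b : tX Phi + R) (e : tcore Phi + univ_F) : 'F_2 :=
  match e, b with
  | inl y, inl x => tA1 x y
  | inl y, inr r => rho r y
  | inr (inl lo), inl x => val lo.1 x
  | inr (inl lo), inr r => (lo.2.1 == Some r)%:R + (lo.2.2 == Some r)%:R
  | inr (inr jr), inl x => 0
  | inr (inr jr), inr r => (r == jr.2)%:R
  end.

Definition univ_A (b : tX Phi + R) (e : tcore Phi + univ_F) : 'F_2 :=
  univ_A' b e + if e is inr (inr jr) then univ_A' b (inl (inl (inr jr.1))) else 0.

Definition univ_C : {set vec_matroid univ_A} :=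
  [set (inl (inr c) : tcore Phi + univ_F) | c : tC Phi].
Definition univ_Y1 : {set vec_matroid univ_A} :=
  [set (inl (inl (inr j)) : tcore Phi + univ_F) | j : tY1 Phi].
Definition univ : matroid := minor univ_C univ_Y1.

Lemma univ_conforms : conforms Phi univ.
Proof.
exists R, univ_F, univ_A; split; last first.
  by exists id => [|S]; [exists id|rewrite imset_id].
exists univ_A', [set f | if f is inr _ then true else false]; split.
- split.
  + by [].
  + move=> [lo|[j r0]]; rewrite inE // => _; split=> //.
    by exists r0.
  + move=> [[l [o1 o2]]|jr]; rewrite !inE //= => _.
    pose s := [seq r <- enum R | (o1 == Some r) || (o2 == Some r)].
    have : {subset [pred r | (o1 == Some r)%:R + (o2 == Some r)%:R != 0 :> 'F_2] <=
        pmap id [:: o1; o2]}.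
      move=> r; rewrite inE mem_pmap map_id !inE ![Some r == _]eq_sym.
      by case: (o1 == _); case: (o2 == _) => //; rewrite addr0 eqxx.
    move/subsetP/subset_leq_card => le; apply: leq_trans (leq_trans _ (leq_trans le (card_size _))) _.
      by apply/subset_leq_card/subsetP => r; rewrite !inE.
    by rewrite size_pmap (leq_trans (count_size _ _)).
  + move=> [[l o]|jr]; rewrite !inE //= => _.
    by rewrite (_ : [ffun x => _] = val l) ?(valP l) //; apply/ffunP=> x; rewrite ffunE.
  + by move=> r; rewrite (_ : [ffun y => _] = rho r) //; apply/ffunP=> y; rewrite ffunE.
- by move=> b y; rewrite /univ_A addr0.
- by move=> b [f|jr]; rewrite inE //= /univ_A addr0.
- by move=> [f|jr]; rewrite inE //= => _; exists jr.1.
Qed.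

Definition univ_V : vectType 'F_2 := {ffun tX Phi + R -> F2}.
Definition stack (x : tX Phi -> 'F_2) (v : R -> 'F_2) : univ_V :=
  [ffun b => match b with inl a => x a | inr r => v r end].
Definition univ_f : univ -> univ_V := mcol univ_A \o @minor_val _ univ_C univ_Y1.
Definition core_col (y : tcore Phi) : univ_V := stack (fun x => tA1 x y) (fun r => rho r y).
Definition univ_K : {vspace univ_V} := sp (fun c => core_col (inr c)) setT.

Lemma rep_univ : rep univ_f univ_K.
Proof.
have -> : univ_K = sp (mcol univ_A) univ_C.
  have E c : core_col (inr c) = mcol univ_A (inl (inr c)).
    by apply/ffunP=> -[x|r]; rewrite !ffunE /univ_A /= addr0.
  apply/eqP; rewrite eqEsubv; apply/andP; split; apply/sp_subP.
    by move=> c _; rewrite E; apply/mem_sp/imset_f.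
  move=> e /imsetP[c _ ->]; rewrite -E.
  by apply: (mem_sp (fun c => core_col (inr c))); rewrite inE.
have := @rep_minor _ _ univ_C univ_Y1 _ _ (@rep_vec _ _ univ_A).
by rewrite add0v.
Qed.

Lemma univY0_subproof (y : tY0 Phi) :
  (inl (inl (inl y)) : vec_matroid univ_A) \notin univ_C :|: univ_Y1.
Proof. by rewrite inE negb_or; apply/andP; split; apply/imsetP=> -[]. Qed.
Definition univ_y (y : tY0 Phi) : univ :=
  exist (fun x : vec_matroid univ_A => x \notin univ_C :|: univ_Y1) _ (univY0_subproof y).

Lemma univF_subproof (f : univ_F) :
  (inr f : vec_matroid univ_A) \notin univ_C :|: univ_Y1.
Proof. by rewrite inE negb_or; apply/andP; split; apply/imsetP=> -[]. Qed.
Definition univ_e (f : univ_F) : univ :=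
  exist (fun x : vec_matroid univ_A => x \notin univ_C :|: univ_Y1) _ (univF_subproof f).

Lemma univ_fy y : univ_f (univ_y y) = core_col (inl (inl y)).
Proof. by apply/ffunP=> -[x|r]; rewrite !ffunE /univ_A /= addr0. Qed.

Definition oe (o : option R) : R -> 'F_2 := fun r => (o == Some r)%:R.
Definition evec (o : option R) : univ_V := stack (fun=> 0) (oe o).
Definition lab (l : {ffun tX Phi -> 'F_2}) : univ_V := stack l (fun=> 0).

Lemma univ_fg lo : univ_f (univ_e (inl lo)) = lab (val lo.1) + evec lo.2.1 + evec lo.2.2.
Proof.
by apply/ffunP=> -[x|r]; rewrite !ffunE /univ_A /= ?(addr0, add0r).
Qed.

Lemma univ_fz j r : univ_f (univ_e (inr (j, r))) = core_col (inl (inr j)) + evec (Some r).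
Proof.
apply/ffunP=> -[x|r']; rewrite !ffunE /univ_A /= ?(addr0, add0r) //.
by rewrite addrC eq_sym.
Qed.

Lemma evecNone : evec None = 0.
Proof. by apply/ffunP=> -[x|r]; rewrite !ffunE. Qed.

End Universal.

(** * What an excluded PG(3,2)\L imposes on Delta and Lambda *)

Section Template.
Variable Phi : frame_template.
Hypothesis noPG : forall M, conforms Phi M -> ~ has_PG32_delete_line_minor M.

Let Lam : finType := {l : {ffun tX Phi -> 'F_2} | l \in tLambda Phi}.

Lemma Delta0 : (0 : {ffun tcore Phi -> 'F_2}) \in tDelta Phi.
Proof. by have [] := tDelta_group Phi. Qed.

Lemma Lambda0 : (0 : {ffun tX Phi -> 'F_2}) \in tLambda Phi.
Proof. by have [] := tLambda_group Phi. Qed.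

Definition lam0 : Lam := exist (fun l => l \in tLambda Phi) 0 Lambda0.

Section Apex.
Variables (R : finType) (rho : R -> {ffun tcore Phi -> 'F_2}).

Lemma lab0 : lab R (val lam0) = 0.
Proof. by apply/ffunP=> -[x|r]; rewrite !ffunE. Qed.

Lemma univ_fe o1 o2 : univ_f (univ_e rho (inl (lam0, (o1, o2)))) = evec Phi o1 + evec Phi o2.
Proof. by rewrite univ_fg lab0 add0r. Qed.

End Apex.

(* If a vector 1_T with T arbitrary is spanned by the core, the conforming
   matroids include M(K_6)/1_T = PG(3,2) for T = V(K_6). *)
Lemma core_relation (J : {set tcore Phi}) (L : {set Lam}) :
  (forall x, \sum_(y in J) tA1 x y = \sum_(l in L) val l x) ->
  forall d, d \in tDelta Phi -> \sum_(y in J) d y = 0.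
Proof.
move=> JL d dD; case: (F2_cases (\sum_(y in J) d y)) => // d1; exfalso.
(* Five rows carry [d]; the absent end [None : option R] is the sixth vertex of K_6. The row
   [Some None] carries 0 instead: the element of [Y_1] index [j] at this row has weight 0, and so
   has the unit column, so that the core column of [j] is contracted. *)
pose R : finType := option 'I_5.
pose rho (r : R) : {ffun tcore Phi -> 'F_2} := if r is Some _ then d else 0.
have rhoD r : rho r \in tDelta Phi by case: r => [i|] //=; exact: Delta0.
pose idx (o : option R) : 'I_6 := if o is Some (Some i) then widen_ord (leqnSn 5) i else ord_max.
pose wt o := weight6 (idx o).
have wtN : wt None = 0 by [].
have [|phi phiE] := @hom_of_linear _ _ (fun v : univ_V Phi R =>
    \sum_(i < 5) v (inr (Some i)) *: wt (Some (Some i))).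
  move=> k v v'; rewrite scaler_sumr -big_split; apply: eq_bigr => i _ /=.
  by rewrite !ffunE scalerDl scalerA.
have phi_e o : phi (evec Phi o) = wt o.
  rewrite phiE; case: o => [[i|]|].
  - rewrite (bigD1 i) //= ffunE /oe eqxx scale1r big1 ?addr0 // => j ji.
    by rewrite ffunE /oe eqE /= eqE /= eq_sym (negPf ji) scale0r.
  - by rewrite big1 // => j _; rewrite ffunE scale0r.
  - by rewrite big1 // => j _; rewrite ffunE scale0r.
have phi_core y : phi (core_col rho y) = 0.
  rewrite phiE; under eq_bigr => i _ do rewrite ffunE /=.
  rewrite -scaler_sumr !big_ord_recl big_ord0 /wt /weight6 /= addr0 !row4D /=.
  by rewrite row4_0 scaler0.
have phi_lab l : phi (lab R l) = 0.
  by rewrite phiE big1 // => i _; rewrite ffunE scale0r.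
have [sigma sE] := hom4 (fun i : 'I_4 => evec Phi (Some (Some (widen_ord (leqnSn 4) i)))).
set K := univ_K rho.
have Kk : (K <= lker phi)%VS.
  by apply/sp_subP => c _; rewrite memv_ker phi_core.
set Ud := killed (univ_f (rho := rho)) K phi.
have kill_loop (l : Lam) : lab R (val l) \in Ud.
  have := @mem_killed _ _ _ (univ_f (rho := rho)) K phi (univ_e rho (inl (l, (None, None)))).
  by rewrite univ_fg evecNone !addr0 phi_lab; apply.
have kill_apex : evec Phi (Some None) \in Ud.
  have := @mem_killed _ _ _ (univ_f (rho := rho)) K phi
    (univ_e rho (inl (lam0, (Some None, None)))).
  by rewrite univ_fe evecNone addr0 phi_e; apply.
have kill_core y : core_col rho y \in Ud.
  case: y => [[y|j]|c].
  - have := @mem_killed _ _ _ (univ_f (rho := rho)) K phi (univ_y rho y).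
    by rewrite univ_fy phi_core; apply.
  - have := @mem_killed _ _ _ (univ_f (rho := rho)) K phi (univ_e rho (inr (j, None))).
    rewrite univ_fz linearD /= phi_core phi_e add0r => /(_ erefl) h.
    by rewrite -[core_col _ _]addr0 -(addF2 (evec Phi (Some None))) addrA memvD.
  - by apply/mem_killedK/(mem_sp (fun c => core_col rho (inr c))); rewrite inE.
(* On the rows of X the two sums cancel by [JL]; on each row that carries [d] the columns of [J] add
   up to 1. *)
have kill_all : \sum_(i < 5) evec Phi (Some (Some i)) \in Ud.
  suff -> : \sum_(i < 5) evec Phi (Some (Some i)) =
      \sum_(y in J) core_col rho y + \sum_(l in L) lab R (val l).
    by apply: memvD; apply: memv_suml => ? _.
  apply/ffunP=> b; rewrite !(sum_ffunE, ffunE); case: b => [x|r].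
    rewrite big1 => [|i _]; last by rewrite ffunE.
    under eq_bigr => y _ do rewrite ffunE; rewrite JL.
    under [X in _ + X]eq_bigr => l _ do rewrite ffunE.
    by rewrite F2_addrr.
  rewrite [X in _ + X]big1 ?addr0 => [|l _]; last by rewrite ffunE.
  under eq_bigr => i _ do rewrite ffunE.
  under [RHS]eq_bigr => y _ do rewrite ffunE.
  case: r => [i|] /=.
    rewrite d1 (bigD1 i) //= /oe eqxx big1 ?addr0 // => j ji.
    by rewrite eqE /= eqE /= (negPf ji).
  by rewrite !big1 // => y _; rewrite ffunE.
(* [sigma] lifts the weights of the first four vertices exactly. The fifth has the sum of these
   weights, so its error is the sum of all five unit vectors, which is killed. *)
have good o : evec Phi o - sigma (wt o) \in Ud.
  case: o => [[i|]|]; first last.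
  - by rewrite evecNone wtN linear0 subrr mem0v.
  - by rewrite (_ : wt _ = 0) // linear0 subr0.
  rewrite /wt /weight6 /=; case: i => -[|[|[|[|[|i]]]]] p //=; rewrite sE;
    rewrite !big_ord_recl big_ord0 /= !(scale0r, scale1r, addr0, add0r).
  + by rewrite (_ : Ordinal p = widen_ord (leqnSn 4) ord0) ?subrr ?mem0v //; apply/val_inj.
  + by rewrite (_ : Ordinal p = widen_ord (leqnSn 4) (lift ord0 ord0)) ?subrr ?mem0v //;
      apply/val_inj.
  + rewrite (_ : Ordinal p = widen_ord (leqnSn 4) (lift ord0 (lift ord0 ord0)));
      by rewrite ?subrr ?mem0v //; apply/val_inj.
  + rewrite (_ : Ordinal p = widen_ord (leqnSn 4) (lift ord0 (lift ord0 (lift ord0 ord0))));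
      by rewrite ?subrr ?mem0v //; apply/val_inj.
  + rewrite (_ : _ - _ = \sum_(i < 5) evec Phi (Some (Some i))) //.
    rewrite !big_ord_recr big_ord0 /= add0r addrC oppF2 !addrA; congr (_ + _ + _ + _ + _);
      congr (evec _ (Some (Some _))); exact/val_inj.
apply: (noPG (univ_conforms rhoD)).
apply: (@PG32_minor _ _ _ _ phi sigma (row4 true false false false)
  (row4 false true false false) (@rep_univ _ _ rho) Kk).
- by rewrite row4_eq0.
- by rewrite row4_eq0.
- by rewrite -subr_eq0 oppF2 row4D row4_eq0.
move=> x _; right; have [i [j ->]] := weight6_cover x.
have lift6 (k : 'I_6) : exists o, weight6 k = wt o.
  have [k5|k5] := ltnP k 5; last first.
    exists None; rewrite /wt /=; congr weight6.
    by apply/eqP; rewrite eqn_leq k5 -ltnS ltn_ord.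
  by exists (Some (Some (Ordinal k5))).
have [o ->] := lift6 i; have [o' ->] := lift6 j.
exists (univ_e rho (inl (lam0, (o, o')))); rewrite univ_fe linearD /= ?phi_e //.
by rewrite opprD addrACA; apply: memvD; apply: good.
Qed.

(* Otherwise all signed graphs conform, and the signed K_4 is PG(3,2) with two
   points deleted. *)
Lemma Lambda_core (l : Lam) : exists J : {set tC Phi},
  forall x, val l x = \sum_(c in J) tA1 x (inr c).
Proof.
pose a c : {ffun tX Phi -> F2} := [ffun x => tA1 x (inr c)].
have [/spP[J _ lJ]|lU] := boolP ((val l : {ffun tX Phi -> F2}) \in sp a setT).
  exists J => x; rewrite lJ sum_ffunE; by apply: eq_bigr => c _; rewrite ffunE.
exfalso.
(* [psi] vanishes on the columns of [C] and is 1 at [l]: it survives the contraction of [C] and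
   reads off the sign of an edge. *)
have [J|psi psiE] := @ext_hom {ffun tX Phi -> F2} F2 (option (tC Phi))
    (fun o => if o is Some c then a c else val l) (fun o => (o == None)%:R).
  have [NJ|NJ] := boolP (None \in J); last first.
    by move=> _; rewrite big1 // => -[c|] //; rewrite (negPf NJ).
  rewrite (bigD1 None) //= => /eqF2 lE; case/negP: lU; change (sval l \in sp a setT); rewrite lE.
  apply: memv_suml => -[c|] /andP[] // _ _.
  by apply: mem_sp; rewrite inE.
have psi_a c : psi (a c) = 0 by have := psiE (Some c).
have psi_l : psi (val l : {ffun tX Phi -> F2}) = 1 by have := psiE None.
pose R : finType := 'I_3.
pose rho (r : R) : {ffun tcore Phi -> 'F_2} := 0.
have rhoD r : rho r \in tDelta Phi by exact: Delta0.
pose b3 i := row4 false (i == 0%N) (i == 1%N) (i == 2).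
pose wt (o : option R) := if o is Some i then b3 (val i) else 0.
pose w0 := row4 true false false false.
have [|phi phiE] := @hom_of_linear _ _ (fun v : univ_V Phi R =>
    (psi ([ffun x => v (inl x)] : {ffun tX Phi -> F2}) : 'F_2) *: w0 +
    \sum_(i < 3) v (inr i) *: b3 (val i)).
  move=> k v v'; rewrite scalerDr scaler_sumr addrACA -big_split; congr (_ + _).
    rewrite scalerA -scalerDl; congr (_ *: _).
    rewrite (_ : [ffun x => _] = k *: ([ffun x => v (inl x)] : {ffun tX Phi -> F2}) +
      [ffun x => v' (inl x)]) ?linearP //; by apply/ffunP=> x; rewrite !ffunE.
  by apply: eq_bigr => i _ /=; rewrite !ffunE scalerDl scalerA.
have phi_e o : phi (evec Phi o) = wt o.
  rewrite phiE (_ : [ffun x => _] = 0) ?linear0 ?scale0r ?add0r; last first.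
    by apply/ffunP=> x; rewrite !ffunE.
  case: o => [i|].
    rewrite (bigD1 i) //= ffunE /oe eqxx scale1r big1 ?addr0 // => j ji.
    by rewrite ffunE /oe eqE /= eq_sym (negPf ji) scale0r.
  by rewrite big1 // => j _; rewrite ffunE scale0r.
have phi_lab (m : {ffun tX Phi -> F2}) : phi (lab R m) = (psi m : 'F_2) *: w0.
  rewrite phiE big1 ?addr0 => [|i _]; last by rewrite ffunE scale0r.
  by congr (psi _ *: _); apply/ffunP=> x; rewrite !ffunE.
have coreE c : core_col rho (inr c) = lab R (a c).
  by apply/ffunP=> -[x|r]; rewrite !ffunE.
have [sigma sE] := hom4 (fun i : 'I_4 =>
  if unlift ord0 i is Some j then evec Phi (Some j) else lab R (val l)).
have sig_w0 : sigma w0 = lab R (val l).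
  by rewrite sE !big_ord_recl big_ord0 /= unlift_none !(scale0r, scale1r, addr0).
have sig_wt o : sigma (wt o) = evec Phi o.
  case: o => [i|]; last by rewrite linear0 evecNone.
  have nthE (j : 'I_3) : nth false [:: false; val i == 0; val i == 1; val i == 2] (lift ord0 j) = (i == j).
    by case: j => -[|[|[|j]]].
  rewrite sE big_ord_recl scale0r add0r (bigD1 i) // big1 => [|j ji]; rewrite nthE liftK.
    by rewrite eqxx scale1r /= addr0.
  by rewrite (eq_sym i) (negPf ji) scale0r.
set K := univ_K rho.
have Kk : (K <= lker phi)%VS.
  by apply/sp_subP => c _; rewrite memv_ker coreE phi_lab psi_a scale0r.
(* The vertices of K_4 have weight 0 and three unit weights, so no difference involves all three
   units. This leaves out 0111 and 1111, whose line contains the sign vector 1000. *)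
apply: (noPG (univ_conforms rhoD)).
apply: (@PG32_minor _ _ _ _ phi sigma (row4 true false false false)
  (row4 false true true true) (@rep_univ _ _ rho) Kk).
- by rewrite row4_eq0.
- by rewrite row4_eq0.
- by rewrite -subr_eq0 oppF2 row4D row4_eq0.
have pt (s : bool) o o' : exists2 e, phi (univ_f (rho := rho) e) =
    s%:R *: w0 + wt o + wt o' & univ_f (rho := rho) e - sigma (s%:R *: w0 + wt o + wt o')
      \in killed (univ_f (rho := rho)) K phi.
  exists (univ_e rho (inl (if s then l else lam0, (o, o')))).
    rewrite univ_fg !linearD /= !phi_e; congr (_ + _ + _); case: s => /=.
      by rewrite phi_lab psi_l.
    by rewrite lab0 linear0 scale0r.
  rewrite univ_fg !linearD /= !sig_wt linearZ /= sig_w0.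
  suff -> : lab R (val (if s then l else lam0)) = s%:R *: lab R (val l).
    by rewrite -!opprD subrr mem0v.
  by case: s => /=; rewrite ?scale1r // lab0 scale0r.
move=> x _; have [s [b [c [d ->]]]] := row4P x.
have [bcd|bcd] := boolP [&& b, c & d].
  left; case/and3P: bcd => -> -> ->; rewrite !inE row4D.
  by case: s; rewrite /= eqxx ?orbT.
right.
have -> : row4 s b c d = s%:R *: w0 + row4 false b c d.
  by case: s; rewrite ?scale1r ?scale0r ?add0r // /w0 row4D.
suff [o [o' ->]] : exists o o', row4 false b c d = wt o + wt o' by rewrite addrA.
pose i0 : R := Ordinal (isT : (0 < 3)%N); pose i1 : R := Ordinal (isT : (1 < 3)%N).
pose i2 : R := Ordinal (isT : (2 < 3)%N).
case: b bcd; case: c; case: d => //= _.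
- by exists (Some i0), (Some i1); rewrite row4D.
- by exists (Some i0), (Some i2); rewrite row4D.
- by exists (Some i0), None; rewrite addr0.
- by exists (Some i1), (Some i2); rewrite row4D.
- by exists (Some i1), None; rewrite addr0.
- by exists (Some i2), None; rewrite addr0.
- by exists None, None; rewrite addr0 row4_0.
Qed.

End Template.

(** * Templates as configurations of points and vectors *)

Section Config.
Variables (V : vectType 'F_2) (I Y : finType) (q : I -> V) (t : Y -> V).

Definition cfg_killed (phi : 'Hom(V, 'rV['F_2]_4)) : {vspace V} :=
  (sp (fun p : I * I => (q p.1 + q p.2)%R) [set p | phi (q p.1 + q p.2)%R == 0%R]
   + sp t [set y | phi (t y) == 0%R])%VS.

(* The matroid of the differences of the points q and of the vectors t has no
   minor PG(3,2)\L. *)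
Definition cfg_noPG : Prop :=
  forall (phi : 'Hom(V, 'rV['F_2]_4)) (sigma : 'Hom('rV['F_2]_4, V)) u v,
  u != 0 -> v != 0 -> u != v ->
  (forall x, x != 0 -> [\/ x \in [:: u; v; u + v],
    exists i j, phi (q i + q j) = x /\ q i + q j - sigma x \in cfg_killed phi |
    exists y, phi (t y) = x /\ t y - sigma x \in cfg_killed phi]) ->
  False.

End Config.

Definition delta (R : finType) (o : option R) : {ffun R -> F2} :=
  [ffun r => (o == Some r)%:R].

Section Template.
Variable Phi : frame_template.
Hypothesis noPG : forall M, conforms Phi M -> ~ has_PG32_delete_line_minor M.

Local Notation VX := {ffun tX Phi -> F2}.
Definition core_x (y : tcore Phi) : VX := [ffun x => tA1 x y].

Variable chi : 'End(VX).
Hypothesis chi_ker : lker chi = sp (fun c => core_x (inr c)) setT.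
Hypothesis chi_id : forall v, v - chi v \in lker chi.

Lemma chi_C c : chi (core_x (inr c)) = 0.
Proof.
by apply/eqP; rewrite -memv_ker chi_ker (mem_sp (fun c => core_x (inr c))) ?inE.
Qed.

Lemma chi_lam l : l \in tLambda Phi -> chi (l : VX) = 0.
Proof.
move=> lL; have [J lE] := Lambda_core noPG (exist (fun l => l \in tLambda Phi) l lL).
suff -> : (l : VX) = \sum_(c in J) core_x (inr c).
  by rewrite linear_sum big1 // => c _; apply: chi_C.
by apply/ffunP=> x; rewrite sum_ffunE lE; apply: eq_bigr => c _; rewrite ffunE.
Qed.

Section Form.
Variables (R F : finType) (A A' : tX Phi + R -> tcore Phi + F -> 'F_2) (Z : {set F}).
Hypothesis resp : respects A' Z.
Hypothesis A_core : forall b y, A b (inl y) = A' b (inl y).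
Hypothesis A_Z : forall b f, f \notin Z -> A b (inr f) = A' b (inr f).
Hypothesis A_nZ : forall f, f \in Z -> exists j : tY1 Phi,
  forall b, A b (inr f) = A' b (inr f) + A' b (inl (inl (inr j))).

Local Notation VR := {ffun R -> F2}.
Local Notation VXR := {ffun tX Phi + R -> F2}.
Local Notation VP := (VX * VR)%type.

Definition core_r (y : tcore Phi) : VR := [ffun r => A' (inr r) (inl y)].

(** By [core_relation], a relation between core columns on X modulo Lambda holds in every row of
    Delta. So the part of the core below X is a linear function of the part on X, and a row
    operation clears it without changing the columns with labels in Lambda. *)
Lemma tau_exists : exists tau : 'Hom(VX, VR),
  (forall y, tau (core_x y) = core_r y) /\ forall l, l \in tLambda Phi -> tau (l : VX) = 0.
Proof.
pose Lam : finType := {l : {ffun tX Phi -> 'F_2} | l \in tLambda Phi}.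
have [A1 _ _ _ AD] := resp.
have [J|tau tauE] := @ext_hom VX VR (tcore Phi + Lam)%type
    (fun i => match i with inl y => core_x y | inr l => val l end)
    (fun i => if i is inl y then core_r y else 0); last first.
  exists tau; split=> [y|l lL]; first exact: (tauE (inl y)).
  exact: (tauE (inr (exist _ l lL))).
rewrite big_sumType /= => /eqF2 JE; rewrite big_sumType /= [X in _ + X]big1 // addr0.
apply/ffunP=> r; rewrite sum_ffunE ffunE.
have := @core_relation Phi noPG [set y | inl y \in J] [set l | inr l \in J] _ _ (AD r).
under eq_bigl => y do rewrite inE.
move=> rel; rewrite -[RHS]rel => [|x].
  by apply: eq_bigr => y _; rewrite !ffunE.
move/ffunP/(_ x): JE; rewrite !sum_ffunE => JE.
under eq_bigl => y do rewrite inE.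
under [RHS]eq_bigl => y do rewrite inE.
by rewrite -[RHS]JE; apply: eq_bigr => y _; rewrite ffunE.
Qed.

(** [Psi] contracts [C] through [chi] and applies the row operation given by [tau]. Labels in Lambda
    disappear because they lie in the span of [C]; a column of Z keeps its unit vector and the
    projected [Y_1] column added to it. *)
Lemma conforming_vectors (tau : 'Hom(VX, VR)) :
  (forall y, tau (core_x y) = core_r y) ->
  (forall l, l \in tLambda Phi -> tau (l : VX) = 0) ->
  exists Psi : 'Hom(VXR, VP),
  [/\ forall v, Psi v = 0 <-> v \in sp (fun c => mcol A (inl (inr c))) setT,
      forall y, Psi (mcol A (inl y)) = (chi (core_x y), 0)
    & forall f, (exists o1 o2, Psi (mcol A (inr f)) = (0, delta o1 + delta o2)) \/
        exists j r, Psi (mcol A (inr f)) = (chi (core_x (inl (inr j))), delta (Some r))].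
Proof.
move=> tau_core tau_lam; have [A1 ZE fr lamE AD] := resp.
pose px (v : VXR) : VX := [ffun x => v (inl x)].
pose pr (v : VXR) : VR := [ffun r => v (inr r)].
have pxL k u v : px (k *: u + v) = k *: px u + px v by apply/ffunP=> x; rewrite !ffunE.
have prL k u v : pr (k *: u + v) = k *: pr u + pr v by apply/ffunP=> x; rewrite !ffunE.
have [|Psi PsiE] := @hom_of_linear VXR VP (fun v => (chi (px v), pr v - tau (px v))).
  move=> k u v; rewrite pxL prL (linearP chi) (linearP tau); congr pair.
  by rewrite /= opprD addrACA scalerBr.
have core_v y : px (mcol A (inl y)) = core_x y /\ pr (mcol A (inl y)) = core_r y.
  by split; apply/ffunP=> x; rewrite !ffunE A_core ?A1.
have Psi_core y : Psi (mcol A (inl y)) = (chi (core_x y), 0).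
  by have [e1 e2] := core_v y; rewrite PsiE e1 e2 tau_core subrr.
exists Psi; split=> //.
- move=> v; split=> [|/spP[J _ ->]]; last first.
    by rewrite linear_sum big1 // => c _; rewrite /= Psi_core chi_C.
  rewrite PsiE => -[/eqP]; rewrite -memv_ker chi_ker => /spP[J _ vx].
  move=> /eqP; rewrite subr_eq0 => /eqP vr; apply/spP; exists J => //.
  apply/ffunP=> -[x|r]; rewrite sum_ffunE.
    move/ffunP/(_ x): vx; rewrite sum_ffunE ffunE => ->.
    by apply: eq_bigr => c _; rewrite !ffunE A_core A1.
  move/ffunP/(_ r): vr; rewrite vx linear_sum sum_ffunE ffunE => ->.
  by apply: eq_bigr => c _; rewrite /= tau_core !ffunE A_core.
- move=> f; have [fZ|fZ] := boolP (f \in Z).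
    have [j AE] := A_nZ fZ; have [X0 [r0 R0]] := ZE f fZ.
    right; exists j, r0; rewrite PsiE.
    have -> : px (mcol A (inr f)) = core_x (inl (inr j)).
      by apply/ffunP=> x; rewrite !ffunE AE X0 add0r A1.
    rewrite tau_core; congr pair; apply/ffunP=> r.
    by rewrite !ffunE AE R0 addrK eqE /= eq_sym.
  left; have := fr f; rewrite inE fZ => /(_ isT).
  set s := [set b | _] => s2.
  have gE r : pr (mcol A (inr f)) r = (r \in s)%:R.
    rewrite !ffunE inE A_Z //.
    by case: (F2_cases (A' (inr r) (inr f))) => ->.
  clearbody s.
  have [o1 [o2 sE]] : exists o1 o2 : option R, pr (mcol A (inr f)) = delta o1 + delta o2.
    have [s0|[r1 r1s]] := set_0Vmem s.
      by exists None, None; apply/ffunP=> r; rewrite gE !ffunE s0 inE addr0.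
    have [s0|[r2 r2s]] := set_0Vmem (s :\ r1).
      exists (Some r1), None; apply/ffunP=> r; rewrite gE !ffunE addr0.
      rewrite (inj_eq Some_inj) eq_sym; move/setP/(_ r): s0; rewrite !inE.
      by have [->|_] /= := eqVneq r r1; [rewrite r1s|move=> ->].
    exists (Some r1), (Some r2); apply/ffunP=> r; rewrite gE !ffunE !eqE /=.
    move: r2s; rewrite !inE => /andP[r21 r2s].
    have [<-|r1r] := eqVneq r1 r; first by rewrite r1s (negPf r21) addr0.
    have [<-|r2r] := eqVneq r2 r; first by rewrite r2s add0r.
    rewrite addr0; suff /negPf -> : r \notin s by [].
    apply/negP=> rs; suff : (3 <= #|s|)%N by lia.
    rewrite (cardsD1 r1) r1s (cardsD1 r2) (cardsD1 r) !inE r21 r2s rs.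
    by rewrite eq_sym r2r eq_sym r1r.
  exists o1, o2; rewrite PsiE sE.
  have -> : px (mcol A (inr f)) = ([ffun x => A' (inl x) (inr f)] : VX).
    by apply/ffunP=> x; rewrite !ffunE A_Z.
  by rewrite chi_lam ?tau_lam ?subr0 ?lamE.
Qed.

End Form.

Definition tpt (y : tY0 Phi) : VX := chi (core_x (inl (inl y))).
Definition spt (j : tY1 Phi) : VX := chi (core_x (inl (inr j))).

(** [Ys] is the set of elements from [Y_0]. The bound on its size depends on the template alone,
    which is what connectivity can exploit. *)
Lemma conforming_form (M : matroid) : conforms Phi M ->
  exists (R : finType) (f : M -> (VX * {ffun R -> F2})%type) (Ys : {set M}),
  [/\ rep f 0, (#|Ys| <= #|tY0 Phi|)%N, forall e, e \in Ys -> exists y, f e = (tpt y, 0),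
      forall y, exists2 e, e \in Ys & f e = (tpt y, 0)
    & forall e, e \notin Ys -> (exists o1 o2, f e = (0, delta o1 + delta o2)) \/
        exists j r, f e = (spt j, delta (Some r))].
Proof.
case=> R [F [A [[A' [Z [resp A_core A_Z A_nZ]]] iso]]].
pose C : {set vec_matroid A} := [set (inl (inr c) : tcore Phi + F) | c : tC Phi].
pose Y1 : {set vec_matroid A} := [set (inl (inl (inr j)) : tcore Phi + F) | j : tY1 Phi].
have {iso} [h hb hr] : matroid_iso M (minor C Y1) := iso.
have [tau [tau_core tau_lam]] := tau_exists resp.
have [Psi [Psi0 Psi_core Psi_F]] := conforming_vectors resp A_core A_Z A_nZ tau_core tau_lam.
pose g (e : M) : tcore Phi + F := minor_val (h e).
have gi : injective g by apply: inj_comp (bij_inj hb); exact: minor_val_inj.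
pose Ys : {set M} := [set e | if g e is inl _ then true else false].
have gY e : e \in Ys -> exists y, g e = inl (inl (inl y)).
  rewrite inE; have := valP (h e); rewrite -/(g e) inE negb_or.
  case E : (g e) => [[[y|j]|c]|f] //; first by exists y.
    by case/andP=> _ /imsetP[]; exists j.
  by case/andP=> /imsetP[]; exists c.
exists R, (fun e => Psi (mcol A (g e))), Ys; split.
- have r1 := rep_iso hr (@rep_minor _ _ C Y1 _ _ (@rep_vec _ _ A)).
  have CE : sp (mcol A) C = sp (fun c => mcol A (inl (inr c))) setT.
    apply/eqP; rewrite eqEsubv; apply/andP; split; apply/sp_subP.
      by move=> e /imsetP[c _ ->]; apply: (mem_sp (fun c => mcol A (inl (inr c)))); rewrite inE.
    by move=> c _; apply/mem_sp/imset_f.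
  move: r1; rewrite add0v CE => r1.
  apply/(rep_quot (phi := Psi) (K := sp (fun c => mcol A (inl (inr c))) setT)); last exact: r1.
    by apply/subvP=> v vC; rewrite memv_ker; apply/eqP/Psi0.
  by move=> v _ /Psi0.
- rewrite -(card_imset _ gi).
  have le : (#|[set (inl (inl (inl y)) : tcore Phi + F) | y : tY0 Phi]| <= #|tY0 Phi|)%N.
    exact: leq_imset_card.
  apply: leq_trans le; apply/subset_leq_card/subsetP=> _ /imsetP[e /gY[y ->] ->].
  exact: imset_f.
- by move=> e /gY[y ->]; exists y; rewrite Psi_core.
- move=> y; have yC : (inl (inl (inl y)) : vec_matroid A) \notin C :|: Y1.
    by rewrite inE negb_or; apply/andP; split; apply/imsetP=> -[].
  have [h' hK h'K] := hb.
  pose e0 : minor C Y1 := exist (fun x : vec_matroid A => x \notin C :|: Y1) _ yC.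
  have gE : g (h' e0) = inl (inl (inl y)) by rewrite /g h'K.
  by exists (h' e0); rewrite ?inE gE ?Psi_core.
- move=> e; rewrite inE; case: (g e) => [y //|f] _; exact: Psi_F.
Qed.

Local Notation VH := (F2 * VX * {ffun 'I_3 -> F2})%type.

(* The vertex 0, the vertices of Y_1 and three free ones; the first coordinate
   is 1 at each vertex, so that only even sets of vertices are dependent. *)
Definition qpt (i : option (tY1 Phi) + 'I_3) : VH :=
  match i with
  | inl None => (1, 0, 0)
  | inl (Some j) => (1, spt j, 0)
  | inr k => (1, 0, delta (Some k))
  end.

Definition Tpt (y : tY0 Phi) : VH := (0, tpt y, 0).

(** A universal conforming matroid with zero rows [rho] has one row for each point. Contracting the
    Z column of [j] at the row [inl (Some j)] identifies the unit vector of this row with [spt j],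
    and contracting the unit column of [r0] puts that vertex at 0. The edges then are the
    differences of the points. *)
Lemma template_config : cfg_noPG qpt Tpt.
Proof.
move=> phi sigma u v u0 v0 uv cover.
pose R : finType := (option (tY1 Phi) + 'I_3)%type.
pose rho (r : R) : {ffun tcore Phi -> 'F_2} := 0.
have rhoD r : rho r \in tDelta Phi by exact: Delta0.
pose VXR := {ffun tX Phi + R -> F2}.
pose px (v : VXR) : VX := [ffun x => v (inl x)].
have pxL k w w' : px (k *: w + w') = k *: px w + px w' by apply/ffunP=> x; rewrite !ffunE.
pose r0 : R := inl None.
pose jx (x : VX) : VH := (0, x, 0).
have jxL k x x' : jx (k *: x + x') = k *: jx x + jx x'.
  by congr (_, _, _); rewrite /= scaler0 addr0.
have [|phi' phiE] := @hom_of_linear VXR 'rV['F_2]_4 (fun w => phi (jx (chi (px w))) +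
    \sum_(r : R) w (inr r) *: phi (qpt r + qpt r0)).
  move=> k w w'; rewrite pxL (linearP chi) jxL (linearP phi) scalerDr scaler_sumr addrACA.
  rewrite -big_split; congr (_ + _).
  by apply: eq_bigr => r _ /=; rewrite !ffunE scalerDl scalerA.
have jx0 : jx 0 = 0 by [].
have phi_lab (m : {ffun tX Phi -> 'F_2}) : phi' (lab R m) = phi (jx (chi m)).
  rewrite phiE big1 ?addr0 => [|r _]; last by rewrite ffunE scale0r.
  by congr (phi (jx (chi _))); apply/ffunP=> x; rewrite !ffunE.
have phi_e r : phi' (evec Phi (Some r)) = phi (qpt r + qpt r0).
  rewrite phiE (_ : px _ = 0) ?linear0 ?jx0 ?linear0 ?add0r; last first.
    by apply/ffunP=> x; rewrite !ffunE.
  rewrite (bigD1 r) //= ffunE /oe eqxx scale1r big1 ?addr0 // => s sr.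
  by rewrite ffunE /oe (inj_eq Some_inj) eq_sym (negPf sr) scale0r.
have phi_qq i j : phi (qpt i + qpt r0) + phi (qpt j + qpt r0) = phi (qpt i + qpt j).
  by rewrite -linearD; congr (phi _); rewrite addrACA addF2 addr0.
have coreE y : core_col rho y = lab R (core_x y).
  by apply/ffunP=> -[x|r]; rewrite !ffunE.
(* The entry in row [r0] is such that a free point lifts to its bare unit vector: the parity
   coordinate 1 cancels against the free coordinate. *)
pose lift (w : VH) : VXR := stack (fun x => w.1.2 x) (fun r => match r with
  | inl None => w.1.1 + \sum_k w.2 k | inl (Some j) => 0 | inr k => w.2 k end).
have [|Lift LiftE] := @hom_of_linear VH VXR lift.
  move=> k w w'; apply/ffunP=> -[x|[[j|]|i]]; rewrite !ffunE //=.
  - by rewrite scaler0 addr0.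
  - rewrite scalerDr scaler_sumr addrACA -big_split; congr (_ + _).
    by apply: eq_bigr => i _; rewrite !ffunE.
set K := univ_K rho; set Ud := killed (univ_f (rho := rho)) K phi'.
have Kk : (K <= lker phi')%VS.
  by apply/sp_subP => c _; rewrite memv_ker coreE phi_lab chi_C jx0 linear0.
have KU w : w \in K -> w \in Ud by exact: mem_killedK.
have labL (J : {set tC Phi}) (g : tC Phi -> VX) :
    lab R (\sum_(c in J) g c) = \sum_(c in J) lab R (g c).
  apply/ffunP=> -[x|r]; rewrite !(sum_ffunE, ffunE).
    by apply: eq_bigr => c _; rewrite ffunE.
  by rewrite big1 // => c _; rewrite ffunE.
have lab_chi (m : VX) : lab R m - lab R (chi m) \in Ud.
  have -> : lab R m - lab R (chi m) = lab R (m - chi m).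
    by apply/ffunP=> -[x|r]; rewrite !ffunE ?subrr.
  apply: KU; have := chi_id m; rewrite chi_ker => /spP[J _ ->]; rewrite labL.
  apply: memv_suml => c _; rewrite -coreE.
  by apply: (mem_sp (fun c => core_col rho (inr c))); rewrite inE.
have kill_r0 : evec Phi (Some r0) \in Ud.
  have := @mem_killed _ _ _ (univ_f (rho := rho)) K phi'
    (univ_e rho (inl (lam0 Phi, (Some r0, None)))).
  by rewrite univ_fe evecNone addr0 phi_e addF2 linear0; apply.
have LiftD w w' : lift (w + w') = lift w + lift w' by rewrite -!LiftE linearD.
have lift_q0 : lift (qpt r0) = evec Phi (Some r0).
  apply/ffunP=> -[x|[[j|]|i]]; rewrite !ffunE //=.
  by rewrite big1 ?addr0 // => i _; rewrite ffunE.
have good i : evec Phi (Some i) - lift (qpt i) \in Ud.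
  case: i => [[j|]|k].
  - have -> : qpt (inl (Some j)) = qpt r0 + jx (spt j).
      by congr (_, _, _); rewrite /= ?addr0 ?add0r.
    have lift_jx : lift (jx (spt j)) = lab R (spt j).
      apply/ffunP=> -[x|[[j'|]|i]]; rewrite !ffunE //=.
      by rewrite big1 ?addr0 // => i _; rewrite ffunE.
    rewrite LiftD lift_q0 lift_jx.
    have := @mem_killed _ _ _ (univ_f (rho := rho)) K phi'
      (univ_e rho (inr (j, inl (Some j)))).
    rewrite univ_fz coreE linearD /= phi_lab phi_e -linearD.
    rewrite (_ : jx _ + _ = 0); last first.
      congr (_, _, _); last by rewrite /= !addr0.
        by rewrite /= add0r addF2.
      by rewrite /= addr0 addF2.
    rewrite linear0 => /(_ erefl) h1.
    apply: (memv_eq (memvD (memvD h1 (lab_chi (core_x (inl (inr j))))) kill_r0)).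
    by rewrite !oppF2 addF2_cancel -!addrA; congr (_ + _); exact: addrC.
  - by rewrite lift_q0 subrr mem0v.
  - suff -> : lift (qpt (inr k)) = evec Phi (Some (inr k)) by rewrite subrr mem0v.
    apply/ffunP=> -[x|[[j'|]|i]]; rewrite !ffunE //=.
    rewrite (bigD1 k) //= ffunE eqxx big1 ?addr0 ?F2_addrr // => i ik.
    by rewrite ffunE (inj_eq Some_inj) eq_sym (negPf ik).
have lift_t y : Lift (Tpt y) = lab R (tpt y).
  rewrite LiftE; apply/ffunP=> -[x|[[j'|]|i]]; rewrite !ffunE //=.
  by rewrite big1 ?addr0 // => i _; rewrite ffunE.
have LiftU w : w \in cfg_killed qpt Tpt phi -> Lift w \in Ud.
  suff : (cfg_killed qpt Tpt phi <= Lift @^-1: Ud)%VS.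
    by move=> /subvP h /h; rewrite memv_preim.
  rewrite subv_add; apply/andP; split; apply/sp_subP.
    move=> [i j]; rewrite inE /= => /eqP h; rewrite -memv_preim LiftE LiftD /=.
    have := @mem_killed _ _ _ (univ_f (rho := rho)) K phi'
      (univ_e rho (inl (lam0 Phi, (Some i, Some j)))).
    rewrite univ_fe linearD /= !phi_e phi_qq => /(_ h) h1.
    apply: (memv_eq (memvD h1 (memvD (good i) (good j)))).
    by rewrite !oppF2 [X in _ = _ + X]addrACA [RHS]addrA addF2 add0r.
  move=> y; rewrite inE => /eqP h; rewrite -memv_preim lift_t.
  have := @mem_killed _ _ _ (univ_f (rho := rho)) K phi' (univ_y rho y).
  rewrite univ_fy coreE phi_lab => /(_ h) h1.
  apply: (memv_eq (memvB h1 (lab_chi (core_x (inl (inl y)))))).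
  by rewrite opprB addrC subrK.
apply: (noPG (univ_conforms rhoD)).
apply: (@PG32_minor _ _ _ _ phi' (Lift \o sigma)%VF u v (@rep_univ _ _ rho) Kk u0 v0 uv).
move=> x x0; case: (cover x x0) => [xl|[i [j [h1 h2]]]|[y [h1 h2]]]; first by left.
  right; exists (univ_e rho (inl (lam0 Phi, (Some i, Some j)))).
    by rewrite univ_fe linearD /= !phi_e phi_qq.
  rewrite univ_fe comp_lfunE.
  apply: (memv_eq (memvD (LiftU _ h2) (memvD (good i) (good j)))).
  rewrite linearB linearD /= !LiftE !oppF2 [X in _ = _ + X]addrACA.
  by rewrite [X in _ = _ + X]addrC addF2_cancel [RHS]addrC.
right; exists (univ_y rho y); first by rewrite univ_fy coreE phi_lab.
rewrite univ_fy coreE comp_lfunE.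
apply: (memv_eq (memvD (LiftU _ h2) (lab_chi (core_x (inl (inl y)))))).
rewrite (linearB Lift) -[X in _ = X - _ + _]/(Lift (Tpt y)) lift_t.
by rewrite [RHS]addrC addrA subrK.
Qed.

End Template.

(** * Relations between the vertices *)

Lemma enum_seq (I : finType) (T : {set I}) : exists s : seq I,
  [/\ uniq s, size s = #|T|, T =i s &
   forall (V : vectType 'F_2) (F : I -> V), \sum_(i in T) F i = \sum_(i <- s) F i].
Proof.
exists (enum T); split; [exact: enum_uniq|by rewrite -cardE|by move=> i; rewrite mem_enum|].
by move=> V F; rewrite big_enum.
Qed.

Definition symdiff (I : finType) (S T : {set I}) : {set I} := (S :\: T) :|: (T :\: S).

Lemma in_symdiff (I : finType) (S T : {set I}) i :
  (i \in symdiff S T) = (i \in S) (+) (i \in T).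
Proof. by rewrite !inE; case: (i \in S); case: (i \in T). Qed.

Lemma card_symdiff (I : finType) (S T : {set I}) :
  (#|symdiff S T| + 2 * #|S :&: T| = #|S| + #|T|)%N.
Proof.
rewrite cardsU (_ : _ :&: _ = set0) ?cards0; last first.
  by apply/setP=> i; rewrite !inE; case: (i \in S); case: (i \in T).
have := cardsID T S; have := cardsID S T; rewrite (setIC T S); lia.
Qed.

Section Combinatorics.
Variables (V : vectType 'F_2) (I Y : finType) (q : I -> V) (t : Y -> V).
Hypothesis noPG : cfg_noPG q t.
Variables (eta : 'Hom(V, F2)) (z : 'I_3 -> I) (zeta : 'I_3 -> 'Hom(V, F2)).
Hypothesis eta_q : forall i, eta (q i) = 1.
Hypothesis eta_t : forall y, eta (t y) = 0.
Hypothesis z_inj : injective z.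
Hypothesis zeta_q : forall k i, zeta k (q i) = (i == z k)%:R.
Hypothesis zeta_t : forall k y, zeta k (t y) = 0.

(** Vertices independent modulo [U] take arbitrary weights even when [U] has to be sent to 0: extend
    over the quotient by [U]. *)
Lemma ext_indep (W : vectType 'F_2) (U : {vspace V}) (B : {set I}) (w : I -> W) :
  (forall J : {set I}, J \subset B -> \sum_(i in J) q i \in U -> J = set0) ->
  exists2 phi : 'Hom(V, W), forall u, u \in U -> phi u = 0
    & forall i, i \in B -> phi (q i) = w i.
Proof.
move=> ind; have [chi chiU _] := hom_lker U.
have [J|phi phiE] := @ext_hom V W I (fun i => if i \in B then chi (q i) else 0)
    (fun i => if i \in B then w i else 0).
  rewrite -!big_mkcondr => h; suff J0 : J :&: B = set0.
    by rewrite big1 // => i iJB; move/setP/(_ i): J0; rewrite !inE iJB.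
  apply: ind; first exact: subsetIr.
  by rewrite -chiU memv_ker linear_sum -[X in _ == X]h; apply/eqP/eq_bigl => i; rewrite inE.
exists (phi \o chi)%VF => [u uU|i iB].
  have : chi u = 0 by apply/eqP; rewrite -memv_ker chiU.
  by rewrite comp_lfunE => ->; rewrite linear0.
by have := phiE i; rewrite iB comp_lfunE.
Qed.

Lemma ext_seq (W : vectType 'F_2) (U : {vspace V}) (s : seq I) (ws : seq W) (b : I) :
  uniq s ->
  (forall J : {set I}, {subset J <= s} -> \sum_(i in J) q i \in U -> J = set0) ->
  exists2 phi : 'Hom(V, W), forall u, u \in U -> phi u = 0
    & forall k, (k < size s)%N -> phi (q (nth b s k)) = nth 0 ws k.
Proof.
move=> us ind; have [J sJ|phi phiU phiE] := @ext_indep W U [set i in s] (fun i => nth 0 ws (index i s)).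
  by apply: ind => i /(subsetP sJ); rewrite inE.
by exists phi => // k ks; rewrite phiE ?inE ?mem_nth // index_uniq.
Qed.

Section Vertices.
Variables (phi : 'Hom(V, 'rV['F_2]_4)) (sigma : 'Hom('rV['F_2]_4, V)).

(** Vertices of equal weight get merged, since the edge between them has weight 0. *)
Lemma kill_pair i j : phi (q i) = phi (q j) -> q i + q j \in cfg_killed q t phi.
Proof.
move=> e; apply/(subvP (addvSl _ _)).
have := @mem_sp V _ (fun p : I * I => q p.1 + q p.2)
  [set p | phi (q p.1 + q p.2) == 0] (i, j).
by apply; rewrite inE /= linearD /= e addF2.
Qed.

Lemma kill_t (Y' : {set Y}) : (forall u, u \in sp t Y' -> phi u = 0) ->
  (sp t Y' <= cfg_killed q t phi)%VS.
Proof.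
move=> h; apply: subv_trans (addvSr _ _); apply: spS.
by apply/subsetP=> y yY; rewrite inE h // mem_sp.
Qed.

(** It suffices to check vertices against a base vertex of weight 0: the error of a difference is
    the sum of the errors of its two ends. *)
Lemma vertex_cover (b : I) u v :
  u != 0 -> v != 0 -> u != v -> phi (q b) = 0 ->
  let good i x := phi (q i) = x /\ q i + q b - sigma x \in cfg_killed q t phi in
  (forall x, x != 0 -> [\/ x \in [:: u; v; u + v],
     exists x1 x2, x = x1 + x2 /\ (exists i, good i x1) /\ (exists j, good j x2) |
     exists y, phi (t y) = x /\ t y - sigma x \in cfg_killed q t phi]) -> False.
Proof.
move=> u0 v0 uv b0 good cover; apply: (noPG (phi := phi) (sigma := sigma) u0 v0 uv) => x x0.
case: (cover x x0) => [xl|[x1 [x2 [-> [[i [i1 i2]] [j [j1 j2]]]]]]|h].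
- by constructor 1.
- constructor 2; exists i, j; rewrite linearD /= i1 j1; split=> //.
  apply: (memv_eq (memvD i2 j2)).
  by rewrite linearD /= !oppF2 [RHS]addrACA [X in _ = X + _]addrACA addF2 addr0.
- by constructor 3.
Qed.

End Vertices.

Notation K Y' T := (\sum_(i in (T : {set I})) q i \in sp t Y').

Lemma K_symdiff Y' S T : K Y' S -> K Y' T -> K Y' (symdiff S T).
Proof. by rewrite sum_symdiff; exact: memvD. Qed.

Lemma K_even Y' T : K Y' T -> odd #|T| = false.
Proof.
case/spP=> J _ h; have := congr1 eta h; rewrite !linear_sum /=.
under eq_bigr => i _ do rewrite eta_q.
under [RHS]eq_bigr => i _ do rewrite eta_t.
rewrite [RHS]big1 // sumr_const => /eqP.
by rewrite [X in X == _](F2_natr #|T|); case: (odd _).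
Qed.

(** The coordinate [zeta k] isolates [z k]. Hence [z ord0] is always available as a further vertex
    outside the relations. *)
Lemma K_z Y' T k : K Y' T -> z k \notin T.
Proof.
case/spP=> J _ h; apply/negP=> zT; have := congr1 (zeta k) h; rewrite !linear_sum /=.
rewrite (bigD1 (z k)) //= zeta_q eqxx big1 => [|i /andP[_ /negPf iz]]; last first.
  by rewrite zeta_q iz.
by rewrite big1.
Qed.

(* K_6 with a relation on all its vertices: PG(3,2). *)
Lemma circuit_card Y' T : K Y' T ->
  (forall S : {set I}, S \subset T -> K Y' S -> S = set0 \/ S = T) -> (#|T| <= 4)%N.
Proof.
move=> KT minT; rewrite leqNgt; apply/negP=> T4.
have evT := K_even KT.
have [s [us sz sT sumT]] := enum_seq T.
have s6 : (6 <= size s)%N by rewrite sz; move: T4 evT; case: #|T| => [|[|[|[|[|[|]]]]]].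
have [c0 _] : exists c0, c0 \in T by apply/set0Pn; rewrite -card_gt0; lia.
pose c := nth c0 s.
have cT k : (k < size s)%N -> c k \in T by move=> ks; rewrite sT mem_nth.
have indc k : (k < size s)%N -> index (c k) s = k by move=> ks; exact: index_uniq.
(* By minimality the vertices of [T] other than [c 4] are independent modulo [sp t Y']; the weight
   of [c 4] is then forced by the relation. Vertices with index above 5 get the default weight 0 and
   are merged with [c 5]. *)
have ind (J : {set I}) : J \subset T :\ c 4 -> K Y' J -> J = set0.
  move=> sJ KJ; have [|//|JT] := minT J _ KJ; first exact: subset_trans sJ (subsetDl _ _).
  have : c 4 \in J by rewrite JT cT //; lia.
  by move/(subsetP sJ); rewrite !inE eqxx.
have [phi phiU phiE] := ext_indep (fun i => weight6 (index i s)) ind.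
have phi_c k : (k < size s)%N -> k != 4 -> phi (q (c k)) = weight6 k.
  move=> ks k4; rewrite phiE ?indc // !inE cT // andbT.
  by apply: contra k4 => /eqP /(congr1 (index^~ s)); rewrite (indc k ks) (indc 4) ?(leq_trans _ s6) // => ->.
have sumc (W : vectType 'F_2) (F : I -> W) : \sum_(i in T) F i =
    F (c 0) + F (c 1) + F (c 2) + F (c 3) + F (c 4) + F (c 5)
    + \sum_(6 <= k < size s) F (c k).
  rewrite sumT (big_nth c0) (@big_cat_nat _ _ _ 6) //=; congr (_ + _).
  by rewrite !big_nat_recr //= big_geq // add0r.
have weight6_out k : (6 <= k)%N -> weight6 k = 0.
  by move: k => [|[|[|[|[|[|k]]]]]] // _; rewrite /weight6 /= nth_nil.
have phi_c4 : phi (q (c 4)) = weight6 4.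
  have := phiU _ KT; rewrite linear_sum sumc /=.
  rewrite !(phi_c 0, phi_c 1, phi_c 2, phi_c 3, phi_c 5)%N ?(leq_trans _ s6) //.
  rewrite big_nat_cond big1 => [|k /andP[/andP[k6 ks] _]]; last first.
    by rewrite phi_c ?weight6_out //; lia.
  by rewrite addr0 /weight6 /= addr0 !row4D /= addrC => /eqF2 ->.
have {phiE ind} phi_c k : (k < size s)%N -> phi (q (c k)) = weight6 k.
  by move=> ks; have [->//|k4] := eqVneq k 4%N; apply: phi_c.
have [sigma sE] := hom4 (fun k : 'I_4 => q (c k) + q (c 5)).
have KU := kill_t phiU.
have good k : (k < 6)%N -> q (c k) + q (c 5) - sigma (weight6 k) \in cfg_killed q t phi.
  case: k => [|[|[|[|[|[|k]]]]]] // _; rewrite ?sE ?linear0 /weight6 /= ?sE;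
    rewrite ?big_ord_recl ?big_ord0 /= ?(scale0r, scale1r, addr0, add0r, subrr, mem0v) //.
  (* The error at [c 4] is the relation itself, after moving the vertices beyond the sixth to [c 5].
     They are even in number, so the copies of [q (c 5)] cancel. *)
  - apply: (memv_eq (memvD (subvP KU _ KT)
      (_ : \sum_(6 <= k < size s) (q (c k) + q (c 5)) \in _))).
      rewrite big_nat_cond; apply: memv_suml => k /andP[/andP[k6 ks] _].
      by apply: kill_pair; rewrite (phi_c k ks) (phi_c 5) ?(leq_trans _ s6) // weight6_out.
    rewrite sumc big_split /= sumr_const_nat -scaler_nat F2_natr oddB // sz evT scale0r.
    f2.
  - by rewrite addF2 mem0v.
apply: (@vertex_cover phi sigma (c 5) (row4 true false false false)
  (row4 false true false false)).
- by rewrite row4_eq0.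
- by rewrite row4_eq0.
- by rewrite -subr_eq0 oppF2 row4D row4_eq0.
- by rewrite phi_c.
move=> x _; constructor 2; have [i [j ->]] := weight6_cover x.
exists (weight6 i), (weight6 j); split=> //.
by split; [exists (c i)|exists (c j)]; rewrite phi_c ?(leq_trans _ s6) //; split=> //; apply: good.
Qed.

Let u7 := row4 true false true true.
Let v7 := row4 false true true true.

Lemma u7v7 : [/\ u7 != 0, v7 != 0 & u7 != v7].
Proof. by rewrite -[u7 == v7]subr_eq0 oppF2 row4D !row4_eq0. Qed.

(* Two 4-circuits and a further vertex: PG(3,2) without two points. *)
Lemma two_circuits Y' (phi : 'Hom(V, 'rV['F_2]_4)) a1 a2 a3 a4 a5 a6 a7 a8 b :
  (forall u, u \in sp t Y' -> phi u = 0) ->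
  phi (q a1) = weight7 0 -> phi (q a2) = weight7 1 -> phi (q a3) = weight7 2 ->
  phi (q a5) = weight7 0 -> phi (q a6) = weight7 1 -> phi (q a7) = weight7 3 ->
  phi (q b) = weight7 4 ->
  q a1 + q a2 + q a3 + q a4 \in sp t Y' -> q a5 + q a6 + q a7 + q a8 \in sp t Y' ->
  False.
Proof.
move=> phiU p1 p2 p3 p5 p6 p7 pb K1 K2.
have p4 : phi (q a4) = weight7 5.
  have := phiU _ K1; rewrite !linearD /= p1 p2 p3 /weight7 /= !row4D /= addrC.
  exact: eqF2.
have p8 : phi (q a8) = weight7 6.
  have := phiU _ K2; rewrite !linearD /= p5 p6 p7 /weight7 /= !row4D /= addrC.
  exact: eqF2.
have [sigma sE] := hom4 (fun k : 'I_4 => nth 0 [:: q a1 + q b; q a2 + q b; q a3 + q b;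
  q a7 + q b] k).
have KU := kill_t phiU.
pose a k := nth b [:: a1; a2; a3; a7; b; a4; a8] k.
have good (k : 'I_7) : phi (q (a k)) = weight7 k /\
    q (a k) + q b - sigma (weight7 k) \in cfg_killed q t phi.
  case: k => [[|[|[|[|[|[|[|k]]]]]]] p] //; split=> //; rewrite /weight7 /= ?sE;
    rewrite ?big_ord_recl ?big_ord0 /= ?(scale0r, scale1r, addr0, add0r, subrr, mem0v) //.
  - by rewrite linear0 addF2 subrr mem0v.
  - by apply: (memv_eq (subvP KU _ K1)); f2.
  (* The vertices [a5], [a6] have the weights of [a1], [a2] and are merged with them. This treats
     disjoint circuits and circuits sharing two vertices alike. *)
  - have k5 : q a5 + q a1 \in cfg_killed q t phi by apply: kill_pair; rewrite p5.
    have k6 : q a6 + q a2 \in cfg_killed q t phi by apply: kill_pair; rewrite p6.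
    by apply: (memv_eq (memvD (memvD (subvP KU _ K2) k5) k6)); f2.
have [u0 v0 uv] := u7v7.
apply: (vertex_cover (sigma := sigma) u0 v0 uv pb) => x _.
have [xl|[i [j ->]]] := weight7_cover x; first by constructor 1.
constructor 2; exists (weight7 i), (weight7 j); split=> //.
by split; [exists (a i); exact: good|exists (a j); exact: good].
Qed.

(* Three of the 4-subsets of five independent points: PG(3,2) without two points. *)
Lemma three_quads (phi : 'Hom(V, 'rV['F_2]_4)) b1 b2 b3 b4 b5 y1 y2 y3 :
  phi (q b1) = weight7 0 -> phi (q b2) = weight7 1 -> phi (q b3) = weight7 2 ->
  phi (q b4) = weight7 3 -> phi (q b5) = weight7 4 ->
  t y1 = q b1 + q b2 + q b3 + q b4 -> t y2 = q b1 + q b2 + q b3 + q b5 ->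
  t y3 = q b1 + q b2 + q b4 + q b5 -> False.
Proof.
move=> p1 p2 p3 p4 p5 t1 t2 t3.
have [sigma sE] := hom4 (fun k : 'I_4 => nth 0 [:: q b1 + q b5; q b2 + q b5; q b3 + q b5;
  q b4 + q b5] k).
pose b k := nth b5 [:: b1; b2; b3; b4; b5] k.
have good (k : 'I_5) : phi (q (b k)) = weight7 k /\
    q (b k) + q b5 - sigma (weight7 k) \in cfg_killed q t phi.
  case: k => [[|[|[|[|[|k]]]]] p] //; split=> //; rewrite /weight7 /= ?sE;
    rewrite ?big_ord_recl ?big_ord0 /= ?(scale0r, scale1r, addr0, add0r, subrr, mem0v) //.
  by rewrite linear0 addF2 subrr mem0v.
have [u0 v0 uv] := u7v7.
apply: (vertex_cover (sigma := sigma) u0 v0 uv p5) => x _.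
have [xl|[i [j ->]]|] := weight5_cover x; first by constructor 1.
  constructor 2; exists (weight7 i), (weight7 j); split=> //.
  by split; [exists (b i); exact: good|exists (b j); exact: good].
have in0 v w : v = w -> v - w \in cfg_killed q t phi by move=> ->; rewrite subrr mem0v.
rewrite !inE => /or3P[] /eqP->; constructor 3; [exists y1|exists y2|exists y3]; split;
  rewrite ?t1 ?t2 ?t3 ?linearD /= ?p1 ?p2 ?p3 ?p4 ?p5 /weight7 /= ?row4D ?addr0 ?row4D //;
  apply: in0; rewrite sE !big_ord_recl big_ord0 /= ?(scale0r, scale1r, addr0, add0r); f2.
Qed.

Section Distinct.
Variables (Y' : {set Y}) (I0 : {set I}).
Implicit Types S T J : {set I}.
Hypothesis dist : forall i j, i \in I0 -> j \in I0 -> i != j -> q i + q j \notin sp t Y'.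

Lemma K_card2 T : T \subset I0 -> K Y' T -> #|T| != 2%N.
Proof.
move=> /subsetP sT KT; apply/negP=> /cards2P[i [j [ij TE]]].
move: KT; rewrite TE big_setU1 ?inE //= big_set1; apply/negP.
by apply: dist => //; apply: sT; rewrite TE !inE eqxx ?orbT.
Qed.

(** A minimal relation has at most four elements by [circuit_card]; it is even, and it is not a pair
    because the points are distinct. *)
Lemma K_four T : T \subset I0 -> K Y' T -> T != set0 ->
  exists2 T' : {set I}, T' \subset T & K Y' T' /\ #|T'| = 4%N.
Proof.
move=> sT KT T0.
have [|T' minT' sT'] := minset_exists (P := fun S : {set I} => (S != set0) && (K Y' S)) (C := T).
  by rewrite T0.
have /minsetP[/andP[T'0 KT'] minT] := minT'.
exists T' => //; split=> //.
have le4 : (#|T'| <= 4)%N.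
  apply: circuit_card KT' _ => S sS KS; have [->|S0] := eqVneq S set0; first by left.
  by right; apply: minT => //; rewrite S0.
have ev := K_even KT'; have n2 := K_card2 (subset_trans sT' sT) KT'.
move: T'0 le4 ev n2; rewrite -card_gt0.
by case: #|T'| => [|[|[|[|[|]]]]].
Qed.

(** Two different ones could only meet in two elements or be disjoint. Either way [two_circuits]
    applies, with [z ord0] as the further vertex, provided that the vertices with prescribed weights
    are independent. *)
Lemma K_four_unique T1 T2 : T1 \subset I0 -> T2 \subset I0 -> K Y' T1 -> K Y' T2 ->
  #|T1| = 4%N -> #|T2| = 4%N -> T1 = T2.
Proof.
have sD S T : S \subset I0 -> T \subset I0 -> symdiff S T \subset I0.
  by move=> sS sT; rewrite subUset !(subset_trans (subsetDl _ _)).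
have zI0 k (J : {set I}) : K Y' J -> z k \notin J by exact: K_z.
(* It remains to see that T1 and T2 meet in two elements or not at all. *)
have red S T : S \subset I0 -> T \subset I0 -> K Y' S -> K Y' T ->
    #|S| = 4%N -> #|T| = 4%N -> S != T -> #|S :&: T| = 0%N \/ #|S :&: T| = 2%N.
  move=> sS sT KS KT S4 T4 ST; have := card_symdiff S T; rewrite S4 T4.
  have KD := K_symdiff KS KT; have sDI := sD _ _ sS sT.
  have D2 := K_card2 sDI KD.
  (* A relation of size 6 contains one of size 4, and the remaining pair would be a relation,
     too. *)
  have D6 : #|symdiff S T| != 6%N.
    apply/negP=> /eqP D6; have [|D' sD' [KD' D'4]] := K_four sDI KD.
      by rewrite -card_gt0 D6.
    have := K_card2 (sD _ _ sDI (subset_trans sD' sDI)) (K_symdiff KD KD').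
    have := card_symdiff (symdiff S T) D'; rewrite (setIidPr sD') D6 D'4.
    by move=> e; have -> : #|symdiff (symdiff S T) D'| = 2%N by move: e; clear; lia.
  have D0 : #|symdiff S T| != 0%N.
    apply: contra ST; rewrite cards_eq0 => /eqP/setP D0.
    apply/eqP/setP=> i; have := D0 i; rewrite in_symdiff inE.
    by case: (i \in S); case: (i \in T).
  move=> e; have : (#|S :&: T| <= 4)%N by rewrite -S4 subset_leq_card // subsetIl.
  by move: e D0 D2 D6; clear; case: #|S :&: T| => [|[|[|[|[|]]]]]; lia.
have four S : #|S| = 4%N -> forall i, i \in S -> exists i2 i3 i4,
    [/\ uniq [:: i; i2; i3; i4], S =i [:: i; i2; i3; i4] &
      \sum_(j in S) q j = q i + q i2 + q i3 + q i4].
  move=> S4 i iS; have [s [us ss sS sumS]] := enum_seq (S :\ i).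
  move: ss; rewrite [#|S :\ i|](_ : _ = 3%N); last by move: S4; rewrite (cardsD1 i) iS; lia.
  case: s us sS sumS => [|i2 [|i3 [|i4 [|]]]] //= us sS sumS _; exists i2, i3, i4; split.
  - by rewrite /= us andbT -[X in ~~ X]sS !inE eqxx.
  - move=> j; have := sS j; rewrite !inE; have [->|_] := eqVneq j i; first by rewrite iS.
    by move=> /= <-.
  - by rewrite (big_setD1 i) //= sumS !big_cons big_nil addr0 !addrA.
have meet2 S T : S \subset I0 -> T \subset I0 -> K Y' S -> K Y' T ->
    #|S| = 4%N -> #|T| = 4%N -> #|S :&: T| = 2%N -> False.
  move=> sS sT KS KT S4 T4 ST2.
  have c1 : #|S :\: T| = 2%N by rewrite cardsD ST2 S4.
  have c2 : #|T :\: S| = 2%N by rewrite cardsD setIC ST2 T4.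
  have /eqP/cards2P[a1 [a2 [a12 STE]]] := ST2.
  have /eqP/cards2P[a3 [a4 [a34 SE]]] := c1.
  have /eqP/cards2P[a7 [a8 [a78 TE]]] := c2.
  have sum2 x y (xy : x != y) : \sum_(i in [set x; y]) q i = q x + q y.
    by rewrite big_setU1 ?inE //= big_set1.
  have KS' : q a1 + q a2 + q a3 + q a4 \in sp t Y'.
    by move: KS; rewrite (big_setID T) /= STE SE !sum2 // addrA.
  have KT' : q a1 + q a2 + q a7 + q a8 \in sp t Y'.
    by move: KT; rewrite (big_setID S) /= setIC STE TE !sum2 // addrA.
  have in1 : (a1 \in S) && (a1 \in T) by rewrite -in_setI STE !inE eqxx.
  have in2 : (a2 \in S) && (a2 \in T) by rewrite -in_setI STE !inE eqxx orbT.
  have in3 : (a3 \notin T) && (a3 \in S) by rewrite -in_setD SE !inE eqxx.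
  have in4 : (a4 \notin T) && (a4 \in S) by rewrite -in_setD SE !inE eqxx orbT.
  have in7 : (a7 \notin S) && (a7 \in T) by rewrite -in_setD TE !inE eqxx.
  have us : uniq [:: a1; a2; a3; a7; z ord0].
    rewrite /= !inE !negb_or a12 /=.
    have ne x y (A : {set I}) : x \in A -> y \notin A -> x != y.
      by move=> xA; apply: contraNneq => <-.
    have ne' x y (A : {set I}) : x \notin A -> y \in A -> x != y.
      by move=> xA yA; rewrite eq_sym; apply: ne yA xA.
    case/andP: in1 in2 => s1 t1 /andP[s2 t2]; case/andP: in3 in7 => t3 s3 /andP[s7 t7].
    have zS := K_z (ord0) KS; have zT := K_z (ord0) KT.
    by rewrite (ne _ _ T) // (ne _ _ S) // (ne _ _ S) // (ne _ _ T) // (ne _ _ S) //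
      (ne _ _ S) // (ne' _ _ T) // (ne _ _ S) // (ne _ _ T).
  have [J sJ KJ|phi phiU phiE] := ext_seq
      [:: weight7 0; weight7 1; weight7 2; weight7 3; weight7 4] (z ord0) us (U := sp t Y').
    (* A relation here avoids [z ord0], so it contains a 4-circuit on all of [a1], [a2], [a3], [a7];
       this meets [S] in three elements without being [S], which [red] excludes. *)
    apply/eqP/contraT => J0.
    have sJ4 : {subset J <= [:: a1; a2; a3; a7]}.
      move=> i iJ; have := sJ i iJ; rewrite !inE.
      case: (eqVneq i (z ord0)) => [e|_]; first by move: (zI0 ord0 _ KJ); rewrite -e iJ.
      by rewrite orbF.
    have JI0 : J \subset I0.
      apply/subsetP=> i /sJ4; rewrite !inE => /or4P[] /eqP->.
      - by apply: (subsetP sS); case/andP: in1.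
      - by apply: (subsetP sS); case/andP: in2.
      - by apply: (subsetP sS); case/andP: in3.
      - by apply: (subsetP sT); case/andP: in7.
    have [J' sJ' [KJ' J'4]] := K_four JI0 KJ J0.
    have J'E : J' =i [:: a1; a2; a3; a7].
      have sub : J' \subset [set i in [:: a1; a2; a3; a7]].
        by apply/subsetP=> i /(subsetP sJ')/sJ4; rewrite inE.
      have le : (#|[set i in [:: a1; a2; a3; a7]]| <= 4)%N.
        by rewrite cardsE; exact: card_size.
      have /eqP -> : J' == [set i in [:: a1; a2; a3; a7]].
        by rewrite eqEcard sub J'4.
      by move=> i; rewrite inE.
    have SJ' : S != J'.
      apply/eqP=> e; have := J'E a4; rewrite -e; case/andP: in4 => t4 ->.
      case/andP: in1 => _ t1; case/andP: in2 => _ t2; case/andP: in7 => _ t7.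
      rewrite !inE [a4 == a3]eq_sym (negPf a34) /=.
      by move=> /esym/or3P[] /eqP a4E; move: t4; rewrite a4E ?t1 ?t2 ?t7.
    have le3 : (3 <= #|S :&: J'|)%N.
      apply: leq_trans (_ : #|[set i in [:: a1; a2; a3]]| <= _)%N.
        have /card_uniqP h : uniq [:: a1; a2; a3].
          move: us; rewrite /= !inE !negb_or.
          by case/and3P=> /and4P[-> -> _ _] /and3P[-> _ _] _.
        by rewrite cardsE h.
      apply: subset_leq_card; apply/subsetP=> i; rewrite !inE J'E !inE.
      case/andP: in1 => ? _; case/andP: in2 => ? _; case/andP: in3 => _ ?.
      by case/or3P=> /eqP->; rewrite eqxx ?orbT andbT.
    by have [] := red S J' sS (subset_trans sJ' JI0) KS KJ' S4 J'4 SJ' => e; rewrite e in le3.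
  apply: (two_circuits phiU (phiE 0%N isT) (phiE 1%N isT) (phiE 2 isT) (phiE 0%N isT)
    (phiE 1%N isT) (phiE 3 isT) (phiE 4 isT) KS' KT').
move=> s1 s2 K1 K2 c1 c2; apply/eqP; apply: contraT => T12.
have [d0|d2] := red _ _ s1 s2 K1 K2 c1 c2 T12; last by case: (meet2 T1 T2).
have dis i : i \in T1 -> i \in T2 -> false.
  by move=> i1 i2; move/eqP: d0; rewrite cards_eq0 => /eqP/setP/(_ i); rewrite !inE i1 i2.
have T1T2 i j : i \in T1 -> j \in T2 -> i != j.
  by move=> iT jT; apply/negP=> /eqP e; have := dis i iT; rewrite e => /(_ jT).
have /card_gt0P[a1 in1] : (0 < #|T1|)%N by rewrite c1.
have /card_gt0P[a5 in5] : (0 < #|T2|)%N by rewrite c2.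
have [a2 [a3 [a4 [u1 E1 sum1]]]] := four T1 c1 a1 in1.
have [a6 [a7 [a8 [u2 E2 sum2]]]] := four T2 c2 a5 in5.
have z1 := K_z ord0 K1; have z2 := K_z ord0 K2.
have us : uniq [:: a1; a2; a3; a5; a6; a7; z ord0].
  have -> : [:: a1; a2; a3; a5; a6; a7; z ord0] = [:: a1; a2; a3] ++ [:: a5; a6; a7] ++ [:: z ord0].
    by [].
  have sub1 i : i \in [:: a1; a2; a3] -> i \in T1.
    by rewrite E1 !inE => /or3P[] /eqP->; rewrite eqxx ?orbT.
  have sub2 i : i \in [:: a5; a6; a7] -> i \in T2.
    by rewrite E2 !inE => /or3P[] /eqP->; rewrite eqxx ?orbT.
  have p1 : uniq [:: a1; a2; a3] by move: u1; rewrite -[[:: _; _; _; _]]/([:: a1; a2; a3] ++ [:: a4]) cat_uniq => /andP[].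
  have p2 : uniq [:: a5; a6; a7] by move: u2; rewrite -[[:: _; _; _; _]]/([:: a5; a6; a7] ++ [:: a8]) cat_uniq => /andP[].
  rewrite !cat_uniq p1 p2 /= !orbF !andbT !negb_or.
  have ne i j : i \in T1 -> j \in T2 -> j != i by rewrite eq_sym; exact: T1T2.
  have nz1 i : i \in T1 -> z ord0 != i by apply: contraTneq => <-.
  have nz2 i : i \in T2 -> z ord0 != i by apply: contraTneq => <-.
  have [m1 m2 m3] : [/\ a1 \in T1, a2 \in T1 & a3 \in T1] by rewrite !E1 !inE !eqxx !orbT.
  have [m5 m6 m7] : [/\ a5 \in T2, a6 \in T2 & a7 \in T2] by rewrite !E2 !inE !eqxx !orbT.
  by rewrite (nz1 _ m1) (nz1 _ m2) (nz1 _ m3) (nz2 _ m5) (nz2 _ m6) (nz2 _ m7) !ne.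
have [J sJ KJ|phi phiU phiE] := ext_seq [:: weight7 0; weight7 1; weight7 2; weight7 0;
    weight7 1; weight7 3; weight7 4] (z ord0) us (U := sp t Y'); last first.
  exfalso; apply: (two_circuits phiU (phiE 0%N isT) (phiE 1%N isT) (phiE 2 isT) (phiE 3 isT)
    (phiE 4 isT) (phiE 5 isT) (phiE 6 isT) (a4 := a4) (a8 := a8)).
    by move: K1; rewrite sum1.
  by move: K2; rewrite sum2.
(* A relation here contains a 4-circuit inside [T1 :|: T2] avoiding [a4] and [a8], so different from
   both. By [red] and [meet2] it is disjoint from each of them, which is absurd. *)
apply/eqP/contraT => J0.
have sJT : J \subset T1 :|: T2.
  apply/subsetP=> i iJ; have := sJ i iJ; rewrite !inE E1 E2 !inE.
  case: (eqVneq i (z ord0)) => [e|_]; first by move: (K_z ord0 KJ); rewrite -e iJ.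
  by rewrite orbF => /or4P[->|->|->|/or3P[]->]; rewrite ?orbT.
have JI0 : J \subset I0 by apply: subset_trans sJT _; rewrite subUset s1.
have [J' sJ' [KJ' J'4]] := K_four JI0 KJ J0.
have J'I0 := subset_trans sJ' JI0.
have notin i (s : seq I) : i \notin s -> {subset J <= s} -> i \notin J'.
  by move=> is_ sub; apply: contra is_ => /(subsetP sJ')/sub.
have a4J : a4 \notin J'.
  apply: notin sJ; move: u1; rewrite /= !inE !negb_or.
  case/and3P=> /and3P[_ _ n1] /andP[_ n2] /andP[n3 _].
  have a4T : a4 \in T1 by rewrite E1 !inE eqxx !orbT.
  have sub2 i : i \in [:: a5; a6; a7] -> i \in T2.
    by rewrite E2 !inE => /or3P[] /eqP->; rewrite eqxx ?orbT.
  have nz : a4 != z ord0 by apply: contraNneq z1 => <-.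
  rewrite nz ![a4 == a1]eq_sym [a4 == a2]eq_sym [a4 == a3]eq_sym n1 n2 n3 /=.
  by rewrite !T1T2 ?sub2 ?inE ?eqxx ?orbT.
have a8J : a8 \notin J'.
  apply: notin sJ; move: u2; rewrite /= !inE !negb_or.
  case/and3P=> /and3P[_ _ n1] /andP[_ n2] /andP[n3 _].
  have a8T : a8 \in T2 by rewrite E2 !inE eqxx !orbT.
  have sub1 i : i \in [:: a1; a2; a3] -> i \in T1.
    by rewrite E1 !inE => /or3P[] /eqP->; rewrite eqxx ?orbT.
  have nz : a8 != z ord0 by apply: contraNneq z2 => <-.
  rewrite nz ![a8 == _]eq_sym n1 n2 n3 /=.
  by rewrite !T1T2 ?sub1 ?inE ?eqxx ?orbT.
have dis1 : T1 :&: J' = set0.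
  have T1J : T1 != J' by apply: contraNneq a4J => <-; rewrite E1 !inE eqxx !orbT.
  have [/eqP|/(meet2 _ _ s1 J'I0 K1 KJ' c1 J'4)//] := red _ _ s1 J'I0 K1 KJ' c1 J'4 T1J.
  by rewrite cards_eq0 => /eqP.
have dis2 : T2 :&: J' = set0.
  have T2J : T2 != J' by apply: contraNneq a8J => <-; rewrite E2 !inE eqxx !orbT.
  have [/eqP|/(meet2 _ _ s2 J'I0 K2 KJ' c2 J'4)//] := red _ _ s2 J'I0 K2 KJ' c2 J'4 T2J.
  by rewrite cards_eq0 => /eqP.
have /card_gt0P[i iJ'] : (0 < #|J'|)%N by rewrite J'4.
have := subsetP sJT i (subsetP sJ' i iJ'); rewrite inE => /orP[] iT.
  by move/setP/(_ i): dis1; rewrite !inE iT iJ'.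
by move/setP/(_ i): dis2; rewrite !inE iT iJ'.
Qed.

(** If a relation properly contained a 4-circuit, the difference would be a relation and contain a
    second 4-circuit, disjoint from the first. *)
Lemma K_unique T1 T2 : T1 \subset I0 -> T2 \subset I0 -> K Y' T1 -> K Y' T2 ->
  T1 != set0 -> T2 != set0 -> T1 = T2 /\ #|T1| = 4%N.
Proof.
have main T : T \subset I0 -> K Y' T -> T != set0 -> #|T| = 4%N.
  move=> sT KT T0; have [T' sT' [KT' c4]] := K_four sT KT T0.
  have KD := K_symdiff KT KT'.
  have sD : symdiff T T' \subset T by rewrite subUset subsetDl (subset_trans (subsetDl _ _) sT').
  have [D0|D0] := eqVneq (symdiff T T') set0.
    suff -> : T = T' by [].
    apply/setP=> i; move/setP/(_ i): D0; rewrite in_symdiff inE.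
    by case: (i \in T); case: (i \in T').
  have [S sS [KS cS]] := K_four (subset_trans sD sT) KD D0.
  have e : T' = S.
    by apply: K_four_unique => //; [exact: subset_trans sT' sT|
      exact: subset_trans sS (subset_trans sD sT)].
  have /card_gt0P[i iT'] : (0 < #|T'|)%N by rewrite c4.
  by have := subsetP sS i; rewrite -e iT' in_symdiff iT' (subsetP sT') //= => /(_ isT).
move=> s1 s2 K1 K2 n1 n2; split; last exact: main.
by apply: K_four_unique => //; exact: main.
Qed.

End Distinct.

Definition good_config : Prop := exists (B : finType) (p : B -> V) (T : {set B}),
  [/\ #|T| = 4%N,
      forall J : {set B}, \sum_(b in J) p b = 0 <-> J = set0 \/ J = T,
      forall i, exists b, q i = p b
    & forall y, exists b b', t y = p b + p b'].

Lemma good_sub (B : finType) (D : {set B}) (p : B -> V) (T : {set B}) :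
  T \subset D -> #|T| = 4%N ->
  (forall J : {set B}, J \subset D -> \sum_(b in J) p b = 0 <-> J = set0 \/ J = T) ->
  (forall i, exists2 b, b \in D & q i = p b) ->
  (forall y, exists b b', [/\ b \in D, b' \in D & t y = p b + p b']) ->
  good_config.
Proof.
move=> sT T4 ker qD tD; pose B' : finType := {b : B | b \in D}.
pose up (J : {set B'}) : {set B} := val @: J.
have upD J : up J \subset D by apply/subsetP=> _ /imsetP[[b bD] _ ->].
have sum_up (J : {set B'}) : \sum_(b in J) p (val b) = \sum_(b in up J) p b.
  by rewrite big_imset // => x y _ _; exact: val_inj.
have up_inj J J' : up J = up J' -> J = J' by exact: (imset_inj val_inj).
pose T' : {set B'} := [set b | val b \in T].
have upT : up T' = T.
  apply/setP=> b; apply/imsetP/idP => [[x + ->]|bT]; first by rewrite inE.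
  by exists (exist (fun b => b \in D) b (subsetP sT b bT)); rewrite ?inE.
exists B', (fun b => p (val b)), T'; split.
- by rewrite -T4 -upT card_imset //; exact: val_inj.
- move=> J; rewrite sum_up; have [h1 h2] := ker (up J) (upD J).
  have up0 : up set0 = set0 by exact: imset0.
  split=> [/h1[]|[]] e; [left|right|apply: h2; left|apply: h2; right].
  + by apply: up_inj; rewrite e up0.
  + by apply: up_inj; rewrite e upT.
  + by rewrite e up0.
  + by rewrite e upT.
- by move=> i; have [b bD e] := qD i; exists (exist (fun b => b \in D) b bD).
- move=> y; have [b [b' [bD bD' e]]] := tD y.
  by exists (exist (fun b => b \in D) b bD), (exist (fun b => b \in D) b' bD').
Qed.

Lemma symdiff_eq0 (S T : {set I}) : symdiff S T = set0 -> S = T.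
Proof.
move=> D0; apply/setP=> i; move/setP/(_ i): D0; rewrite in_symdiff inE.
by case: (i \in S); case: (i \in T).
Qed.

(** If the points have a relation, it is one 4-set. A vector [t y] that is no difference of points
    keeps them distinct when contracted, so its expansion [Jf y] would be this same relation and
    [t y] would be 0. If the points are independent, the exceptional vectors are sums of four
    points, and these 4-sets share a triple, whose sum is added as a new vertex. *)
Lemma config_good : (forall y, t y \in sp q setT) -> good_config.
Proof.
(* Different indices may carry the same point; [can] selects one index for each, so that the points
   on [I0] are distinct. *)
move=> tq; pose can i := odflt i [pick j | q j == q i].
have canE i : q (can i) = q i by rewrite /can; case: pickP => [j /eqP|].
have can_eq i j : q i = q j -> can i = can j.
  move=> e; rewrite /can (eq_pick (Q := fun k => q k == q j)); last by move=> k /=; rewrite e.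
  by case: pickP => // /(_ j); rewrite eqxx.
pose I0 := [set i | can i == i].
have canI0 i : can i \in I0 by rewrite inE (can_eq (can i) i).
have I0_inj i j : i \in I0 -> j \in I0 -> q i = q j -> i = j.
  by rewrite !inE => /eqP {2}<- /eqP {2}<-; exact: can_eq.
have zI0 k : z k \in I0.
  rewrite inE; have := congr1 (zeta k) (canE (z k)); rewrite !zeta_q eqxx.
  by case: eqP.
have qI0 : (sp q setT <= sp q I0)%VS.
  by apply/sp_subP=> i _; rewrite -canE mem_sp.
have /fin_all_exists[Jf JfP] : forall y, exists J : {set I}, J \subset I0 /\ t y = \sum_(i in J) q i.
  by move=> y; have /spP[J sJ e] := subvP qI0 _ (tq y); exists J.
have sp1 y v : v \in sp t [set y] -> v = 0 \/ v = t y.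
  case/spP=> J; rewrite subset1 => /orP[] /eqP->; rewrite ?big_set1 ?big_set0; by [left|right].
have sp0 v : v \in sp t set0 -> v = 0 by rewrite sp_set0 memv0 => /eqP.
have eqJ y : t y != 0 -> Jf y != set0.
  by move=> t0; apply: contraNneq t0 => J0; rewrite (JfP y).2 J0 big_set0.
have KJf (Y' : {set Y}) y : y \in Y' -> K Y' (Jf y).
  by move=> yY; rewrite -(JfP y).2 mem_sp.
have pair0 i j : i \in I0 -> j \in I0 -> i != j -> q i + q j != 0.
  by move=> iI jI; apply: contraNneq => /eqF2 /(I0_inj _ _ iI jI) ->.
pose nice y := t y = 0 \/ exists i j, [/\ i \in I0, j \in I0 & t y = q i + q j].
have dist1 y : ~ nice y -> forall i j, i \in I0 -> j \in I0 -> i != j ->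
    q i + q j \notin sp t [set y].
  move=> ny i j iI jI ij; apply/negP=> /sp1[/eqP|e].
    by apply/negP; exact: pair0.
  by apply: ny; right; exists i, j.
have dist0 i j : i \in I0 -> j \in I0 -> i != j -> q i + q j \notin sp t set0.
  by move=> iI jI ij; apply/negP=> /sp0/eqP; apply/negP; exact: pair0.
have niceP y : nice y \/ ~ nice y.
  have [/eqP t0|t0] := boolP (t y == 0); first by left; left.
  have [/existsP[i /existsP[j /and3P[iI jI /eqP e]]]|h] :=
      boolP [exists i, exists j, [&& i \in I0, j \in I0 & t y == q i + q j]].
    by left; right; exists i, j.
  right=> -[e|[i [j [iI jI e]]]]; first by rewrite e eqxx in t0.
  by case/negP: h; apply/existsP; exists i; apply/existsP; exists j; rewrite iI jI e eqxx.
have qcov i : exists2 b, b \in I0 & q i = q b by exists (can i); rewrite ?canE.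
have [/existsP[T0 /and3P[sT0 T00 /eqP T0K]]|noT] :=
    boolP [exists T : {set I}, [&& T \subset I0, T != set0 & \sum_(i in T) q i == 0]].
  have KT0 Y' : K Y' T0 by rewrite T0K mem0v.
  have ut (J : {set I}) : J \subset I0 -> J != set0 -> \sum_(i in J) q i = 0 -> T0 = J /\ #|T0| = 4%N.
    by move=> sJ J0 JK; apply: (K_unique dist0) => //; rewrite ?JK ?T0K mem0v.
  apply: (@good_sub I I0 q T0) => //; first by case: (ut T0).
    move=> J sJ; split=> [JK|[]->]; rewrite ?big_set0 //.
    by have [->|J0] := eqVneq J set0; [left|right; case: (ut J)].
  move=> y; have [[t0|h]|ny] := niceP y; first by exists (z ord0), (z ord0); rewrite addF2.
    by case: h => i [j h]; exists i, j.
  have t0 : t y != 0 by apply/eqP=> t0; apply: ny; left.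
  have [e _] := K_unique (dist1 y ny) sT0 (JfP y).1 (KT0 _) (KJf [set y] y (set11 y)) T00 (eqJ y t0).
  by case/eqP: t0; rewrite (JfP y).2 -e.
have ind (J : {set I}) : J \subset I0 -> \sum_(i in J) q i = 0 -> J = set0.
  move=> sJ JK; apply/eqP; apply: contraNT noT => J0.
  by apply/existsP; exists J; rewrite sJ J0 JK eqxx.
have nn_t0 y : ~ nice y -> t y != 0 by move=> ny; apply/eqP=> t0; apply: ny; left.
have card4 y : ~ nice y -> #|Jf y| = 4%N.
  move=> ny; have K1 := KJf [set y] y (set11 y); have J0 := eqJ y (nn_t0 y ny).
  by case: (K_unique (dist1 y ny) (JfP y).1 (JfP y).1 K1 K1 J0 J0).
(* If [t y1 + t y2] is no difference of points, the points remain distinct after contracting both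
   vectors, and uniqueness makes the two sets equal. Otherwise the symmetric difference is a
   pair. *)
have meet3 y1 y2 : ~ nice y1 -> ~ nice y2 -> Jf y1 != Jf y2 -> #|Jf y1 :&: Jf y2| = 3%N.
  move=> n1 n2 J12.
  have [/existsP[i /existsP[j /and4P[iI jI ij /eqP e]]]|h] := boolP [exists i, exists j,
      [&& i \in I0, j \in I0, i != j & t y1 + t y2 == q i + q j]].
    have D2 : symdiff (symdiff (Jf y1) (Jf y2)) [set i; j] = set0.
      apply: ind.
        rewrite !subUset !(subset_trans (subsetDl _ _)) ?subUset ?(subset_trans (subsetDl _ _)) //;
          rewrite ?(JfP _).1 //= ?sub1set ?iI //.
      rewrite !sum_symdiff -!(JfP _).2 e big_setU1 ?inE //= big_set1.
      by rewrite addF2.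
    have := card_symdiff (Jf y1) (Jf y2); rewrite (symdiff_eq0 D2) cards2 ij !card4 //.
    lia.
  have d i j : i \in I0 -> j \in I0 -> i != j -> q i + q j \notin sp t [set y1; y2].
    move=> iI jI ij; apply/negP; rewrite setUC spU => /memv_addP[a /sp1 aE [b /sp1 bE e]].
    case: aE bE e => [->|->] [->|->]; rewrite ?addr0 ?add0r => e.
    - by have := pair0 i j iI jI ij; rewrite e eqxx.
    - by apply: n1; right; exists i, j.
    - by apply: n2; right; exists i, j.
    - case/negP: h; apply/existsP; exists i; apply/existsP; exists j.
      by rewrite iI jI ij e addrC eqxx.
  have [e _] := K_unique d (JfP y1).1 (JfP y2).1 (KJf [set y1; y2] y1 (set21 _ _))
    (KJf [set y1; y2] y2 (set22 _ _)) (eqJ _ (nn_t0 _ n1)) (eqJ _ (nn_t0 _ n2)).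
  by rewrite e eqxx in J12.
(* 4-sets that pairwise meet in three elements share a triple unless three of them lie in a common
   5-set, and then [three_quads] applies. Without exceptional vectors any triple will do; the three
   free vertices ensure that there is one. *)
have [A [sA A3 Acore]] : exists A : {set I}, [/\ A \subset I0, #|A| = 3%N &
    forall y, ~ nice y -> A \subset Jf y].
  have /fin_all_exists[nb nbP] : forall y, exists b : bool, b <-> nice y.
    by move=> y; case: (niceP y) => h; [exists true|exists false].
  have nbN y : ~ nice y -> ~~ nb y by move=> ny; apply/negP=> /nbP.
  have [/existsP[y1 /negP n1]|h1] := boolP [exists y, ~~ nb y]; last first.
    exists (z @: setT); split.
    - by apply/subsetP=> _ /imsetP[k _ ->].
    - by rewrite card_imset // cardsT card_ord.
    - by move=> y /nbN ny; case/existsP: h1; exists y.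
  have {}n1 : ~ nice y1 by move/nbP.
  have J1I := (JfP y1).1; have c1 := card4 _ n1.
  have [/existsP[y2 /andP[/negP n2 J12]]|h2] := boolP [exists y, ~~ nb y && (Jf y1 != Jf y)];
    last first.
    have /card_gt0P[a aJ] : (0 < #|Jf y1|)%N by rewrite c1.
    exists (Jf y1 :\ a); split; first exact: subset_trans (subsetDl _ _) J1I.
      by move: c1; rewrite (cardsD1 a) aJ => /eqP; rewrite eqSS => /eqP.
    move=> y ny; suff -> : Jf y = Jf y1 by exact: subsetDl.
    apply/eqP; apply: contraNT h2; rewrite eq_sym => J1y.
    by apply/existsP; exists y; rewrite nbN.
  have {}n2 : ~ nice y2 by move/nbP.
  have J2I := (JfP y2).1; have c2 := card4 _ n2; have cA := meet3 _ _ n1 n2 J12.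
  exists (Jf y1 :&: Jf y2); split=> //; first by rewrite subIset // J1I.
  move=> y3 n3; apply/contraT => /subsetPn[a]; rewrite inE => /andP[a1 a2] a3.
  have c3 := card4 _ n3.
  have sub (J : {set I}) : #|J| = 4%N -> a \in J -> #|J :&: Jf y3| = 3%N -> J :\ a \subset Jf y3.
    move=> J4 aJ cJ; suff -> : J :\ a = J :&: Jf y3 by exact: subsetIr.
    apply/eqP; rewrite eq_sym eqEcard; apply/andP; split.
      apply/subsetP=> i; rewrite !inE => /andP[iJ i3]; rewrite iJ andbT.
      by apply: contraNneq a3 => <-.
    by rewrite cJ; move: J4; rewrite (cardsD1 a) aJ; clear; lia.
  have m13 : #|Jf y1 :&: Jf y3| = 3%N.
    by apply: meet3 => //; apply: contraNneq a3 => <-.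
  have m23 : #|Jf y2 :&: Jf y3| = 3%N.
    by apply: meet3 => //; apply: contraNneq a3 => <-.
  have s13 := sub _ c1 a1 m13; have s23 := sub _ c2 a2 m23.
  have /cards2P[b [c [bc AE]]] : #|(Jf y1 :&: Jf y2) :\ a| == 2%N.
    by move: cA; rewrite (cardsD1 a) inE a1 a2 => /eqP; rewrite eqSS.
  have /cards1P[x xE] : #|Jf y1 :\: Jf y2| == 1%N by rewrite cardsD c1 cA.
  have /cards1P[x' x'E] : #|Jf y2 :\: Jf y1| == 1%N by rewrite cardsD setIC c2 cA.
  have bA : [&& b != a, b \in Jf y1 & b \in Jf y2].
    by have := set21 b c; rewrite -AE !inE.
  have cA' : [&& c != a, c \in Jf y1 & c \in Jf y2].
    by have := set22 b c; rewrite -AE !inE.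
  have xA : (x \notin Jf y2) && (x \in Jf y1) by have := set11 x; rewrite -xE !inE.
  have x'A : (x' \notin Jf y1) && (x' \in Jf y2) by have := set11 x'; rewrite -x'E !inE.
  case/and3P: bA => ba b1 b2; case/and3P: cA' => ca c1' c2'.
  case/andP: xA => x2 x1; case/andP: x'A => x'1 x'2.
  have ne i j (S : {set I}) : i \in S -> j \notin S -> (i != j) && (j != i).
    by move=> iS jS; rewrite [j == i]eq_sym andbb; apply: contraNneq jS => <-.
  have [/andP[bx _] /andP[cx _] /andP[ax _]] := And3 (ne _ _ _ b2 x2) (ne _ _ _ c2' x2) (ne _ _ _ a2 x2).
  have [/andP[bx' _] /andP[cx' _] /andP[ax' _]] :=
    And3 (ne _ _ _ b1 x'1) (ne _ _ _ c1' x'1) (ne _ _ _ a1 x'1).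
  have /andP[xx' _] := ne _ _ _ x1 x'1.
  have us : uniq [:: b; c; a; x; x'].
    by rewrite /= !inE !negb_or bc ba ca bx cx ax bx' cx' ax' xx'.
  have sum4 (J : {set I}) i j k l : uniq [:: i; j; k; l] -> {subset [:: i; j; k; l] <= J} ->
      #|J| = 4%N -> \sum_(i in J) q i = q i + q j + q k + q l.
    move=> u sJ J4; have JE : J = [set e in [:: i; j; k; l]].
      apply/eqP; rewrite eq_sym eqEcard J4; apply/andP; split.
        by apply/subsetP=> e; rewrite in_set; exact: sJ.
      by rewrite cardsE (card_uniqP u).
    rewrite JE (eq_bigl (fun e => e \in [:: i; j; k; l])); last by move=> e; rewrite in_set.
    by rewrite -big_uniq // !big_cons big_nil /= addr0 !addrA.
  have u1 : uniq [:: b; c; a; x] by rewrite /= !inE !negb_or bc ba ca bx cx ax.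
  have u2 : uniq [:: b; c; a; x'] by rewrite /= !inE !negb_or bc ba ca bx' cx' ax'.
  have u3 : uniq [:: b; c; x; x'] by rewrite /= !inE !negb_or bc bx cx bx' cx' xx'.
  have t1 : t y1 = q b + q c + q a + q x.
    rewrite (JfP y1).2; apply: sum4 => // e; rewrite !inE.
    by case/or4P=> /eqP->.
  have t2 : t y2 = q b + q c + q a + q x'.
    rewrite (JfP y2).2; apply: sum4 => // e; rewrite !inE.
    by case/or4P=> /eqP->.
  have t3 : t y3 = q b + q c + q x + q x'.
    rewrite (JfP y3).2; apply: sum4 => // e; rewrite !inE.
    case/or4P=> /eqP->; last by apply: (subsetP s23); rewrite !inE eq_sym ax'.
    - by apply: (subsetP s13); rewrite !inE ba.
    - by apply: (subsetP s13); rewrite !inE ca.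
    - by apply: (subsetP s13); rewrite !inE eq_sym ax.
  have [J sJ|phi _ phiE] := ext_seq [:: weight7 0; weight7 1; weight7 2; weight7 3; weight7 4]
      b us (U := sp t set0).
    move=> /sp0; apply: ind; apply/subsetP=> i /sJ; rewrite !in_cons in_nil orbF.
    case/or4P=> [/eqP->|/eqP->|/eqP->|/orP[/eqP->|/eqP->]].
    - exact: (subsetP J1I).
    - exact: (subsetP J1I).
    - exact: (subsetP J1I).
    - exact: (subsetP J1I).
    - exact: (subsetP J2I).
  exfalso; exact: (three_quads (phiE 0%N isT) (phiE 1%N isT) (phiE 2%N isT) (phiE 3%N isT)
    (phiE 4%N isT) t1 t2 t3).
(* [None] is the new vertex. With the triple [A] it forms the 4-set of sum 0, and each exceptional
   vector becomes the difference between it and the fourth point. *)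
pose p o := if o is Some i then q i else \sum_(i in A) q i.
pose D := [set o : option I | if o is Some i then i \in I0 else true].
pose T : {set option I} := None |: Some @: A.
have NSome (J : {set I}) : None \notin Some @: J by apply/imsetP=> -[].
have SomeJ (J : {set I}) i : (Some i \in Some @: J) = (i \in J) by rewrite mem_imset //; exact: Some_inj.
have sumSome (J : {set I}) : \sum_(o in Some @: J) p o = \sum_(i in J) q i.
  by rewrite big_imset // => i j _ _; exact: Some_inj.
have [a aA] : exists a, a \in A by apply/set0Pn; rewrite -card_gt0 A3.
have DN : None \in D by rewrite in_set.
have DS i : (Some i \in D) = (i \in I0) by rewrite in_set.
apply: (@good_sub (option I) D p T).
- rewrite subUset sub1set inE; apply/subsetP=> _ /imsetP[i iA ->].
  by rewrite inE (subsetP sA).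
- by rewrite cardsU1 NSome card_imset ?A3 //; exact: Some_inj.
- move=> J sJ; pose J' := [set i | Some i \in J].
  have sJ' : J' \subset I0.
    by apply/subsetP=> i; rewrite inE => /(subsetP sJ); rewrite inE.
  have JE : J :\ None = Some @: J'.
    by apply/setP=> -[i|]; rewrite !inE ?SomeJ ?inE ?(negPf (NSome _)).
  have [NJ|NJ] := boolP (None \in J).
    have JE' : J = None |: Some @: J' by rewrite -JE setD1K.
    rewrite JE' big_setU1 ?NSome //= sumSome -sum_symdiff -/(symdiff _ _).
    have sD : symdiff A J' \subset I0 by rewrite subUset !(subset_trans (subsetDl _ _)).
    split=> [/(ind _ sD)/symdiff_eq0 <-|]; first by right.
    case=> [/setP/(_ None)|e]; first by rewrite !inE.
    suff -> : A = J' by rewrite sum_symdiff addF2.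
    apply/setP=> i; have /setP/(_ (Some i)) := e.
    by rewrite !in_setU1 !SomeJ /= => ->.
  have JE' : J = Some @: J'.
    by rewrite -JE; apply/setP=> o; rewrite !inE; case: eqP => [->|//]; rewrite (negPf NJ).
  rewrite JE' sumSome; split=> [/(ind _ sJ') ->|]; first by left; rewrite imset0.
  case=> [/eqP|/setP/(_ None)]; last by rewrite !inE (negPf (NSome _)).
  by rewrite imset_eq0 => /eqP->; rewrite big_set0.
- move=> i; exists (Some (can i)); first by rewrite /D in_set canI0.
  by rewrite /= canE.
move=> y; have [[t0|[i [j [iI jI e]]]]|ny] := niceP y.
- by exists None, None; split; rewrite ?addF2.
- by exists (Some i), (Some j); split; rewrite ?DS.
have sAJ := Acore y ny; have /cards1P[x xE] : #|Jf y :\: A| == 1%N.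
  by rewrite cardsD (setIidPr sAJ) card4 // A3.
have xJ : x \in Jf y by have := set11 x; rewrite -xE inE => /andP[].
exists None, (Some x); split; rewrite ?DS ?(subsetP (JfP y).1) //.
by rewrite (JfP y).2 (big_setID A) (setIidPr sAJ) /= xE big_set1.
Qed.

End Combinatorics.

(** * Cliques and simplification *)

Lemma eq_rep (M : matroid) (V : vectType 'F_2) (f g : M -> V) K :
  f =1 g -> rep f K -> rep g K.
Proof. by move=> fg r S; rewrite r (eq_sp S fg). Qed.

Lemma rep_rk_le (M N : matroid) (V : vectType 'F_2) (f : M -> V) :
  rep f 0 -> has_minor M N -> (rk N setT <= rk M setT)%N.
Proof.
move=> r /(has_minor_rep r)[C [h [_ _ rN]]]; have := rN setT; rewrite add0v (rep_rk _ r).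
suff /dimvS : (sp (f \o h) setT + sp f C <= sp f setT)%VS by lia.
rewrite subv_add spS ?subsetT // andbT; apply/sp_subP => x _ /=.
by rewrite mem_sp ?inE.
Qed.

Lemma binary_minor (M N : matroid) : binary M -> has_minor M N -> binary N.
Proof.
move=> /binary_rep[B [f r]] /(has_minor_rep r)[C [h [_ _ rN]]].
apply/binary_rep; exists B; have [chi chiU _] := hom_lker (0 + sp f C).
exists (chi \o (f \o h)); apply/(rep_quot (K := 0 + sp f C)) => //.
  by rewrite chiU.
by move=> v _ v0; rewrite -chiU memv_ker v0.
Qed.

Lemma rep_simple (M : matroid) (V : vectType 'F_2) (f : M -> V) : rep f 0 ->
  simple M <-> injective f /\ forall e, f e != 0.
Proof.
move=> r; split=> [sM|[fi f0] S S2].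
  split=> [x y fxy|e]; last by rewrite (rep_loop r) sM ?cards1.
  apply/eqP; apply: contraT => xy.
  have : (rk M [set x; y] < #|[set x; y]|)%N.
    apply/(rep_dep r); exists [set x; y]; split=> //.
      by apply/set0Pn; exists x; rewrite !inE eqxx.
    by rewrite big_setU1 ?inE //= big_set1 fxy addF2.
  by rewrite sM ?ltnn // cards2 xy.
apply/eqP; rewrite eqn_leq rk_card leqNgt; apply/negP=> /(rep_dep r)[J [sJ J0 Jf]].
have : (#|J| <= 2)%N := leq_trans (subset_leq_card sJ) S2.
move: J0; rewrite -card_gt0; case E : #|J| => [|[|[|]]] // _ _.
  have /cards1P[x xE] : #|J| == 1%N by rewrite E.
  by move: Jf; rewrite xE big_set1 => /eqP; rewrite (negPf (f0 x)).
have /cards2P[x [y [xy JE]]] : #|J| == 2%N by rewrite E.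
move: Jf; rewrite JE big_setU1 ?inE //= big_set1 => /eqF2 /fi e.
by rewrite e eqxx in xy.
Qed.

Section Complete.

Definition MK_vec (n : nat) (e : MK n) : {ffun 'I_n -> F2} := mcol (@incidence (Kgraph n)) e.

Lemma rep_MK n : rep (@MK_vec n) 0.
Proof. by apply/rep0E => S; exact: (@graph_rkE (Kgraph n) S). Qed.

Lemma MK_vecE n (e : MK n) i :
  MK_vec e i = (i == (val e).1)%:R + (i == (val e).2)%:R.
Proof. by rewrite !ffunE. Qed.

Lemma MK_simple n : simple (MK n).
Proof.
apply/(rep_simple (@rep_MK n)); split=> [x y exy|e]; last first.
  apply/eqP=> /ffunP/(_ (val e).1); rewrite MK_vecE eqxx ffunE.
  have := valP e; case: eqP => [->|_]; first by rewrite ltnn.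
  by [].
apply: val_inj; case: x exy => -[i j] /= ij; case: y => -[i' j'] /= ij' exy.
move/ffunP: exy => exy; move: (exy i) (exy j) => {exy}.
rewrite !MK_vecE /= !eqxx !F2_addb -!val_eqE /=; move: ij ij' => /= ij ij'.
rewrite (ltn_eqF ij) (gtn_eqF ij) /=.
have [ii'|ii'] := eqVneq (val i) i'; have [jj'|jj'] := eqVneq (val j) j'.
- by move=> _ _; congr pair; apply/val_inj.
- case: (eqVneq (val j) i') => [e _ _|_ _ /eqP //]; move: ij ii' e => /=; lia.
- case: (eqVneq (val i) j') => [e _ _|_ /eqP //]; move: ij jj' e => /=; lia.
- case: (eqVneq (val i) j') => [e|_ /eqP //]; case: (eqVneq (val j) i') => [e'|_ _ /eqP //].
  move: ij ij' e e' => /=; lia.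
Qed.

Lemma MK_rank n : (0 < n)%N -> rk (MK n) setT = n.-1.
Proof.
case: n => // n _; rewrite /= /graph_rk card_ord.
set A := adj _; have symA : connect_sym A := adj_sym _.
have -> : n_comp A predT = 1%N.
  rewrite -(n_comp_connect symA ord0); apply: eq_n_comp_r => i; rewrite inE.
  have [<-|i0] := eqVneq ord0 i; first by rewrite [RHS]connect0.
  apply/esym; rewrite [LHS](_ : _ = true) //; apply: connect1; apply/exists_inP.
  have lt0 : ((@ord0 n : nat) < (i : 'I_n.+1))%N.
    by rewrite lt0n; apply: contraNneq i0 => e; apply/eqP/val_inj.
  exists (exist (fun p : 'I_n.+1 * 'I_n.+1 => (p.1 < p.2)%N) (ord0, i) lt0); rewrite ?inE ?eqxx //=.
by rewrite subn1.
Qed.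

Lemma MK_widen (n n0 : nat) : (n0 <= n)%N -> exists2 h : MK n0 -> MK n,
  injective h & forall S : {set MK n0}, rk (MK n) (h @: S) = rk (MK n0) S.
Proof.
move=> le; pose h (e : MK n0) : MK n :=
  exist (fun p : 'I_n * 'I_n => (p.1 < p.2)%N)
    (widen_ord le (val e).1, widen_ord le (val e).2) (valP e).
have hi : injective h.
  move=> [[i j] ij] [[i' j'] ij'] /(congr1 val)[e1 e2].
  by apply/val_inj => /=; congr pair; apply/val_inj.
exists h => // S.
have hE e i : MK_vec (h e) (widen_ord le i) = MK_vec e i.
  by rewrite !MK_vecE.
have r : rep (fun e => MK_vec (h e)) 0.
  apply: (rep_rel (@rep_MK n0)) => J; split=> J0.
    apply/ffunP=> i; rewrite sum_ffunE ffunE; have [i0|i0] := ltnP i n0.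
      have -> : i = widen_ord le (Ordinal i0) by apply/val_inj.
      move/ffunP/(_ (Ordinal i0)): J0; rewrite sum_ffunE ffunE => J0.
      by rewrite -[RHS]J0; apply: eq_bigr => e _; rewrite hE.
    rewrite big1 // => e _; rewrite MK_vecE -!val_eqE /=.
    by rewrite !(gtn_eqF (leq_trans (ltn_ord _) i0)) addr0.
  apply/ffunP=> i; move/ffunP/(_ (widen_ord le i)): J0; rewrite !sum_ffunE !ffunE => J0.
  by rewrite -[RHS]J0; apply: eq_bigr => e _; rewrite hE.
by rewrite (rep_rk _ r) (rep_rk _ (@rep_MK n)) sp_imset.
Qed.

Lemma has_minor_MK_le (M : matroid) (n n0 : nat) : binary M -> (n0 <= n)%N ->
  has_minor M (MK n) -> has_minor M (MK n0).
Proof.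
move=> /binary_rep[B [f r]] le /(has_minor_rep r)[C [h [hi hC rN]]].
have [g gi gr] := MK_widen le.
apply: (rep_sub (h := h \o g) (C := C) r); first exact: inj_comp.
  by move=> x; exact: hC.
exact: (rep_iso gr rN).
Qed.

End Complete.

Section Simplification.
Variables (M : matroid) (V : vectType 'F_2) (f : M -> V).
Hypothesis r : rep f 0.

(** [pick] depends only on the vector [f e], so parallel elements have the same representative.
    Loops are removed separately. *)
Definition si_rep (e : M) : M := odflt e [pick x | f x == f e].
Definition si_set : {set M} := [set e | (f e != 0) && (si_rep e == e)].
Definition si : matroid := delete (~: si_set).
Definition si_val (x : si) : M := minor_val x.

Lemma rep_si : rep (f \o si_val) 0.
Proof. by have := @rep_minor _ _ set0 (~: si_set) _ _ r; rewrite sp_set0 addv0. Qed.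

Lemma si_has_minor : has_minor M si.
Proof.
exists set0, (~: si_set); split; first by rewrite disjoint_sym disjoints_subset setC0 subsetT.
by exists id => [|S]; [exists id|rewrite imset_id].
Qed.

Lemma si_neq0 x : f (si_val x) != 0.
Proof.
have : si_val x \notin set0 :|: ~: si_set := valP x.
by rewrite !inE negbK => /andP[].
Qed.

Lemma si_repE e : f (si_rep e) = f e.
Proof. by rewrite /si_rep; case: pickP => [x /eqP|]. Qed.

Lemma si_rep_eq e e' : f e = f e' -> si_rep e = si_rep e'.
Proof.
move=> h; rewrite /si_rep (eq_pick (Q := fun x => f x == f e')); last by move=> x /=; rewrite h.
by case: pickP => // /(_ e'); rewrite eqxx.
Qed.

Lemma si_inj : injective (f \o si_val).
Proof.
move=> x y /= h; apply: minor_val_inj.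
have : si_val x \notin set0 :|: ~: si_set := valP x.
have : si_val y \notin set0 :|: ~: si_set := valP y; rewrite !inE !negbK.
by case/andP=> _ /eqP ey /andP[_ /eqP ex]; rewrite -[LHS]ex -[RHS]ey; apply: si_rep_eq.
Qed.

Lemma si_lift e : f e != 0 -> exists x, f (si_val x) = f e.
Proof.
move=> e0; have mem : si_rep e \notin set0 :|: ~: si_set.
  rewrite !inE negbK si_repE e0 /=; apply/eqP/si_rep_eq; exact: si_repE.
by exists (exist (fun x => x \notin set0 :|: ~: si_set) _ mem); rewrite -[RHS]si_repE.
Qed.

Lemma si_simple : simple si.
Proof. by apply/(rep_simple rep_si); split; [exact: si_inj|exact: si_neq0]. Qed.

(** A set of representatives, extended by the loops and by everything parallel to it, keeps its
    rank, and so does its complement. *)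
Lemma si_connected k : vertically_connected k M -> vertically_connected k si.
Proof.
move=> vc P; pose Q : {set M} := [set e | (f e == 0) || [exists x in P, f (si_val x) == f e]].
have eqsp (X : {set M}) (X' : {set si}) :
    (forall e, e \in X -> f e != 0 -> exists2 x, x \in X' & f (si_val x) = f e) ->
    (forall x, x \in X' -> exists2 e, e \in X & f e = f (si_val x)) ->
    rk M X = rk si X'.
  move=> h1 h2; rewrite (rep_rk _ r) (rep_rk _ rep_si); congr (\dim _).
  apply/eqP; rewrite eqEsubv; apply/andP; split; apply/sp_subP => e eX.
    have [->|/(h1 e eX)[x xX' <-]] := eqVneq (f e) 0; first exact: mem0v.
    exact: (mem_sp (f \o si_val)).
  by have [e' e'X /= <-] := h2 e eX; exact: mem_sp.
have eQ : rk M Q = rk si P.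
  apply: eqsp => [e|x xP].
    by rewrite inE => /orP[/eqP->|/exists_inP[x xP /eqP e1]]; [rewrite eqxx|exists x].
  by exists (si_val x) => //; rewrite inE; apply/orP; right; apply/exists_inP; exists x.
have eCQ : rk M (~: Q) = rk si (~: P).
  apply: eqsp => [e|x].
    rewrite !inE negb_or => /andP[e0 /exists_inPn h] _; have [x xe] := si_lift e0.
    by exists x => //; rewrite inE; apply/negP=> /h; rewrite xe eqxx.
  rewrite inE => xP; exists (si_val x) => //; rewrite !inE negb_or si_neq0 /=.
  by apply/exists_inPn=> y yP; apply: contraNneq xP => /si_inj <-.
have eT : rk M setT = rk si setT.
  apply: eqsp => [e _ /si_lift[x xe]|x _]; first by exists x.
  by exists (si_val x).
by rewrite -eQ -eCQ -eT => /vc; rewrite /spanning -eQ -eCQ -eT.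
Qed.

(** No element of a simple minor is a loop of [M], so it can be replaced by its representative.
    Contracting all representatives killed by [chi] gives the same contracted space as [C]. *)
Lemma si_minor (L : matroid) : simple L -> has_minor M L -> has_minor si L.
Proof.
move=> sL /(has_minor_rep r)[C [h [hi hC rL]]].
have [chi chiU _] := hom_lker (0 + sp f C).
have rL' : rep (chi \o (f \o h)) 0.
  apply/(rep_quot (K := 0 + sp f C)) => //; first by rewrite chiU.
  by move=> v _ v0; rewrite -chiU memv_ker v0.
have [gi g0] := proj1 (rep_simple rL') sL.
have killE : killed (f \o si_val) 0 chi = (0 + sp f C)%VS.
  apply/eqP; rewrite eqEsubv; apply/andP; split.
    rewrite subv_add sub0v; apply/sp_subP => x; rewrite inE => /eqP h0.
    by rewrite -chiU memv_ker h0.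
  rewrite subv_add sub0v; apply/sp_subP => c cC.
  have [->|/si_lift[x xc]] := eqVneq (f c) 0; first exact: mem0v.
  rewrite -xc; apply: (@mem_killed _ _ _ (f \o si_val) 0 chi x).
  apply/eqP; rewrite /= xc -memv_ker chiU add0v; exact: mem_sp.
have [phi _ phiE] : exists2 sigma : 'End(V), True & forall v, v - sigma (chi v) \in lker chi.
  have [sig0 sigE] : exists sig : 'End(V), sig = (chi^-1)%VF by exists (chi^-1)%VF.
  exists sig0 => // v; rewrite memv_ker linearB sigE /= limg_lfunVK ?subrr //.
  exact: memv_img (memvf v).
apply: (@minor_criterion si L V V (f \o si_val) 0 (chi \o (f \o h)) chi phi rep_si rL' gi g0).
  exact: sub0v.
move=> x; have fx0 : f (h x) != 0.
  by apply: contraNneq (g0 x) => /= ->; rewrite linear0.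
have [y ye] := si_lift fx0; exists y; first by rewrite /= ye.
by rewrite killE -chiU /= -ye; apply: phiE.
Qed.

End Simplification.

(** * Graphic matroids with four vertices summing to zero *)

(* M is M(G)/T, where the element contracted is the sum of the four vertices T
   of the graph G with vertex set B and ends a, b. *)
Definition quad_graphic (M : matroid) : Prop :=
  exists (B : finType) (V : vectType 'F_2) (p : B -> V) (T : {set B}) (a b : M -> B),
  [/\ #|T| = 4%N, forall J : {set B}, \sum_(i in J) p i = 0 <-> J = set0 \/ J = T
    & rep (fun e => p (a e) + p (b e)) 0].

Lemma quad_graphic_rel (M : matroid) (B : finType) (V W : vectType 'F_2)
  (p : B -> V) (p' : B -> W) (a b : M -> B) :
  (forall J : {set B}, \sum_(i in J) p i = 0 <-> \sum_(i in J) p' i = 0) ->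
  rep (fun e => p (a e) + p (b e)) 0 -> rep (fun e => p' (a e) + p' (b e)) 0.
Proof.
move=> h r; have [phi phiE] := ext_hom (fun J => proj1 (h J)).
have [psi psiE] := ext_hom (fun J => proj2 (h J)).
apply: (rep_rel r) => J; split=> J0.
  by rewrite -[RHS](linear0 phi) -J0 linear_sum; apply: eq_bigr => e _;
    rewrite linearD /= !phiE.
by rewrite -[RHS](linear0 psi) -J0 linear_sum; apply: eq_bigr => e _;
  rewrite linearD /= !psiE.
Qed.

Section Even_cycle.
Variables (B : finType) (t1 t2 t3 t4 : B).
Hypothesis ut : uniq [:: t1; t2; t3; t4].

(** Merging [t3] into [t1] and [t4] into [t2], with the coordinate [None] recording whether this
    happened, makes the two ends of an edge add up to its column in the even-cycle matrix. *)
Definition fold_vertex (i : B) : B := if i == t3 then t1 else if i == t4 then t2 else i.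
Definition fold_odd (i : B) : bool := (i == t3) || (i == t4).
Definition fold_vec (i : B) : {ffun option B -> F2} :=
  [ffun o => if o is Some j then (j == fold_vertex i)%:R else (fold_odd i)%:R].

(** Row [None] puts both or none of [t3], [t4] in [J]; the rows of [t1] and [t2] tie these to [t3]
    and [t4]; the other rows exclude all other vertices. *)
Lemma fold_vec_ker (J : {set B}) :
  \sum_(i in J) fold_vec i = 0 <-> J = set0 \/ J = [set t1; t2; t3; t4].
Proof.
have [t12 t13 t14 [t23 t24 t34]] : [/\ t1 != t2, t1 != t3, t1 != t4 &
    [/\ t2 != t3, t2 != t4 & t3 != t4]].
  move: ut; rewrite /= !inE !negb_or andbT.
  by case/and3P=> /and3P[-> -> ->] /andP[-> ->] ->.
have S1 j (k : bool) : \sum_(i in J) ((i == j) && k)%:R = ((j \in J) && k)%:R :> 'F_2.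
  case: k; last by rewrite andbF big1 // => i _; rewrite andbF.
  rewrite andbT; under eq_bigr => i _ do rewrite andbT.
  have [jJ|jJ] := boolP (j \in J).
    by rewrite (bigD1 j) //= eqxx big1 ?addr0 // => i /andP[_ /negPf ->].
  by rewrite big1 // => i iJ; case: eqP => // e; rewrite -e iJ in jJ.
have E j : (\sum_(i in J) fold_vec i) (Some j) = ((j \in J) && ~~ fold_odd j)%:R +
    ((t3 \in J) && (j == t1))%:R + ((t4 \in J) && (j == t2))%:R.
  rewrite sum_ffunE -!S1 -!big_split; apply: eq_bigr => i _ /=.
  rewrite ffunE /fold_vertex /fold_odd.
  have [->|i3] := eqVneq i t3.
    have -> : (t3 == j) && ~~ ((j == t3) || (j == t4)) = false.
      by case: (eqVneq t3 j).
    by rewrite (negPf t34) /= add0r addr0.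
  have [->|i4] := eqVneq i t4.
    have -> : (t4 == j) && ~~ ((j == t3) || (j == t4)) = false.
      by case: (eqVneq t4 j) => //=; rewrite orbT.
    by rewrite /= !add0r.
  rewrite /= !addr0 eq_sym; case: (eqVneq i j) => [<-|//].
  by rewrite (negPf i3) (negPf i4).
have E0 : (\sum_(i in J) fold_vec i) None = (t3 \in J)%:R + (t4 \in J)%:R.
  rewrite sum_ffunE -[(t3 \in J)]andbT -[(t4 \in J)]andbT -!S1 -big_split.
  apply: eq_bigr => i _ /=; rewrite ffunE /fold_odd !andbT.
  by case: (eqVneq i t3) => [->|_] /=; rewrite ?add0r // (negPf t34) addr0.
have b0 (x : bool) : x%:R = 0 :> 'F_2 -> x = false by case: x => // /eqP.
split=> [J0|].
  have {}E j : ((j \in J) && ~~ fold_odd j) (+) ((t3 \in J) && (j == t1)) (+)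
      ((t4 \in J) && (j == t2)) = false.
    by apply: b0; rewrite -!F2_addb -E J0 ffunE.
  have {}E0 : (t3 \in J) (+) (t4 \in J) = false.
    by apply: b0; rewrite -F2_addb -E0 J0 ffunE.
  have := E t1; have := E t2; rewrite /fold_odd !eqxx !(eq_sym t2 t1) (negPf t12).
  rewrite (negPf t13) (negPf t14) (negPf t23) (negPf t24) /= !andbT !andbF !addbF => e2 e1.
  have other j : j \notin [:: t1; t2; t3; t4] -> (j \in J) = false.
    rewrite !inE !negb_or => /and4P[/negPf j1 /negPf j2 /negPf j3 /negPf j4].
    by have := E j; rewrite /fold_odd j1 j2 j3 j4 /= !andbF andbT !addbF.
  have [J3|J3] := boolP (t3 \in J); [right|left]; apply/setP=> j; rewrite !inE.
    move: E0 e1 e2; rewrite J3; case J4 : (t4 \in J); case J1 : (t1 \in J);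
      case J2 : (t2 \in J) => // _ _ _.
    have [/or4P[] /eqP->|jT] := boolP [|| j == t1, j == t2, j == t3 | j == t4].
    - by rewrite J1 eqxx.
    - by rewrite J2 eqxx ?orbT.
    - by rewrite J3 eqxx ?orbT.
    - by rewrite J4 eqxx ?orbT.
    have := other j; rewrite !inE => ->; last by move: jT; rewrite !negb_or.
    by move: jT; rewrite !negb_or => /and4P[/negPf -> /negPf -> /negPf -> /negPf ->].
  move: E0 e1 e2; rewrite (negPf J3); case J4 : (t4 \in J); case J1 : (t1 \in J);
    case J2 : (t2 \in J) => // _ _ _.
  have [/or4P[] /eqP->|jT] := boolP [|| j == t1, j == t2, j == t3 | j == t4];
    rewrite ?J1 ?J2 ?J4 ?(negPf J3) //.
  by apply: other; rewrite !inE.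
case=> [->|JE]; first by rewrite big_set0.
apply/ffunP=> -[j|]; rewrite ?E ?E0 ffunE JE !inE ?eqxx ?orbT ?F2_addb //.
rewrite /fold_odd /=.
case: (eqVneq j t1) => [->|j1]; first by rewrite (negPf t12) (negPf t13) (negPf t14).
case: (eqVneq j t2) => [->|j2]; first by rewrite (negPf t23) (negPf t24).
by case: (eqVneq j t3); case: (eqVneq j t4).
Qed.

End Even_cycle.

(** An odd edge has exactly one end in {[t3], [t4]}, so after merging it is incident with [t1] or
    [t2]: this is a blocking pair without any resigning. *)
Lemma quad_graphic_even_cycle (M : matroid) : quad_graphic M -> even_cycle_with_blocking_pair M.
Proof.
case=> B [V [p [T [a [b [T4 ker r]]]]]].
have [s [us sz sT _]] := enum_seq T.
move: us sz sT; rewrite T4; case: s => [|t1 [|t2 [|t3 [|t4 [|]]]]] // us _ sT.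
have TE : T = [set t1; t2; t3; t4] by apply/setP=> i; rewrite sT !inE !orbA.
pose ev e := (fold_vertex t1 t2 t3 t4 (a e), fold_vertex t1 t2 t3 t4 (b e)).
pose G := Graph ev.
pose W : {set edge G} := [set e | fold_odd t3 t4 (a e) (+) fold_odd t3 t4 (b e)].
exists G, W; split; last first.
  exists t1, t2; split.
    by move: us; rewrite /= !inE !negb_or => /andP[/andP[->]].
  exists [::] => e /=; rewrite inE /incident /= /fold_vertex /fold_odd.
  by case: (eqVneq (a e) t3); case: (eqVneq (a e) t4); case: (eqVneq (b e) t3);
    case: (eqVneq (b e) t4); rewrite ?eqxx ?orbT.
have r' : rep (fun e => fold_vec t1 t2 t3 t4 (a e) + fold_vec t1 t2 t3 t4 (b e)) 0.
  by apply: (quad_graphic_rel _ r) => J; rewrite ker TE fold_vec_ker.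
exists id; first by exists id.
move=> S; rewrite imset_id (rep_rk _ r') (rep_rk _ (@rep_vec _ _ (even_cycle_matrix W))).
congr (\dim _); apply: eq_sp => e; apply/ffunP=> -[v|]; rewrite !ffunE //=.
by rewrite inE F2_addb.
Qed.

Lemma quad_graphic_si (M : matroid) (V : vectType 'F_2) (f : M -> V) :
  rep f 0 -> quad_graphic (si f) -> quad_graphic M.
Proof.
move=> r [B [W [p [T [a [b [T4 ker rs]]]]]]].
have /card_gt0P[t0 _] : (0 < #|T|)%N by rewrite T4.
have [phi phiE] := rep_hom (rep_si r) rs.
have [psi psiE] := rep_hom rs (rep_si r).
have /fin_all_exists[a' /fin_all_exists[b' ab]] :
    forall e, exists x y, p x + p y = phi (f e).
  move=> e; have [->|/si_lift[z ze]] := eqVneq (f e) 0.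
    by exists t0, t0; rewrite addF2 linear0.
  by exists (a z), (b z); rewrite -ze -phiE.
exists B, W, p, T, a', b'; split=> //.
apply: (rep_rel r) => J; under [X in _ <-> X = 0]eq_bigr => e _ do rewrite ab.
rewrite -linear_sum; split=> [->|h]; first by rewrite linear0.
rewrite -[RHS](linear0 psi) -h !linear_sum; apply: eq_bigr => e _ /=.
have [->|/si_lift[z ze]] := eqVneq (f e) 0; first by rewrite !linear0.
by rewrite -ze (phiE z) psiE.
Qed.

(** * From a template to a graph with one 4-set of sum zero *)

Section Template.
Variable Phi : frame_template.
Hypothesis noPG : forall M, conforms Phi M -> ~ has_PG32_delete_line_minor M.

Local Notation VX := {ffun tX Phi -> F2}.
Local Notation VH := (F2 * VX * {ffun 'I_3 -> F2})%type.

Lemma template_good (chi : 'End(VX)) :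
  lker chi = sp (fun c => @core_x Phi (inr c)) setT ->
  (forall v, v - chi v \in lker chi) ->
  (forall y, Tpt chi y \in sp (qpt chi) setT) ->
  good_config (qpt chi) (Tpt chi).
Proof.
move=> chi_ker chi_id tq.
have [|eta etaE] := @hom_of_linear VH F2 (fun v => v.1.1); first by [].
have zeta_lin (k : 'I_3) : exists z : 'Hom(VH, F2), forall v, z v = v.2 k.
  by apply: hom_of_linear => c u v; rewrite !ffunE.
have /fin_all_exists[zeta zetaE] := zeta_lin.
apply: (@config_good VH _ _ _ _ (template_config noPG chi_ker chi_id) eta (fun k => inr k) zeta).
- by move=> [[j|]|k]; rewrite etaE.
- by move=> y; rewrite etaE.
- by move=> k k' [].
- move=> k [[j|]|k']; rewrite zetaE /= ?ffunE //.
- by move=> k y; rewrite zetaE ffunE.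
- exact: tq.
Qed.

(** The rank of [Ys] is less than [k - 1], so [Ys] or its complement spans, and the rank of [M]
    excludes the former. Hence the vectors from [Y_0] are spanned by the other elements, and
    therefore by the points, as [config_good] demands. *)
Lemma template_quad_graphic (M : matroid) (k : nat) : conforms Phi M ->
  vertically_connected k M -> (#|tY0 Phi| + 1 < k)%N -> (#|tY0 Phi| < rk M setT)%N ->
  quad_graphic M.
Proof.
move=> cM vc kY rY.
have [chi chi_ker chi_id'] := hom_lker (sp (fun c => @core_x Phi (inr c)) setT).
have chi_id v : v - chi v \in lker chi by rewrite chi_ker.
have [R [f [Ys [r Ys_card Ys_t t_Ys nYs]]]] := conforming_form noPG chi_ker cM.
have rYs : (rk M Ys <= #|tY0 Phi|)%N := leq_trans (rk_card Ys) Ys_card.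
have spanC : rk M (~: Ys) = rk M setT.
  have [|sP|//] := vc Ys; first by have := rk_mono (subsetT (~: Ys)); lia.
  by move: sP; rewrite /spanning; lia.
have spC : sp f (~: Ys) = sp f setT.
  apply/eqP; rewrite eqEdim spS ?subsetT //=.
  by rewrite -(rep_rk _ r) -(rep_rk _ r) spanC.
(* [G] forgets the rows in [R]: graph edges go to 0 and the elements with a [Y_1] part go to
   differences of points. *)
have [|G GE] := @hom_of_linear (VX * {ffun R -> F2})%type VH (fun v => (0, v.1, 0)).
  by move=> c u v; congr (_, _, _); rewrite /= scaler0 addr0.
have tq y : Tpt chi y \in sp (qpt chi) setT.
  have [e eY fe] := t_Ys y; have : f e \in sp f (~: Ys) by rewrite spC mem_sp ?inE.
  have -> : Tpt chi y = G (f e) by rewrite GE fe.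
  case/spP=> J sJ ->; rewrite linear_sum; apply: memv_suml => e' e'J /=.
  have : e' \notin Ys by have := subsetP sJ e' e'J; rewrite inE.
  case/nYs=> [[o1 [o2 ->]]|[j [r0 ->]]]; first by rewrite GE; exact: mem0v.
  have -> : G (spt chi j, delta (Some r0)) = qpt chi (inl (Some j)) + qpt chi (inl None).
    rewrite GE; congr (_, _, _); rewrite /= ?addr0 //.
    by rewrite F2_addrr.
  by apply: memvD; apply: mem_sp; rewrite inE.
have [B [p [T [T4 ker qp tp]]]] := template_good chi_ker chi_id tq.
have [b0 b0E] := qp (inl None).
pose VR := {ffun R -> F2}.
pose p' (i : B + R) : VH * VR := match i with inl b => (p b, 0) | inr r => (0, delta (Some r)) end.
(* A unit vector alone is an edge to the vertex 0; the multiple of [qpt chi (inl None)] makes this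
   second end explicit. As the [R] part is kept, [emb] is injective and changes no relation. *)
have [|emb embE] := @hom_of_linear (VX * VR)%type (VH * VR)%type
    (fun v => ((0, v.1, 0) + (\sum_r v.2 r : 'F_2) *: qpt chi (inl None), v.2)).
  move=> c u v; congr pair; rewrite /= scalerDr addrACA scalerA -scalerDl; congr (_ + _ *: _).
    by congr (_, _, _); rewrite /= scaler0 addr0.
  by rewrite mulr_sumr -big_split; apply: eq_bigr => i _; rewrite !ffunE.
have emb0 v : emb v = 0 -> v = 0.
  rewrite embE; case: v => x v [/= h1 h2 h3 h4]; move: h2; rewrite h4.
  rewrite big1 => [|i _]; last by rewrite ffunE.
  by rewrite scale0r addr0 => ->.
have r' : rep (emb \o f) 0.
  apply/(@rep_quot _ _ _ emb f 0) => //; first exact: sub0v.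
  by move=> v _ /emb0 ->; exact: mem0v.
have sumd (r0 : R) : \sum_r (delta (Some r0) r : 'F_2) = 1.
  rewrite (bigD1 r0) //= ffunE eqxx big1 ?addr0 // => i ir0.
  by rewrite ffunE (inj_eq Some_inj) eq_sym (negPf ir0).
have ends e : exists i j, p' i + p' j = emb (f e).
  have deltaE (o : option R) : exists i, p' i + p' (inl b0) = emb (0, delta o).
    case: o => [r0|]; [exists (inr r0)|exists (inl b0)]; rewrite embE /= -?b0E.
      congr pair; last by rewrite addr0.
      by rewrite (_ : (0, 0, 0) = 0) // !add0r sumd scale1r.
    have -> : delta (None : option R) = 0 by apply/ffunP=> i; rewrite !ffunE.
    by rewrite addF2 big1 ?scale0r ?addr0 // => i _; rewrite ffunE.
  have [eY|/nYs[[o1 [o2 ->]]|[j [r0 ->]]]] := boolP (e \in Ys).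
  - have [y ->] := Ys_t e eY; have [b [b' tE]] := tp y; exists (inl b), (inl b').
    rewrite embE /=; congr pair; last by rewrite addr0.
    by rewrite big1 ?scale0r ?addr0 // => i _; rewrite ffunE.
  - have [i iE] := deltaE o1; have [j jE] := deltaE o2; exists i, j.
    have -> : ((0, delta o1 + delta o2) : VX * VR) = (0, delta o1) + (0, delta o2).
      by congr pair; rewrite /= addr0.
    by rewrite linearD /= -iE -jE; f2.
  - have [b bE] := qp (inl (Some j)); have [i iE] := deltaE (Some r0).
    exists (inl b), (inr r0).
    rewrite embE /= sumd scale1r -bE; congr pair; last by rewrite add0r.
    by rewrite addr0; congr (_, _, _); rewrite /= ?add0r ?addr0.
have /fin_all_exists[a /fin_all_exists[b ab]] := ends.
exists (B + R)%type, (VH * VR)%type, p', (inl @: T), a, b; split.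
- by rewrite card_imset // => x y [].
- move=> J; pose J1 := [set b | inl b \in J]; pose J2 := [set i | inr i \in J].
  have sum1 : (\sum_(i in J) p' i).1 = \sum_(b in J1) p b.
    rewrite (big_morph (fun v : VH * VR => v.1) (id1 := 0) (op1 := +%R)) // big_sumType /=.
    by rewrite [X in _ + X]big1 // addr0; apply: eq_bigl => i; rewrite inE.
  have sum2 : (\sum_(i in J) p' i).2 = \sum_(i in J2) delta (Some i).
    rewrite (big_morph (fun v : VH * VR => v.2) (id1 := 0) (op1 := +%R)) // big_sumType /=.
    by rewrite [X in X + _]big1 // add0r; apply: eq_bigl => i; rewrite inE.
  have JE : J2 = set0 -> J = inl @: J1.
    move=> J20; apply/setP=> -[b'|i].
      by rewrite mem_imset ?inE // => x y [].
    by move/setP/(_ i): J20; rewrite !inE => ->; apply/esym/imsetP => -[].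
  split=> [J0|[->|JT]]; last first.
  - have J1T : J1 = T.
      by apply/setP=> b'; rewrite inE JT mem_imset // => x y [].
    have J20 : J2 = set0.
      by apply/setP=> i; rewrite !inE JT; apply/imsetP => -[].
    rewrite [LHS]surjective_pairing sum1 sum2 J1T J20 big_set0.
    by have -> : \sum_(b in T) p b = 0 by apply/ker; right.
  - by rewrite big_set0.
  have J20 : J2 = set0.
    apply/setP=> i; rewrite [RHS]inE; apply/negP=> iJ.
    have : (0 : VR) i = (\sum_(i in J2) delta (Some i)) i by rewrite -sum2 J0.
    rewrite sum_ffunE (bigD1 i) //= !ffunE eqxx big1 ?addr0 => [/eqP //|i' /andP[_ ii]].
    by rewrite ffunE (inj_eq Some_inj) (negPf ii).
  have /ker[] : \sum_(b in J1) p b = 0 by rewrite -sum1 J0.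
    by rewrite (JE J20) => ->; left; rewrite imset0.
  by rewrite (JE J20) => ->; right.
- by apply: eq_rep r' => e; rewrite ab.
Qed.
End Template.

(** * The Vertical Template Hypothesis applied to the class without PG(3,2)\L *)

Definition noPG_binary (M : matroid) : Prop := binary M /\ ~ has_PG32_delete_line_minor M.

Lemma noPG_binary_minor : minor_closed noPG_binary.
Proof.
move=> M N [bM nM] MN; split; first exact: binary_minor bM MN.
case=> L Ll NL; apply: nM; exists L => //.
by have /binary_rep[B [f r]] := bM; exact: (has_minor_trans_rep r MN NL).
Qed.

Lemma noPG_binary_proper : proper_minor_closed_binary noPG_binary.
Proof.
split; [by move=> M []|exact: noPG_binary_minor|].
have b : binary PG32.
  exists 'I_4, PG32_point, (fun (i : 'I_4) (p : PG32_point) => val p 0 i); exists id; first by exists id.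
  by move=> S; rewrite imset_id.
exists PG32 => // -[_ []]; exists (pair_line (row4 true false false false)
    (row4 false true false false)).
  by apply: pair_lineP; [| |rewrite -subr_eq0 oppF2 row4D]; rewrite row4_eq0.
exists set0, (pair_line (row4 true false false false) (row4 false true false false)).
split; first by rewrite disjoints_subset sub0set.
by exists id => [|S]; [exists id|rewrite imset_id].
Qed.

Lemma forward (VTH : vertical_template_hypothesis) :
  exists k n : nat, (0 < k)%N /\ (0 < n)%N /\
    forall M : matroid, binary M -> vertically_connected k M -> has_minor M (MK n) ->
    ~ has_PG32_delete_line_minor M -> even_cycle_with_blocking_pair M.
Proof.
have [k0 [n0 [k0p [n0p [s [t [Phi [Psi [PhiP _ conf _]]]]]]]]] := VTH _ noPG_binary_proper.
pose m := (\sum_(i < s) #|tY0 (Phi i)|)%N.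
have le_m i : (#|tY0 (Phi i)| <= m)%N by rewrite /m (bigD1 i) //= leq_addr.
(* [m] bounds the size of [Y_0] in all templates at once. The summands [m + 2] make [k] exceed that
   size by at least 2 and the rank [n - 1] of M(K_n) exceed it, as [template_quad_graphic]
   requires. *)
exists (k0 + m + 2)%N, (n0 + m + 2)%N; split; first by lia.
split=> [|M bM vc MKM nPG]; first by lia.
have /binary_rep[B [f r]] := bM.
apply: quad_graphic_even_cycle; apply: (quad_graphic_si r).
have Psi_M : noPG_binary (si f) by apply: noPG_binary_minor (si_has_minor f).
have vcs := si_connected r vc.
have MKs := si_minor r (@MK_simple _) MKM.
have MK0 : has_minor (si f) (MK n0) by apply: has_minor_MK_le Psi_M.1 _ MKs; lia.
have [|i ci] := conf (si f) Psi_M (@si_simple _ _ _ r) _ MK0; first by move=> P h; apply: vcs; apply: leq_trans h _; lia.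
apply: (template_quad_graphic _ ci vcs).
- by move=> N /PhiP[].
- by have := le_m i; lia.
- have := rep_rk_le (rep_si r) MKs; rewrite MK_rank; have := le_m i; lia.
Qed.

(** * From a blocking pair to a 4-set of sum zero, and its minors *)

Lemma resign_rel (G : graph) (W : {set edge G}) (u : vert G) (J : {set edge G}) :
  \sum_(e in J) mcol (even_cycle_matrix W) e = 0 <->
  \sum_(e in J) mcol (even_cycle_matrix (resign W u)) e = 0.
Proof.
set A := mcol _; set A' := mcol _.
have AS e v : A' e (Some v) = A e (Some v) by rewrite !ffunE.
have AN e : A' e None = A e None + A e (Some u).
  rewrite !ffunE /= /resign !inE.
  by case: (F2_cases (incidence u e)) => ->; rewrite ?eqxx /=; case: (e \in W) => //=;
    apply/val_inj.
have S v : (\sum_(e in J) A' e) (Some v) = (\sum_(e in J) A e) (Some v).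
  by rewrite !sum_ffunE; apply: eq_bigr.
have N : (\sum_(e in J) A' e) None = (\sum_(e in J) A e) None + (\sum_(e in J) A e) (Some u).
  by rewrite !sum_ffunE -big_split; apply: eq_bigr => e _; rewrite AN.
split=> /ffunP J0; apply/ffunP=> -[v|].
- by rewrite S J0 !ffunE.
- by rewrite N !J0 !ffunE addr0.
- by rewrite -S J0 !ffunE.
have := J0 None; rewrite N -(S u) (J0 (Some u)) [X in _ + X]ffunE addr0 => ->.
by rewrite !ffunE.
Qed.

Lemma resigns_rel (G : graph) (us : seq (vert G)) (W : {set edge G}) (J : {set edge G}) :
  \sum_(e in J) mcol (even_cycle_matrix W) e = 0 <->
  \sum_(e in J) mcol (even_cycle_matrix (foldl (@resign G) W us)) e = 0.
Proof. by elim: us W => //= u us IHus W; rewrite (resign_rel W u). Qed.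

(** The merging is undone: [t3] and [t4] are new copies of [u] and [v], and one end of each odd edge
    is moved from [u] to [t3], or else from [v] to [t4]. An odd loop at [u] becomes an edge between
    [t3] and [t1]. *)
Lemma even_cycle_quad_graphic (M : matroid) : even_cycle_with_blocking_pair M -> quad_graphic M.
Proof.
case=> G [W [[h hb hr] [u [v [uv [us blk]]]]]].
set W' := foldl _ W us in blk.
have r : rep (mcol (even_cycle_matrix W') : even_cycle_matroid W -> _) 0.
  by apply: (rep_rel (@rep_vec _ _ (even_cycle_matrix W))) => J; exact: resigns_rel.
pose B : finType := (vert G + bool)%type.
pose t1 : B := inl u; pose t2 : B := inl v; pose t3 : B := inr false; pose t4 : B := inr true.
have ut : uniq [:: t1; t2; t3; t4].
  by rewrite /= !inE !negb_or /= !andbT; apply: contraNneq uv => -[->].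
pose ab (e : edge G) : B * B :=
  let x := (ends e).1 in let y := (ends e).2 in
  if e \notin W' then (inl x, inl y) else if u == x then (t3, inl y)
  else if u == y then (inl x, t3) else if v == x then (t4, inl y) else (inl x, t4).
pose p := fold_vec t1 t2 t3 t4.
have colE e : [/\ forall x, (p (ab e).1 + p (ab e).2) (Some (inl x)) =
      mcol (even_cycle_matrix W') e (Some x),
    forall c, (p (ab e).1 + p (ab e).2) (Some (inr c)) = 0 &
    (p (ab e).1 + p (ab e).2) None = mcol (even_cycle_matrix W') e None].
  have pl x (o : option B) : p (inl x) o = (o == Some (inl x))%:R.
    by rewrite ffunE /fold_vertex /fold_odd /=; case: o => [o|].
  have p3 (o : option B) : p t3 o = (o == Some t1)%:R + (o == None)%:R.
    rewrite ffunE /fold_vertex /fold_odd /=; case: o => [o|]; rewrite ?addr0 ?add0r //.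
  have p4 (o : option B) : p t4 o = (o == Some t2)%:R + (o == None)%:R.
    rewrite ffunE /fold_vertex /fold_odd /=; case: o => [o|]; rewrite ?addr0 ?add0r //.
  have addE (f g : {ffun option B -> F2}) o : (f + g) o = f o + g o by rewrite ffunE.
  have incE x : mcol (even_cycle_matrix W') e (Some x) =
    (x == (ends e).1)%:R + (x == (ends e).2)%:R by rewrite ffunE.
  have parE : mcol (even_cycle_matrix W') e None = (e \in W')%:R by rewrite ffunE.
  have blkE := blk e; rewrite /incident in blkE.
  rewrite /ab; have [eW|eW] := boolP (e \in W') => /=; last first.
    by split=> [x|c|]; rewrite addE !pl ?incE ?parE ?(negPf eW) //= addr0.
  have [ux|ux] := eqVneq u (ends e).1.
    by split=> [x|c|]; rewrite addE pl p3 ?incE ?parE ?eW /= ?addr0 ?add0r // /t1 ux.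
  have [uy|uy] := eqVneq u (ends e).2.
    by split=> [x|c|]; rewrite addE pl p3 ?incE ?parE ?eW /= ?addr0 ?add0r // /t1 uy.
  move: blkE; rewrite eW (negPf ux) (negPf uy) /= => /(_ isT).
  have [vx _|vx] := eqVneq v (ends e).1.
    by split=> [x|c|]; rewrite addE pl p4 ?incE ?parE ?eW /= ?addr0 ?add0r // /t2 vx.
  move=> /eqP vy.
  by split=> [x|c|]; rewrite addE pl p4 ?incE ?parE ?eW /= ?addr0 ?add0r // /t2 vy.
exists B, {ffun option B -> F2}, p, [set t1; t2; t3; t4], (fun e => (ab (h e)).1), (fun e => (ab (h e)).2).
split; [|exact: fold_vec_ker|].
  by rewrite -[RHS](card_uniqP ut); apply: eq_card => i; rewrite !inE !orbA.
apply: (rep_iso (f := fun e : even_cycle_matroid W => p (ab e).1 + p (ab e).2) hr).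
apply: (rep_rel r) => J; split=> /ffunP J0; apply/ffunP=> o.
  move: o => [[x|c]|]; rewrite sum_ffunE ffunE.
  - have := J0 (Some x); rewrite sum_ffunE ffunE => {2}<-.
    by apply: eq_bigr => e _; have [-> _ _] := colE e.
  - by rewrite big1 // => e _; have [_ -> _] := colE e.
  - have := J0 None; rewrite sum_ffunE ffunE => {2}<-.
    by apply: eq_bigr => e _; have [_ _ ->] := colE e.
move: o => [x|]; rewrite sum_ffunE ffunE.
  have := J0 (Some (inl x)); rewrite sum_ffunE ffunE => {2}<-.
  by apply: eq_bigr => e _; have [-> _ _] := colE e.
have := J0 None; rewrite sum_ffunE ffunE => {2}<-.
by apply: eq_bigr => e _; have [_ _ ->] := colE e.
Qed.

(* The minors of quad_graphic matroids: T shrinks when its vertices are identified. *)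
Definition small_graphic (M : matroid) : Prop :=
  exists (B : finType) (V : vectType 'F_2) (p : B -> V) (T : {set B}) (a b : M -> B),
  [/\ (#|T| <= 4)%N, odd #|T| = false,
      forall J : {set B}, \sum_(i in J) p i = 0 -> J = set0 \/ J = T
    & rep (fun e => p (a e) + p (b e)) 0].

Lemma sum_F2_card (B : finType) (P : pred B) (T : {set B}) :
  \sum_(i | P i) (i \in T)%:R = (odd #|[set i in T | P i]|)%:R :> 'F_2.
Proof.
rewrite -F2_natr -sum1_card natr_sum big_mkcond [RHS]big_mkcond.
by apply: eq_bigr => i _; rewrite inE; case: (i \in T); case: (P i).
Qed.

Lemma sum_eq_F2 (B : finType) (P : pred B) (x : B) :
  \sum_(i | P i) (x == i)%:R = (P x)%:R :> 'F_2.
Proof.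
rewrite big_mkcond (bigD1 x) //= eqxx big1 ?addr0 => [|i ix]; first by case: (P x).
by rewrite eq_sym (negPf ix); case: (P i).
Qed.

(** The vertices of the minor are the components of the contracted edges, given by their roots. A
    component belongs to the new 4-set or its remnant when it contains an odd number of vertices of
    [T], which bounds the size by 4 and preserves parity. *)
Lemma quad_graphic_minor (M N : matroid) :
  quad_graphic M -> has_minor M N -> small_graphic N.
Proof.
case=> B [V [p [T [a [b [T4 ker r]]]]]] /(has_minor_rep r)[C [h [hi hC rN]]].
pose f e := p (a e) + p (b e).
pose A : rel B := fun i j => [exists e in C, ((a e, b e) == (i, j)) || ((a e, b e) == (j, i))].
have symA : connect_sym A.
  by apply: sym_connect_sym => i j; apply: eq_existsb => e; rewrite orbC.
have conU i j : connect A i j -> p i + p j \in sp f C.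
  case/connectP=> s; elim: s i => [|k s IHs] i /=; first by move=> _ ->; rewrite addF2 mem0v.
  case/andP=> /exists_inP[e eC ik] ks lj.
  have pik : p i + p k \in sp f C.
    have -> : p i + p k = f e by rewrite /f; case/orP: ik => /eqP[-> ->] //; rewrite addrC.
    exact: mem_sp.
  by apply: (memv_eq (memvD pik (IHs k ks lj))); f2.
pose rt := fingraph.root A.
have [chi chiU _] := hom_lker (0 + sp f C).
have chi_rt i : chi (p i) = chi (p (rt i)).
  apply: eqF2; rewrite -linearD; apply/eqP; rewrite -memv_ker chiU add0v.
  exact/conU/connect_root.
pose B' : finType := {i : B | roots A i}.
have rootsP i : roots A (rt i) by exact: roots_root.
pose toB (i : B) : B' := exist (roots A) (rt i) (rootsP i).
pose T' : {set B'} := [set i | odd #|[set j in T | rt j == val i]|].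
have rtA e : e \in C -> rt (a e) = rt (b e).
  move=> eC; apply/eqP; rewrite /rt (root_connect symA); apply: connect1.
  by apply/exists_inP; exists e; rewrite ?eqxx.
exists B', V, (fun i => chi (p (val i))), T', (fun x => toB (a (h x))), (fun x => toB (b (h x))).
split.
- rewrite -T4 -(card_imset _ val_inj).
  apply: leq_trans (_ : #|rt @: T| <= _)%N; last exact: leq_imset_card.
  apply/subset_leq_card/subsetP => _ /imsetP[i + ->]; rewrite inE => oi.
  have /card_gt0P[j] : (0 < #|[set j in T | rt j == val i]|)%N by case: #|_| oi.
  by rewrite inE => /andP[jT /eqP <-]; exact: imset_f.
- have : \sum_(i : B') (i \in T')%:R = \sum_(j : B) (j \in T)%:R :> 'F_2.
    rewrite [RHS](partition_big toB predT) //=; apply: eq_bigr => i _.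
    rewrite sum_F2_card inE; congr (odd _)%:R.
  rewrite !sum_F2_card.
  have e (X : finType) (S : {set X}) : [set i in S | true] = S.
    by apply/setP=> i; rewrite inE andbT.
  by rewrite !e T4; case: (odd _).
- move=> J J0.
  have [C' sC' e1] : exists2 C' : {set M}, C' \subset C &
      \sum_(i in J) p (val i) = \sum_(e in C') f e.
    apply/spP; rewrite -[sp f C]add0v -chiU memv_ker linear_sum.
    by apply/eqP; rewrite -[RHS]J0.
  (* A relation between roots modulo contracted edges becomes a relation with coefficients [c]
     between the old vertices. Summed over a component, the contracted edges cancel, as both their
     ends lie in it. *)
  pose c i : 'F_2 := (i \in val @: J)%:R + \sum_(e in C') ((a e == i)%:R + (b e == i)%:R).
  have sum_b x : \sum_i (x == i)%:R *: p i = p x.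
    rewrite (bigD1 x) //= eqxx scale1r big1 ?addr0 // => i ix.
    by rewrite eq_sym (negPf ix) scale0r.
  have c0 : \sum_i c i *: p i = 0.
    transitivity (\sum_(i in val @: J) p i + \sum_(e in C') f e).
      rewrite (big_mkcond (fun i => i \in val @: J)) /=.
      under eq_bigr => i _ do rewrite scalerDl scaler_suml.
      rewrite big_split exchange_big /=; congr (_ + _).
        by apply: eq_bigr => i _; case: (i \in _); rewrite ?scale1r ?scale0r.
      apply: eq_bigr => e _; under eq_bigr => i _ do rewrite scalerDl.
      by rewrite big_split /= !sum_b.
    rewrite big_imset => [|x y _ _]; last exact: val_inj.
    by rewrite e1 addF2.
  have push (i0 : B') : \sum_(i | rt i == val i0) c i = (i0 \in J)%:R.
    rewrite big_split exchange_big /= [X in _ + X]big1 ?addr0 => [|e eC]; last first.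
      by rewrite big_split /= !sum_eq_F2 rtA ?(subsetP sC') // F2_addrr.
    rewrite sum_F2_card; congr (_%:R).
    have -> : [set i in val @: J | rt i == val i0] = val @: (J :&: [set i0]).
      apply/setP=> i; rewrite inE; apply/andP/imsetP => [[/imsetP[j jJ ->]]|[j]].
        have /eqP rj : rt (val j) == val j := valP j.
        by rewrite rj val_eqE => /eqP <-; exists j => //; rewrite !inE jJ eqxx.
      rewrite !inE => /andP[jJ /eqP jE] ->; split; first exact: imset_f.
      by rewrite -jE; exact: (valP j).
    rewrite card_imset; last exact: val_inj.
    have [iJ|iJ] := boolP (i0 \in J); first by rewrite (setIidPr _) ?cards1 // sub1set.
    rewrite (_ : _ :&: _ = set0) ?cards0 //; apply/setP=> j; rewrite !inE.
    by case: (eqVneq j i0) => [->|]; rewrite ?(negPf iJ) ?andbF.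
  move: c0; rewrite sum_setF2 => /ker[|] K0; [left|right]; apply/setP=> i0.
    rewrite [RHS]inE; apply/negbTE/negP=> iJ; have := push i0; rewrite iJ big1 => [/eqP //|i _].
    by move/setP/(_ i): K0; rewrite !inE => /negbFE/eqP.
  have cE i : c i = (i \in T)%:R.
    by move/setP/(_ i): K0; rewrite inE => <-; case: (F2_cases (c i)) => ->.
  have := push i0; under eq_bigr => i _ do rewrite cE.
  rewrite sum_F2_card [i0 \in T']inE.
  by case: (odd _); case: (i0 \in J) => // /eqP.
- have [|v _ v0|q _] := @rep_quot N V V chi (f \o h) (0 + sp f C).
  + by rewrite chiU.
  + by rewrite -chiU memv_ker v0.
  apply: (eq_rep _ (q rN)) => x.
  by rewrite /= linearD /= !(chi_rt (_ (h x))).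
Qed.

(** * Counting the edges at a vertex *)

Definition cocycle (N : matroid) (V : vectType 'F_2) (f : N -> V) (u : 'Hom(V, F2)) : {set N} :=
  [set e | u (f e) != 0].

Lemma cocycle_rank (N : matroid) (V : vectType 'F_2) (f : N -> V) u :
  rep f 0 -> cocycle f u != set0 -> (rk N (~: cocycle f u) < rk N setT)%N.
Proof.
move=> r /set0Pn[e]; rewrite inE => ue; rewrite !(rep_rk _ r).
have sT : (sp f (~: cocycle f u) <= sp f setT)%VS by apply: spS.
rewrite ltn_neqAle dimvS // andbT; apply: contra ue => /eqP d.
have /eqP E : sp f (~: cocycle f u) == sp f setT by rewrite eqEdim sT d leqnn.
have : f e \in sp f (~: cocycle f u) by rewrite E mem_sp ?inE.
suff /subvP h : (sp f (~: cocycle f u) <= lker u)%VS by move/h; rewrite memv_ker.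
by apply/sp_subP=> i; rewrite in_setC inE negbK memv_ker.
Qed.

Section Stars.
Variables (N : matroid) (B : finType) (V : vectType 'F_2) (p : B -> V) (T : {set B}).
Variables (a b : N -> B).
Let f e := p (a e) + p (b e).
Hypothesis T4 : (#|T| <= 4)%N.
Hypothesis Teven : odd #|T| = false.
Hypothesis ker : forall J : {set B}, \sum_(i in J) p i = 0 -> J = set0 \/ J = T.
Hypothesis r : rep f 0.

Variable m : nat.
Hypothesis cocycle_card : forall u, cocycle f u = set0 \/ (m <= #|cocycle f u|)%N.

Definition cut (J : {set B}) : {set N} := [set e | (a e \in J) (+) (b e \in J)].
Notation star i := (cut [set i]).

(** The indicator function of [J] extends linearly as soon as it respects the only possible
    relation, the one on [T]. *)
Lemma cut_cocycle (J : {set B}) : \sum_(i in T) p i != 0 \/ odd #|T :&: J| = false ->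
  exists u, cut J = cocycle f u.
Proof.
move=> TJ; have [K K0|u uE] := @ext_hom V F2 B p (fun i => (i \in J)%:R).
  have [->|KT] := ker K0; first by rewrite big_set0.
  case: TJ => [|ev]; first by rewrite -KT K0 eqxx.
  rewrite KT sum_F2_card (_ : [set i in J | i \in T] = T :&: J) ?ev //.
  by apply/setP=> i; rewrite !inE andbC.
exists u; apply/setP=> e; rewrite !inE linearD /= !uE.
by case: (a e \in J); case: (b e \in J).
Qed.

Lemma cut_card (J : {set B}) : \sum_(i in T) p i != 0 \/ odd #|T :&: J| = false ->
  cut J != set0 -> (m <= #|cut J|)%N.
Proof.
by move=> /cut_cocycle[u ->]; have [->|] := cocycle_card u; rewrite ?eqxx.
Qed.

Definition nonisolated : {set B} := [set i | star i != set0].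

Lemma star_sum (X : {set B}) : (\sum_(i in X) #|star i| <= 2 * #|N|)%N.
Proof.
apply: (@leq_trans (\sum_(i : B) \sum_(e : N) (e \in star i))%N).
  rewrite big_mkcond; apply: leq_sum => i _; case: (i \in X) => //.
  by rewrite -sum1_card big_mkcond; apply: leq_sum => e _; case: (e \in _).
rewrite exchange_big mulnC -sum_nat_const; apply: leq_sum => e _.
apply: (@leq_trans (\sum_(i : B) (i \in [set a e; b e]))%N).
  apply: leq_sum => i _; rewrite !inE ![i == _]eq_sym.
  by case: (a e == i); case: (b e == i).
by rewrite -big_mkcond /= sum1_card cards2; case: (_ != _).
Qed.

Lemma rank_le (D : {set B}) (i0 : B) : i0 \in D ->
  (forall e, f e \in sp (fun i => p i + p i0) D) -> (rk N setT < #|D|)%N.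
Proof.
move=> iD fD; rewrite (rep_rk _ r) (cardsD1 i0) iD ltnS.
apply: leq_trans (dim_sp_card (fun i => p i + p i0) (D :\ i0)).
apply: dimvS; apply: (@subv_trans _ _ (sp (fun i => p i + p i0) D)).
  by apply/sp_subP=> e _; exact: fD.
apply/sp_subP=> i iD'; have [->|ii] := eqVneq i i0; first by rewrite addF2 mem0v.
by apply: (mem_sp (fun i => p i + p i0)); rewrite !inE ii.
Qed.

Lemma ends_nonisolated e : a e != b e -> (a e \in nonisolated) && (b e \in nonisolated).
Proof.
move=> ab; rewrite !inE; apply/andP; split; apply/set0Pn; exists e; rewrite !inE eqxx.
  by rewrite eq_sym (negPf ab).
by rewrite (negPf ab).
Qed.

Lemma edge_sp (D : {set B}) (i0 : B) e :
  (a e != b e -> (a e \in D) && (b e \in D)) -> f e \in sp (fun i => p i + p i0) D.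
Proof.
rewrite /f; have [-> _|ab /(_ isT) /andP[aD bD]] := eqVneq (a e) (b e).
  by rewrite addF2 mem0v.
have h i : i \in D -> p i + p i0 \in sp (fun i => p i + p i0) D.
  exact: (mem_sp (fun i => p i + p i0)).
by apply: (memv_eq (memvD (h _ aD) (h _ bD))); f2.
Qed.

Lemma rank_nonisolated : (0 < rk N setT)%N -> (rk N setT < #|nonisolated|)%N.
Proof.
move=> r0; have [I0|/set0Pn[i0 i0I]] := eqVneq nonisolated set0.
  suff : (rk N setT <= 0)%N by lia.
  rewrite (rep_rk _ r) leqn0 dimv_eq0 -subv0; apply/sp_subP => e _.
  rewrite /f; have [->|/ends_nonisolated] := eqVneq (a e) (b e); first by rewrite addF2 mem0v.
  by rewrite I0 !inE.
by apply: rank_le i0I _ => e; apply: edge_sp => /ends_nonisolated.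
Qed.

Lemma sum_star_ge (X : {set B}) : (forall i, i \in X -> (m <= #|star i|)%N) ->
  (m * #|X| <= \sum_(i in X) #|star i|)%N.
Proof. by move=> h; rewrite mulnC -sum_nat_const; apply: leq_sum. Qed.

Lemma T_two (s : B) : #|T| = 2%N -> s \in T -> exists2 t, T = [set s; t] & s != t.
Proof.
move=> T2 sT; have /cards1P[t tE] : #|T :\ s| == 1%N.
  by move: T2; rewrite (cardsD1 s) sT => /eqP; rewrite eqSS.
exists t; first by rewrite -(setD1K sT) tE.
by have := set11 t; rewrite -tE !inE eq_sym => /andP[].
Qed.

(** As [T] is even, its relation also holds for the differences from [i0]. It expresses the one of
    [t1] by the others, so one vertex fewer is needed than in [rank_le]. *)
Lemma rank_T (t1 : B) (D : {set B}) : \sum_(i in T) p i = 0 -> t1 \in T -> T \subset D ->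
  (exists2 i0, i0 \in T & i0 != t1) ->
  (forall e, a e != b e -> (a e \in D) && (b e \in D)) -> (rk N setT + 2 <= #|D|)%N.
Proof.
move=> T0 t1T TD [i0 i0T i01] ends.
suff : (rk N setT < #|D :\ t1|)%N by rewrite [#|D|](cardsD1 t1) (subsetP TD) //; lia.
have i0D : i0 \in D :\ t1 by rewrite !inE i01 (subsetP TD).
apply: rank_le i0D _ => e.
have h i : i \in D -> p i + p i0 \in sp (fun i => p i + p i0) (D :\ t1).
  move=> iD; have [->|it] := eqVneq i t1; last first.
    by apply: (mem_sp (fun i => p i + p i0)); rewrite !inE it.
  have : \sum_(i in T) (p i + p i0) = 0.
    by rewrite big_split /= T0 add0r sumr_const -scaler_nat F2_natr Teven scale0r.
  rewrite (bigD1 t1) //= => /eqF2 ->; apply: memv_suml => j /andP[jT jt].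
  by apply: (mem_sp (fun i => p i + p i0)); rewrite !inE jt (subsetP TD).
rewrite /f; have [->|/ends/andP[aD bD]] := eqVneq (a e) (b e); first by rewrite addF2 mem0v.
by apply: (memv_eq (memvD (h _ aD) (h _ bD))); f2.
Qed.

Lemma cut_symdiff (J K : {set B}) : cut (symdiff J K) = symdiff (cut J) (cut K).
Proof.
apply/setP=> e; rewrite in_symdiff !inE -!/(symdiff _ _).
by case: (a e \in J); case: (a e \in K); case: (b e \in J); case: (b e \in K).
Qed.

Lemma star_three e i j k : i != j -> i != k -> j != k ->
  e \in star i -> e \in star j -> e \in star k -> False.
Proof.
rewrite !inE => ij ik jk.
case: (eqVneq (a e) i) => [->|_] /=.
  rewrite (negPf ij) (negPf ik) /= => _ /eqP -> /eqP; exact/eqP.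
move=> /eqP ->; rewrite (negPf ij) (negPf ik) !addbF => /eqP -> /eqP; exact/eqP.
Qed.

Lemma cut2 s t : s != t -> cut [set s; t] = symdiff (star s) (star t).
Proof.
move=> st; rewrite -cut_symdiff; congr cut; apply/setP=> j; rewrite in_symdiff !inE.
by case: (eqVneq j s) => // ->; rewrite (negPf st).
Qed.

(* Counting incidences: every nonempty star has at least m elements, except that
   for i in T only the differences of two stars are cocycles. *)
Lemma star_count : (0 < rk N setT)%N ->
  [\/ (m * (rk N setT).+1 <= 2 * #|N|)%N, (m * rk N setT + 2 <= 2 * #|N|)%N |
   [/\ #|T| = 4%N, (m * (rk N setT - 2) + \sum_(i in T) #|star i| <= 2 * #|N|)%N &
     forall s t, s \in T -> t \in T -> s != t -> (m <= #|cut [set s; t]|)%N]].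
Proof.
move=> r0; have rI := rank_nonisolated r0.
have case_a : (forall i, i \in nonisolated -> (m <= #|star i|)%N) ->
    (m * (rk N setT).+1 <= 2 * #|N|)%N.
  move=> h; apply: leq_trans (star_sum nonisolated); apply: leq_trans (sum_star_ge h).
  by rewrite leq_mul2l rI orbT.
have [T0|T0] := boolP (\sum_(i in T) p i == 0); last first.
  constructor 1; apply: case_a => i; rewrite inE; apply: cut_card.
  by left; rewrite T0.
have notT i : i \notin T -> i \in nonisolated -> (m <= #|star i|)%N.
  move=> iT; rewrite inE; apply: cut_card; right.
  suff -> : T :&: [set i] = set0 by rewrite cards0.
  by apply/setP=> j; rewrite !inE; case: eqP => [->|]; rewrite ?(negPf iT) ?andbF.
have [TI|/subsetPn[t0 t0T]] := boolP (T \subset nonisolated); last first.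
  (* A vertex [t0] of [T] with empty star may be added to any other vertex of [T] without changing
     the cut; the resulting pair meets [T] evenly, so all nonempty stars are cocycles. *)
  rewrite inE negbK => /eqP st0.
  constructor 1; apply: case_a => i iI; have [iT|/notT] := boolP (i \in T); last exact.
  have it0 : i != t0 by apply: contraTneq iI => ->; rewrite inE st0 eqxx.
  have E : star i = cut [set i; t0].
    by rewrite cut2 // st0 /symdiff setD0 set0D setU0.
  rewrite E; apply: cut_card; last by rewrite -E; move: iI; rewrite inE.
  right; suff -> : T :&: [set i; t0] = [set i; t0] by rewrite cards2 it0.
  by apply/setIidPr; rewrite subUset !sub1set iT.
have [T00|T00] := eqVneq T set0.
  by constructor 1; apply: case_a => i; apply: notT; rewrite T00 inE.
have ends e : a e != b e -> (a e \in nonisolated) && (b e \in nonisolated).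
  exact: ends_nonisolated.
have sumD : (m * #|nonisolated :\: T| + \sum_(i in T) #|star i| <= 2 * #|N|)%N.
  apply: leq_trans (star_sum nonisolated).
  rewrite [X in (_ <= X)%N](big_setID T) /= (setIidPr TI) addnC leq_add2l; apply: sum_star_ge => i.
  by rewrite inE => /andP[iT]; exact: notT.
have pos i : i \in T -> (0 < #|star i|)%N.
  by move=> /(subsetP TI); rewrite inE -card_gt0.
have cardD : (#|nonisolated :\: T| + #|T| = #|nonisolated|)%N.
  by have := cardsID T nonisolated; rewrite (setIidPr TI); lia.
have /set0Pn[t1 t1T] := T00.
have T24 : #|T| = 2%N \/ #|T| = 4%N.
  move: Teven T4 T00; rewrite -card_gt0.
  by case: #|T| => [|[|[|[|[|]]]]] //; [left|right].
have other s : s \in T -> exists2 i0, i0 \in T & i0 != s.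
  move=> sT; have : (0 < #|T :\ s|)%N.
    by move: T24; rewrite (cardsD1 s) sT; lia.
  by case/card_gt0P=> i; rewrite !inE => /andP[is_ iT]; exists i.
have rT := rank_T (eqP T0) t1T TI (other t1 t1T) ends.
have [T2|T4'] := T24.
  (* At least [rk N setT] vertices with nonempty stars lie outside [T], and the two stars in [T]
     contribute at least 1 each. *)
  constructor 2; have [t2 TE t12] := T_two T2 t1T.
  have t2T : t2 \in T by rewrite TE !inE eqxx orbT.
  move: sumD; rewrite {2}TE big_setU1 ?inE //= big_set1.
  have := pos _ t1T; have := pos _ t2T.
  have : (m * rk N setT <= m * #|nonisolated :\: T|)%N by rewrite leq_mul2l; lia.
  lia.
have pair s t : s \in T -> t \in T -> s != t -> star s != star t ->
    (m <= #|cut [set s; t]|)%N /\ (m <= #|star s| + #|star t|)%N.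
  move=> sT tT st ss; suff h : (m <= #|cut [set s; t]|)%N.
    by split=> //; apply: leq_trans h _; rewrite cut2 // -card_symdiff leq_addr.
  apply: cut_card.
    right; suff -> : T :&: [set s; t] = [set s; t] by rewrite cards2 st.
    by apply/setIidPr; rewrite subUset !sub1set sT.
  apply: contraNneq ss => /setP c0; apply/eqP/setP=> e; have := c0 e.
  by rewrite cut2 // in_symdiff in_set0; case: (e \in star s); case: (e \in star t).
have [/existsP[s /existsP[t /and4P[sT tT st /eqP est]]]|ndup] := boolP [exists s, exists t,
    [&& s \in T, t \in T, s != t & star s == star t]].
  (* Equal stars mean that all nonloop edges at [s] or [t] join these two. Since
     [p s + p t = p x + p y], such edges are replaced by an edge [xy], and the rank is bounded
     without [s] and [t]. The pairs [s], [x] and [t], [y] contribute [m] each. *)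
  constructor 1.
  have /cards2P[x [y [xy TE]]] : #|T :\ s :\ t| == 2%N.
    move: T4'; rewrite (cardsD1 s) sT (cardsD1 t (T :\ s)) !inE eq_sym st tT => /eqP.
    by rewrite !eqSS.
  have xy_in z : z \in [set x; y] -> [/\ z \in T, z != s & z != t].
    by rewrite -TE !inE => /and3P[].
  have [xT xs xt] := xy_in x (set21 x y); have [yT ys yt] := xy_in y (set22 x y).
  have st_ends e : a e != b e -> (a e \in [set s; t]) || (b e \in [set s; t]) ->
      f e = p s + p t.
    have := congr1 (fun X : {set N} => e \in X) est; rewrite !inE /f.
    case: (eqVneq (a e) s) => [->|as_]; case: (eqVneq (b e) s) => [->|bs]; rewrite ?eqxx //=.
    - by rewrite (negPf st); case: (eqVneq (b e) t) => [->|].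
    - by rewrite (negPf st) addbF; case: (eqVneq (a e) t) => [-> _ _ _|//]; rewrite addrC.
    - case: (eqVneq (a e) t) => [->|]; case: (eqVneq (b e) t) => [->|] //=.
  have [e0 e0s] := card_gt0P (pos s sT).
  have [e1 e1t] := card_gt0P (pos t tT).
  have sx : star s != star x.
    apply: contraTneq e0s => sx; apply/negP=> e0s.
    by apply: (@star_three e0 s t x) => //; rewrite 1?eq_sym // -?est -?sx.
  have ty : star t != star y.
    apply: contraTneq e1t => ty; apply/negP=> e1t.
    by apply: (@star_three e1 s t y) => //; rewrite 1?eq_sym // ?est -?ty.
  have := (pair _ _ sT xT _ sx).2; rewrite eq_sym xs => /(_ isT) h1.
  have := (pair _ _ tT yT _ ty).2; rewrite eq_sym yt => /(_ isT) h2.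
  have stI : [set s; t] \subset nonisolated by rewrite subUset !sub1set !(subsetP TI).
  pose D := nonisolated :\: [set s; t].
  have zD z : z \in [set x; y] -> z \in D.
    by move=> /xy_in[zT zs zt]; rewrite in_setD in_set2 negb_or zs zt (subsetP TI).
  have xD := zD x (set21 x y); have yD := zD y (set22 x y).
  have : (rk N setT < #|D|)%N.
    apply: (rank_le xD) => e; have [ab|ab] := eqVneq (a e) (b e).
      by apply: edge_sp; rewrite ab eqxx.
    have [/(st_ends e ab) ->|] := boolP ((a e \in [set s; t]) || (b e \in [set s; t])).
      have : p s + p t = p x + p y.
        apply: eqF2; move/eqP: T0; rewrite (big_setD1 s) //= (big_setD1 t) ?inE 1?eq_sym ?st //=.
        by rewrite TE big_setU1 ?inE //= big_set1 addrA.
      move=> ->; apply: (memv_eq (mem_sp (fun i => p i + p x) yD)); exact: addrC.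
    rewrite negb_or => /andP[aD bD]; apply: edge_sp => _.
    by rewrite !in_setD aD bD ends.
  rewrite /D cardsDS // cards2 st => h3.
  move: sumD; rewrite (big_setD1 s) //= (big_setD1 t) ?inE 1?eq_sym ?st //=.
  rewrite TE big_setU1 ?inE //= big_set1 => h4.
  have h5 : (m * (rk N setT - 1) <= m * #|nonisolated :\: T|)%N.
    by rewrite leq_mul2l; apply/orP; right; move: h3 cardD T4' ; clear; lia.
  have -> : (m * (rk N setT).+1 = m * (rk N setT - 1) + m + m)%N.
    by case: (rk N setT) r0 => // q _; rewrite subn1 /= !mulnS; clear; lia.
  by rewrite -addnA; apply: leq_trans h4; apply: leq_add => //; move: h1 h2; clear; lia.
constructor 3; split=> //.
  apply: leq_trans sumD; rewrite leq_add2r leq_mul2l; lia.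
move=> s t sT tT st; apply: (pair s t sT tT st _).1.
by apply: contraNneq ndup => e; apply/existsP; exists s; apply/existsP; exists t; rewrite sT tT st e eqxx.
Qed.

End Stars.

(** * The two excluded minors *)

Lemma cards4 (I : finType) (T : {set I}) : #|T| = 4%N ->
  exists s t x y, [/\ uniq [:: s; t; x; y], T =i [:: s; t; x; y] &
    forall g : I -> nat, (\sum_(i in T) g i = g s + g t + g x + g y)%N].
Proof.
rewrite cardE; have := enum_uniq T.
have : T =i enum T by move=> i; rewrite mem_enum.
have : forall g : I -> nat, (\sum_(i in T) g i = \sum_(i <- enum T) g i)%N.
  by move=> g; rewrite big_enum.
case: (enum T) => [|s [|t [|x [|y []]]]] // sumE TE un _; exists s, t, x, y; split=> // g.
by rewrite sumE !big_cons big_nil addn0 !addnA.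
Qed.

Lemma card_MK6 : #|MK 6| = 15%N.
Proof.
rewrite card_sub -sum1_card (eq_bigl (fun p : 'I_6 * 'I_6 => true && (p.1 < p.2)%N)) //.
rewrite -(pair_big_dep xpredT (fun i j : 'I_6 => (i < j)%N) (fun _ _ => 1%N)) /=.
under eq_bigr => i _ do rewrite big_mkcond !big_ord_recl big_ord0.
by rewrite !big_ord_recl big_ord0.
Qed.

(** A nonempty cocycle of the dual is dependent in the simple matroid M(K_6), so it has at least 3
    elements. The first two bounds of [star_count] fail because 33 and 32 exceed 30. The third
    leaves at most 6 for the four stars in [T], but pairwise sums of at least 3 require at least
    7. *)
Lemma dual_MK6_not_small : ~ small_graphic (dual (MK 6)).
Proof.
case=> B [V [p [T [a [b [T4 Tev ker r]]]]]].
have rkM : rk (MK 6) setT = 5%N by rewrite MK_rank.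
have cardN : #|dual (MK 6)| = 15%N := card_MK6.
have rkN : rk (dual (MK 6)) setT = 10%N.
  by rewrite /= /dual_rk setCT rk0 rkM cardsT cardN.
pose f e := p (a e) + p (b e).
have cc u : cocycle f u = set0 \/
    (3 <= #|cocycle f u|)%N.
  have [|S0] := eqVneq (cocycle f u) set0; [by left|right].
  have := cocycle_rank r S0; rewrite rkN.
  have h (S : {set MK 6}) : (dual_rk (~: S) < 10)%N -> (3 <= #|S|)%N.
    rewrite /dual_rk setCK rkM; have := cardsC S; rewrite card_MK6.
    have [//|S2] := leqP 3 #|S|; rewrite (MK_simple S2); lia.
  exact: h.
have := star_count T4 Tev ker r cc; rewrite rkN cardN.
case=> // -[/cards4[s [t [x [y [un TE sumE]]]]]]; rewrite sumE => le pair.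
have pr i j : i \in T -> j \in T -> i != j -> (3 <= #|cut a b [set i]| + #|cut a b [set j]|)%N.
  move=> iT jT ij; apply: leq_trans (pair i j iT jT ij) _.
  by rewrite cut2 // -card_symdiff leq_addr.
move: un; rewrite /= !inE !negb_or -!andbA => /and5P[st sx sy tx /andP[ty /andP[xy _]]].
have := (pr s t, pr s x, pr s y, pr t x, pr t y, pr x y); rewrite !TE !inE !eqxx ?orbT.
case=> -[-[-[-[h1 h2] h3] h4] h5] h6.
have := (h1 isT isT st, h2 isT isT sx, h3 isT isT sy, h4 isT isT tx, h5 isT isT ty, h6 isT isT xy).
lia.
Qed.

Lemma card_vspace_rV4 (U : {vspace 'rV['F_2]_4}) : #|[set v in U]| = (2 ^ \dim U)%N.
Proof.
by rewrite cardsE (@card_vspace 'F_2 'rV['F_2]_4 _ U) card_Fp.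
Qed.

(* Translation by a vector x of W with u x != 0 exchanges the two halves of W. *)
Lemma half_vspace (U : {vspace 'rV['F_2]_4}) (u : 'Hom('rV['F_2]_4, F2)) :
  let n := #|[set v in U | u v != 0]| in n = 0%N \/ (2 * n = 2 ^ \dim U)%N.
Proof.
move=> n; have [n0|/set0Pn[x]] := eqVneq [set v in U | u v != 0] set0.
  by left; rewrite /n n0 cards0.
rewrite inE => /andP[xU ux]; right; rewrite -card_vspace_rV4 /n.
have u1 v : u v != 0 -> u v = 1 by case: (F2_cases (u v)) => ->; rewrite ?eqxx.
have E : [set v in U] :\: [set v in U | u v != 0] = [set v + x | v in [set v in U | u v != 0]].
  apply/setP=> v; rewrite !inE negb_and negbK; apply/andP/imsetP => [[h vU]|[w]].
    have uv : u v == 0 by move: h; rewrite vU.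
    exists (v + x); last by rewrite addF2K.
    by rewrite inE memvD //= linearD /= (eqP uv) add0r.
  rewrite inE => /andP[wU uw] ->; by rewrite memvD // linearD /= (u1 _ uw) (u1 _ ux) .
rewrite -[RHS](cardsID [set v in U | u v != 0] _) E card_imset; last exact: addIr.
rewrite (_ : _ :&: _ = [set v in U | u v != 0]) ?addnn ?mul2n //.
by apply/setP=> v; rewrite !inE andbA andbb.
Qed.

Lemma card_delete_line (L : {set PG32}) (U : {vspace 'rV['F_2]_4}) (P : pred 'rV['F_2]_4) :
  ~~ P 0 -> L = [set q : PG32_point | val q \in U] ->
  #|[set x : delete L | P (PGL_val x)]| = #|[set v | P v && (v \notin U)]|.
Proof.
move=> P0 LE; have LP (q : PG32_point) : (q \in L) = (val q \in U) by rewrite LE inE.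
rewrite -(card_imset _ (@PGL_val_inj L)); apply: eq_card => v.
apply/imsetP/idP => [[x]|]; rewrite !inE.
  by move=> Px ->; rewrite Px; have := PGL_val_notin x; rewrite LP.
case/andP=> Pv vU; have v0 : v != 0 by apply: contraNneq P0 => <-.
pose q : PG32_point := exist _ v v0.
have qL : q \notin set0 :|: L by rewrite in_setU in_set0 LP.
by exists (exist _ q qL); rewrite ?inE.
Qed.

Section DeleteLine.
Variables (L : {set PG32}) (U : {vspace 'rV['F_2]_4}).
Hypotheses (U2 : \dim U = 2%N) (LE : L = [set q : PG32_point | val q \in U]).

Lemma card_PGL : #|delete L| = 12%N.
Proof.
rewrite -cardsT.
transitivity #|[set x : delete L | PGL_val x != 0]|.
  by apply: eq_card => x; rewrite !inE PGL_val_neq0.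
rewrite (card_delete_line (P := fun v => v != 0) _ LE) ?eqxx //.
have := cardsC [set v in U]; rewrite card_vspace_rV4 U2 card_mx card_Fp // => h.
have -> : [set v | (v != 0) && (v \notin U)] = ~: [set v in U].
  by apply/setP=> v; rewrite !inE; have [->|] := eqVneq v 0; rewrite ?mem0v.
by apply/eqP; rewrite -(eqn_add2l (2 ^ 2)) h.
Qed.

Lemma rank_PGL : rk (delete L) setT = 4%N.
Proof.
rewrite (rep_rk _ (@rep_PGL L)).
suff -> : sp (@PGL_val L) setT = fullv by rewrite dimvf.
apply/eqP; rewrite eqEsubv subvf; apply/subvP=> v _.
have out w : w \notin U -> w \in sp (@PGL_val L) setT.
  move=> wU; have w0 : w != 0 by apply: contraNneq wU => ->; exact: mem0v.
  pose q : PG32_point := exist _ w w0.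
  have qL : q \notin set0 :|: L by rewrite LE !inE.
  by apply: (@mem_sp _ _ (@PGL_val L) setT (exist _ q qL)).
have [vU|] := boolP (v \in U); last exact: out.
have [x xU] : exists x, x \notin U.
  apply/existsP; rewrite -negb_forall; apply/forallP=> h.
  have : \dim U = 4%N.
    have -> : U = fullv by apply/eqP; rewrite eqEsubv subvf; apply/subvP=> w _; exact: h.
    by rewrite dimvf.
  by rewrite U2.
apply: (memv_eq (memvD (out _ xU) (out (x + v) _))); last by f2.
by rewrite rpredDr.
Qed.

(** A nonzero functional is 1 at 8 of the 16 vectors, and at none or two of the four vectors of
    [U]. *)
Lemma cocycle_PGL (u : 'Hom('rV['F_2]_4, F2)) :
  cocycle (@PGL_val L) u = set0 \/ (6 <= #|cocycle (@PGL_val L) u| <= 8)%N.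
Proof.
have [|/set0Pn[x ux]] := eqVneq (cocycle (@PGL_val L) u) set0; [by left|right].
rewrite (card_delete_line (P := fun v => u v != 0) _ LE) ?linear0 ?eqxx //.
have [] := half_vspace fullv u.
  move/eqP; rewrite cards_eq0 => /eqP/setP/(_ (PGL_val x)); rewrite !inE memvf.
  by move: ux; rewrite inE => ->.
rewrite dimvf /= => h.
have := half_vspace U u; rewrite U2 /= => h2.
have := cardsID [set v in U] [set v | u v != 0].
rewrite (_ : _ :&: _ = [set v in U | u v != 0]); last by apply/setP=> v; rewrite !inE andbC.
rewrite (_ : _ :\: _ = [set v | (u v != 0) && (v \notin U)]); last first.
  by apply/setP=> v; rewrite !inE andbC.
have -> : #|[set v | u v != 0]| = 8%N.
  suff : (2 * #|[set v | (u v != 0)%R]| = 2 * 8)%N by move/eqP; rewrite eqn_pmul2l // => /eqP.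
  by apply: etrans h; congr (2 * _)%N; apply: eq_card => v; rewrite !inE memvf.
have key i j : i = 0%N \/ (2 * i = 2 ^ 2)%N -> (i + j = 8)%N -> (6 <= j <= 8)%N by lia.
exact: (key _ _ h2).
Qed.

Lemma PGL_not_small : ~ small_graphic (delete L).
Proof.
case=> B [V [p [T [a [b [T4 Tev ker r]]]]]]; pose f e := p (a e) + p (b e).
have [phi phiE] := rep_hom (@rep_PGL L) r.
have cc u : cocycle f u = set0 \/ (6 <= #|cocycle f u| <= 8)%N.
  have -> : cocycle f u = cocycle (@PGL_val L) (u \o phi)%VF.
    by apply/setP=> e; rewrite !inE comp_lfunE phiE.
  exact: cocycle_PGL.
have cc6 u : cocycle f u = set0 \/ (6 <= #|cocycle f u|)%N.
  by have [|/andP[]] := cc u; [left|right].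
have := star_count T4 Tev ker r cc6; rewrite rank_PGL card_PGL.
(* The first two bounds fail because 30 and 26 exceed 24. The third leaves at most 12 for the four
   stars in [T], while any two have at least 6 elements together: all have exactly 3 and they are
   disjoint. *)
case=> // -[cT]; have [s [t [x [y [un TE sumE]]]]] := cards4 cT; rewrite sumE => le pair.
move: un; rewrite /= !inE !negb_or -!andbA => /and5P[st sx sy tx /andP[ty /andP[xy _]]].
have pr i j : i \in T -> j \in T -> i != j -> (6 + 2 * #|cut a b [set i] :&: cut a b [set j]| <=
    #|cut a b [set i]| + #|cut a b [set j]|)%N.
  by move=> iT jT ij; rewrite -card_symdiff leq_add2r -cut2 //; exact: pair.
have := (pr s t, pr s x, pr s y, pr t x, pr t y, pr x y); rewrite !TE !inE !eqxx ?orbT.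
case=> -[-[-[-[h1 h2] h3] h4] h5] h6.
have {}h1 := h1 isT isT st. have {}h2 := h2 isT isT sx. have {}h3 := h3 isT isT sy.
have {}h4 := h4 isT isT tx. have {}h5 := h5 isT isT ty. have {}h6 := h6 isT isT xy.
have dis i j e : (6 + 2 * #|cut a b [set i] :&: cut a b [set j]| <= 6)%N ->
    (e \in cut a b [set i]) && (e \in cut a b [set j]) = false.
  move=> h; rewrite -in_setI; have /eqP : #|cut a b [set i] :&: cut a b [set j]| = 0%N.
    by move: h; clear; lia.
  by rewrite cards_eq0 => /eqP ->; rewrite inE.
have cstar i : i \in T -> #|cut a b [set i]| = 3%N by rewrite TE !inE => /or4P[] /eqP->;
  move: le h1 h2 h3 h4 h5 h6; clear; lia.
have [cs ct cx cy] : [/\ #|cut a b [set s]| = 3, #|cut a b [set t]| = 3,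
    #|cut a b [set x]| = 3 & #|cut a b [set y]| = 3]%N by split; apply: cstar; rewrite TE !inE eqxx ?orbT.
rewrite cs ct cx cy in h1 h2 h3 h4 h5 h6.
have d6 i j : i != j -> #|cut a b [set i]| = 3%N -> #|cut a b [set j]| = 3%N ->
    (6 + 2 * #|cut a b [set i] :&: cut a b [set j]| <= 6)%N -> #|cut a b [set i; j]| = 6%N.
  by move=> ij ci cj h; have := card_symdiff (cut a b [set i]) (cut a b [set j]);
    rewrite cut2 //; move: ci cj h; clear; lia.
have : #|cut a b T| = 12%N.
  have -> : T = symdiff [set s; t] [set x; y].
    apply/setP=> z; rewrite TE in_symdiff !inE.
    have [->|] := eqVneq z s; first by rewrite (negPf sx) (negPf sy).
    have [->|_ _] := eqVneq z t; first by rewrite (negPf tx) (negPf ty).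
    by [].
  rewrite cut_symdiff; have := card_symdiff (cut a b [set s; t]) (cut a b [set x; y]).
  rewrite (d6 s t) // (d6 x y) // (_ : _ :&: _ = set0) ?cards0 ?muln0 ?addn0 //.
  apply/setP=> e; rewrite in_setI !cut2 // !in_symdiff in_set0.
  have := (dis s x e h2, dis s y e h3, dis t x e h4, dis t y e h5).
  by case: (e \in cut a b [set s]); case: (e \in cut a b [set t]) => //=;
    case: (e \in cut a b [set x]); case: (e \in cut a b [set y]); case=> -[[]].
have [|u ->] := @cut_cocycle _ _ _ p T a b ker T.
  by right; rewrite setIid.
rewrite -/f; have [->|/andP[_ h] e] := cc u; first by rewrite cards0.
by move: h; rewrite e.
Qed.

End DeleteLine.

Theorem theorem9p3 (VTH : vertical_template_hypothesis) :
  exists k n : nat, (0 < k)%N /\ (0 < n)%N /\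
    forall M : matroid, binary M -> vertically_connected k M ->
      has_minor M (MK n) ->
      ((~ has_PG32_delete_line_minor M /\ ~ has_minor M (dual (MK 6))) <->
       even_cycle_with_blocking_pair M).
Proof.
have [k [n [k0 [n0 fwd]]]] := forward VTH.
exists k, n; split=> //; split=> // M bM cM nM; split=> [[noPG _]|ecM]; first exact: fwd.
have qM := even_cycle_quad_graphic ecM.
split=> [[L [U U2 LE]]|] /(quad_graphic_minor qM); first exact: (PGL_not_small U2 LE).
exact: dual_MK6_not_small.
Qed.
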